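(* Let $n\in\mathbb{N}$ and let $\widetilde{J}_{n+1}=[1\ n{+}1]+[2\ n{+}1]+\cdots+[n\ n{+}1]\in\mathbb{C}[\widetilde{\mathfrak{S}}_{n+1}]$. Then for every $(\lambda,\gamma)\in(\widetilde{\mathfrak{S}}_n)^\wedge_{\mathrm{spin}}$ and every $k\in\mathbb{N}$ (that is, $k\ge 1$), $$\frac{\chi^{(\lambda,\gamma)}\bigl(\widetilde{E}_n\widetilde{J}_{n+1}^{\,2k}\bigr)}{\dim(\lambda,\gamma)}=\sum_{\mu\in\mathcal{SP}_{n+1}:\ \mu\searrow\lambda}\Bigl(\frac{c(\mu/\lambda)\,(c(\mu/\lambda)+1)}{2}\Bigr)^k\,\mathfrak{m}_{D(\lambda)}\bigl(\{c(\mu/\lambda),\,-c(\mu/\lambda)-1\}\bigr).$$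
   Context: Group. For $n\ge 1$, $\widetilde{\mathfrak{S}}_n$ is the group generated by $z,r_1,\dots,r_{n-1}$ with relations $z^2=e$, $r_iz=zr_i$, $r_i^2=e$, $(r_ir_{i+1})^3=e$, $r_ir_j=zr_jr_i$ for $|i-j|\ge 2$. It is a double cover of $\mathfrak{S}_n$ via $\Phi(z)=e$, $\Phi(r_i)=(i\ i{+}1)$, and $\widetilde{\mathfrak{S}}_n\subset\widetilde{\mathfrak{S}}_{n+1}$ by identifying generators. For $1\le i<j$ put $[i\ j]=z^{j-i-1}r_{j-1}\cdots r_{i+1}r_ir_{i+1}\cdots r_{j-1}$ and $[j\ i]=z[i\ j]$; for distinct $i_1,\dots,i_p$ put $[i_1\ \cdots\ i_p]=[i_{p-1}\ i_p]\cdots[i_2\ i_p][i_1\ i_p]$ (equal to $e$ if $p=1$). The linear map $\widetilde{E}_n:\mathbb{C}[\widetilde{\mathfrak{S}}_{n+1}]\to\mathbb{C}[\widetilde{\mathfrak{S}}_n]$ sends $x\in\widetilde{\mathfrak{S}}_n$ to $x$ and $x\in\widetilde{\mathfrak{S}}_{n+1}\setminus\widetilde{\mathfrak{S}}_n$ to $0$. Characters are extended linearly to the group algebra. Spin irreducible representations. An irreducible complex representation of $\widetilde{\mathfrak{S}}_n$ is spin if $z$ acts as $-1$; $(\widetilde{\mathfrak{S}}_n)^\wedge_{\mathrm{spin}}$ is the set of equivalence classes of these. $\mathcal{SP}_n$ is the set of strict partitions of $n$ (distinct parts); $\mathcal{OP}_n$ the set of partitions of $n$ with all parts odd; $l(\cdot)$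 is the number of parts; $\epsilon(\lambda)\in\{0,1\}$ is the parity of $n-l(\lambda)$. The elements of $(\widetilde{\mathfrak{S}}_n)^\wedge_{\mathrm{spin}}$ are labelled by pairs $(\lambda,\gamma)$, $\lambda\in\mathcal{SP}_n$, $\gamma\in\{1,-1\}$, where $(\lambda,1)=(\lambda,-1)$ (self-associate) if $\epsilon(\lambda)=0$, and $(\lambda,1)\ne(\lambda,-1)$ with $(\lambda,-1)=\mathrm{sgn}\cdot(\lambda,1)$ if $\epsilon(\lambda)=1$. The character $\chi^{(\lambda,\gamma)}$ is determined on odd-type elements by Schur's formula $Q_\lambda=\sum_{\rho\in\mathcal{OP}_n}2^{(l(\lambda)+l(\rho)+\epsilon(\lambda))/2}z_\rho^{-1}\chi^{(\lambda,\gamma)}([\rho])\,p_\rho$, where $Q_\lambda$ is Schur's $Q$-function, $p_\rho$ the power sum, $z_\rho=\prod_j j^{m_j(\rho)}m_j(\rho)!$ and $[\rho]=[1\cdots\rho_1][\rho_1{+}1\cdots\rho_1{+}\rho_2]\cdots$. $\dim(\lambda,\gamma)$ is the dimension. Diagrams. The shifted diagram $S(\lambda)$ of $\lambda\in\mathcal{SP}_n$ has boxes $(i,j)$ with $i\le j\le i+\lambda_i-1$. Write $\lambda\nearrow\mu$ or $\mu\searrow\lambda$ if $S(\mu)$ is $S(\lambda)$ plus one box $\mu/\lambda=(i,j)$; its content is $c(\mu/\lambda)=j-i$. $D(\lambda)$ is the (ordinary) Young diagram with $2n$ boxes whose Frobenius coordinates are $(\lambda_1-1,\dots,\lambda_l-1\,|\,\lambda_1,\dots,\lambda_l)$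 (arms $|$ legs), $l=l(\lambda)$. For a Young diagram let $x_1<y_1<x_2<\cdots<y_{r-1}<x_r$ be its interlacing coordinates: $x_i$ are the contents (column minus row) of the addable boxes and $y_i$ the contents of the removable boxes. Its (Kerov) transition measure $\mathfrak{m}$ is the probability supported on $\{x_1,\dots,x_r\}$ with $\prod_{i=1}^{r-1}(\zeta-y_i)/\prod_{i=1}^r(\zeta-x_i)=\sum_{i=1}^r\mathfrak{m}(\{x_i\})/(\zeta-x_i)$. *)

(* Defs.v *)
From HB Require Import structures.
From mathcomp Require Import all_boot all_order all_algebra all_fingroup.
From mathcomp Require Import mxrepresentation.
From mathcomp Require Import zify.
From mathcomp Require boolp.

Set Implicit Arguments.
Unset Strict Implicit.
Unset Printing Implicit Defensive.

Import Order.TTheory GRing.Theory Num.Theory.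

Local Open Scope group_scope.

(* [None] stands for z and [Some k] for r_(k+1), where k < n - 1.  Since the   *)
(* relations make every generator an involution, words without inverses       *)
(* suffice to present the group.                                              *)
Notation letter n := (option 'I_n.-1).
Notation word n := (seq (letter n)).

Inductive spin_eq n : word n -> word n -> Prop :=
| SpinRefl u : spin_eq u u
| SpinSym u v : spin_eq u v -> spin_eq v u
| SpinTrans u v w : spin_eq u v -> spin_eq v w -> spin_eq u w
| SpinCat u u' v v' :
    spin_eq u u' -> spin_eq v v' -> spin_eq (u ++ v) (u' ++ v')
| SpinZZ : spin_eq [:: None; None] [::]
| SpinRZ (i : 'I_n.-1) : spin_eq [:: Some i; None] [:: None; Some i]
| SpinRR (i : 'I_n.-1) : spin_eq [:: Some i; Some i] [::]
| SpinBraid (i j : 'I_n.-1) : j = i.+1 :> nat ->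
    spin_eq (flatten (nseq 3 [:: Some i; Some j])) [::]
| SpinFar (i j : 'I_n.-1) : (i.+1 < j) || (j.+1 < i) ->
    spin_eq [:: Some i; Some j] [:: None; Some j; Some i].

Definition spin_rel n : rel (word n) := fun u v => boolp.asbool (spin_eq u v).

Lemma spin_relP n (u v : word n) : reflect (spin_eq u v) (spin_rel u v).
Proof. exact: boolp.asboolP. Qed.

Lemma spin_rel_refl n : reflexive (@spin_rel n).
Proof. by move=> u; apply/spin_relP; apply: SpinRefl. Qed.

Lemma spin_rel_sym n : symmetric (@spin_rel n).
Proof. by move=> u v; apply/spin_relP/spin_relP; apply: SpinSym. Qed.

Lemma spin_rel_trans n : transitive (@spin_rel n).
Proof.
move=> v u w /spin_relP uv /spin_relP vw; apply/spin_relP.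
exact: SpinTrans uv vw.
Qed.

Canonical spin_equiv n :=
  EquivRel (@spin_rel n) (@spin_rel_refl n) (@spin_rel_sym n)
           (@spin_rel_trans n).

Definition spin_sym n : Type := {eq_quot (@spin_equiv n)}%qT.
HB.instance Definition _ n := Choice.on (spin_sym n).

Definition spin_class n (u : word n) : spin_sym n :=
  (\pi_({eq_quot (@spin_equiv n)}) u)%qT.
Definition spin_word n (g : spin_sym n) : word n :=
  generic_quotient.repr (g : {eq_quot (@spin_equiv n)}%qT).

Lemma spin_wordK n : cancel (@spin_word n) (@spin_class n).
Proof. by move=> g; apply: reprK. Qed.

Lemma spin_classE n (u v : word n) : spin_class u = spin_class v <-> spin_eq u v.
Proof.
split; last by move=> uv; apply/eqmodP/spin_relP.
by move/eqmodP/spin_relP.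
Qed.

Lemma spin_classK n (u : word n) : spin_eq (spin_word (spin_class u)) u.
Proof. by apply/spin_classE; rewrite spin_wordK. Qed.

Section SpinGroup.
Variable n : nat.
Implicit Types (g h : spin_sym n) (u v : word n).

Definition spin_mul g h := spin_class (spin_word g ++ spin_word h).
Definition spin_one : spin_sym n := spin_class [::].
Definition spin_inv g := spin_class (rev (spin_word g)).

Lemma spin_class_cat u v : spin_mul (spin_class u) (spin_class v) = spin_class (u ++ v).
Proof. by apply/spin_classE; apply: SpinCat; apply: spin_classK. Qed.

Lemma spin_mulA : associative spin_mul.
Proof.
move=> x y w; rewrite -[x]spin_wordK -[y]spin_wordK -[w]spin_wordK.
by rewrite !spin_class_cat catA.
Qed.

Lemma spin_mul1 : left_id spin_one spin_mul.
Proof. by move=> x; rewrite -[x]spin_wordK spin_class_cat. Qed.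

Lemma spin_mulr1 : right_id spin_one spin_mul.
Proof. by move=> x; rewrite -[x]spin_wordK spin_class_cat cats0. Qed.

Lemma spin_catV u : spin_eq (rev u ++ u) [::].
Proof.
elim: u => [|a u IHu] /=; first exact: SpinRefl.
rewrite rev_cons -cats1 -catA /=.
apply: SpinTrans IHu; apply: SpinCat; first exact: SpinRefl.
apply: (@SpinCat _ [:: a; a] [::]); last exact: SpinRefl.
by case: a => [i|]; [apply: SpinRR | apply: SpinZZ].
Qed.

Lemma spin_mulV : left_inverse spin_one spin_inv spin_mul.
Proof.
move=> g; rewrite -{2}[g]spin_wordK spin_class_cat.
by apply/spin_classE; apply: spin_catV.
Qed.

Lemma spin_mulrV : right_inverse spin_one spin_inv spin_mul.
Proof.
move=> g; rewrite -{1}[g]spin_wordK spin_class_cat.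
apply/spin_classE; rewrite -{1}[spin_word g]revK; apply: spin_catV.
Qed.

End SpinGroup.

HB.instance Definition _ n := isGroup.Build (spin_sym n)
  (@spin_mulA n) (@spin_mul1 n) (@spin_mulr1 n) (@spin_mulV n) (@spin_mulrV n).

Definition spin_z n : spin_sym n := spin_class [:: None].

(* r_i for 1 <= i < n; the value outside this range is irrelevant. *)
Definition spin_r n (i : nat) : spin_sym n :=
  if insub i.-1 is Some k then spin_class [:: Some k] else 1.

Section SpinTheory.
Variable n : nat.
Local Notation z := (spin_z n).
Local Notation s k := (spin_r n k.+1).

Lemma spin_rE (k : 'I_n.-1) : s k = spin_class [:: Some k].
Proof. by rewrite /spin_r /= valK. Qed.

Lemma spin_mulE (u v : word n) :
  spin_class u * spin_class v = spin_class (u ++ v).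
Proof. exact: spin_class_cat. Qed.

Lemma spin_class2 a b (u : word n) :
  spin_class [:: a, b & u] = spin_class [:: a] * spin_class (b :: u).
Proof. by rewrite spin_mulE. Qed.

Lemma spin_zz : z * z = 1.
Proof. by rewrite spin_mulE; apply/spin_classE/SpinZZ. Qed.

Lemma spin_rz i : s i * z = z * s i.
Proof.
rewrite /spin_r; case: insubP => [k _ _|_]; last by rewrite mul1g mulg1.
by rewrite !spin_mulE; apply/spin_classE/SpinRZ.
Qed.

Lemma spin_rr i : s i * s i = 1.
Proof.
rewrite /spin_r; case: insubP => [k _ _|_]; last by rewrite mul1g.
by rewrite !spin_mulE; apply/spin_classE/SpinRR.
Qed.

Lemma spin_rr3 i : i.+1 < n.-1 -> (s i * s i.+1) ^+ 3 = 1.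
Proof.
move=> lt_i1; have lt_i := ltnW lt_i1.
rewrite (spin_rE (Ordinal lt_i)) (spin_rE (Ordinal lt_i1)) !expgS expg0 mulg1.
have /spin_classE := @SpinBraid n (Ordinal lt_i) (Ordinal lt_i1) erefl.
by rewrite /= !spin_class2 !mulgA.
Qed.

Lemma spin_far i j : i < n.-1 -> j < n.-1 -> (i.+1 < j) || (j.+1 < i) ->
  s i * s j = z * s j * s i.
Proof.
move=> lt_i lt_j ij.
rewrite (spin_rE (Ordinal lt_i)) (spin_rE (Ordinal lt_j)).
have /spin_classE := @SpinFar n (Ordinal lt_i) (Ordinal lt_j) ij.
by rewrite !spin_class2 mulgA.
Qed.

Lemma spin_braid i : i.+1 < n.-1 ->
  s i.+1 * s i * s i.+1 = s i * s i.+1 * s i.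
Proof.
move=> lt_i; have := spin_rr3 lt_i; rewrite !expgS expg0 mulg1 !mulgA => e.
apply: (mulgI (s i * s i.+1 * s i)); rewrite !mulgA e.
by rewrite -!mulgA (mulgA (s i) (s i)) spin_rr mul1g
  (mulgA (s i.+1) (s i.+1)) spin_rr mul1g spin_rr.
Qed.

Lemma spin_zC (g : spin_sym n) : g * z = z * g.
Proof.
rewrite -[g]spin_wordK; elim: (spin_word g) => [|a u IHu].
  by rewrite -[spin_class _]/(1 : spin_sym n) mul1g mulg1.
rewrite -[a :: u]/([:: a] ++ u) -spin_mulE -mulgA IHu !mulgA; congr (_ * _).
by case: a => [k|//]; rewrite -spin_rE spin_rz.
Qed.

(* The group is finite: inductively, every element of the subgroup generated  *)
(* by z and the s_i, i <= m, is h * s_m s_(m-1) ... s_(m-t+1) with h in the   *)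
(* subgroup generated by z and the s_i, i < m.                                *)
Inductive spin_sub (m : nat) : spin_sym n -> Prop :=
| SpinSub1 : spin_sub m 1
| SpinSubZ g : spin_sub m g -> spin_sub m (g * z)
| SpinSubR g i : i < m -> spin_sub m g -> spin_sub m (g * s i).

Lemma spin_subM m g h : spin_sub m g -> spin_sub m h -> spin_sub m (g * h).
Proof.
move=> Hg; elim=> {h} [|h _ IHh|h i im _ IHh]; rewrite ?mulg1 ?mulgA //.
  exact: SpinSubZ.
exact: SpinSubR.
Qed.

Lemma spin_sub_z m b : spin_sub m (z ^+ b).
Proof.
elim: b => [|b IHb]; first exact: SpinSub1.
by rewrite expgSr; apply: SpinSubZ.
Qed.

Lemma spin_sub_zr m b i : i < m -> spin_sub m (z ^+ b * s i).
Proof. by move=> im; apply: SpinSubR => //; apply: spin_sub_z. Qed.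

Fixpoint spin_desc m t : spin_sym n :=
  if t is t'.+1 then spin_desc m t' * s (m - t') else 1.

Lemma spin_desc_low m t i : m < n.-1 -> i + t < m ->
  exists b, spin_desc m t * s i = z ^+ b * s i * spin_desc m t.
Proof.
move=> lt_m; elim: t => [|t IHt] it /=; first by exists 0; rewrite !mul1g mulg1.
have [|b Eb] := IHt; first by lia.
exists b.+1; rewrite -mulgA spin_far; [|lia..].
by rewrite !mulgA spin_zC -(mulgA z) Eb expgS !mulgA.
Qed.

Lemma spin_desc_high m t i : m < n.-1 -> t <= m.+1 -> i <= m -> m.+1 < i + t ->
  exists b, spin_desc m t * s i = z ^+ b * s i.-1 * spin_desc m t.
Proof.
move=> lt_m; elim: t => [|t IHt] tm im it /=; first by lia.
have [lt_it|le_it] := ltnP m.+1 (i + t).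
  have [|||b Eb] := IHt; [lia..|].
  exists b.+1; rewrite -mulgA spin_far; [|lia..].
  by rewrite !mulgA spin_zC -(mulgA z) Eb expgS !mulgA.
have [t' Et] : exists t', t = t'.+1 by exists t.-1; lia.
have [j Ei] : exists j, i = j.+1 by exists i.-1; lia.
rewrite Et Ei /= in le_it it tm im *.
have -> : m - t' = j.+1 by lia.
have -> : m - t'.+1 = j by lia.
have [|b Eb] := @spin_desc_low m t' j lt_m; first by lia.
exists b; rewrite -!mulgA (mulgA (s j.+1)) spin_braid; last by lia.
by rewrite !mulgA Eb.
Qed.

Lemma spin_sub_dec m g : m < n.-1 -> spin_sub m.+1 g ->
  exists h t, [/\ spin_sub m h, t <= m.+1 & g = h * spin_desc m t].
Proof.
move=> lt_m; elim=> {g} [|g _ [h [t [Hh tm ->]]]|g i im _ [h [t [Hh tm ->]]]].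
- by exists 1, 0; split; [apply: SpinSub1 | | rewrite mulg1].
- exists (h * z), t; split=> //; first exact: SpinSubZ.
  by rewrite -!mulgA spin_zC.
have [lt_it|] := ltnP (i + t) m.
  have [b Eb] := spin_desc_low lt_m lt_it.
  exists (h * (z ^+ b * s i)), t; split=> //; last by rewrite -mulgA Eb !mulgA.
  by apply: spin_subM => //; apply: spin_sub_zr; lia.
have [lt_it _|le_it ge_it] := ltnP m.+1 (i + t).
  have [|b Eb] := spin_desc_high lt_m tm _ lt_it; first by lia.
  exists (h * (z ^+ b * s i.-1)), t; split=> //; last by rewrite -mulgA Eb !mulgA.
  by apply: spin_subM => //; apply: spin_sub_zr; lia.
have [Em|Em] : i = m - t /\ t <= m \/ exists2 t', t = t'.+1 & i = m - t'.
- have [?|?] := eqVneq (i + t) m; first by left; lia.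
  by right; exists t.-1; lia.
- exists h, t.+1; split=> //; first by lia.
  by rewrite /= -Em.1 mulgA.
case: Em => t' Et Ei; exists h, t'; split=> //; first by lia.
by rewrite Et /= Ei -!mulgA spin_rr mulg1.
Qed.

Fixpoint spin_enum m : seq (spin_sym n) :=
  if m is m'.+1 then [seq h * spin_desc m' t | h <- spin_enum m', t <- iota 0 m'.+2]
  else [:: 1; z].

Lemma spin_enumP m g : m <= n.-1 -> spin_sub m g -> g \in spin_enum m.
Proof.
elim: m g => [|m IHm] g lt_m.
  elim=> {g} [|g _|g i //]; rewrite !inE ?eqxx //.
  by case/orP=> /eqP->; rewrite ?spin_zz ?mul1g eqxx ?orbT.
case/(spin_sub_dec lt_m) => h [t [Hh tm ->]].
apply: allpairs_f; first by apply: IHm => //; apply: ltnW.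
by rewrite mem_iota; lia.
Qed.

Lemma spin_sub_all (g : spin_sym n) : spin_sub n.-1 g.
Proof.
rewrite -[g]spin_wordK; elim/last_ind: (spin_word g) => [|u a IHu].
  exact: SpinSub1.
rewrite -cats1 -spin_mulE; case: a => [k|]; last exact: SpinSubZ.
by rewrite -spin_rE; apply: SpinSubR.
Qed.

Lemma mem_spin_enum (g : spin_sym n) : g \in undup (spin_enum n.-1).
Proof. by rewrite mem_undup; apply: spin_enumP => //; apply: spin_sub_all. Qed.

Lemma spin_pickleK : pcancel (fun g => index g (undup (spin_enum n.-1)))
  (fun i => Some (nth 1 (undup (spin_enum n.-1)) i)).
Proof. by move=> g; rewrite nth_index ?mem_spin_enum. Qed.

End SpinTheory.

HB.instance Definition _ n :=
  Choice_isCountable.Build (spin_sym n) (@spin_pickleK n).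
HB.instance Definition _ n := isFinite.Build (spin_sym n)
  (Finite.uniq_enumP (undup_uniq (spin_enum n n.-1)) (@mem_spin_enum n)).

Definition spin_lift n (H : groupType) (f : letter n -> H) (g : spin_sym n) : H :=
  \prod_(a <- spin_word g) f a.

Section SpinLift.
Variables (n : nat) (H : groupType) (f : letter n -> H).
Hypothesis fzz : f None * f None = 1.
Hypothesis frz : forall i, f (Some i) * f None = f None * f (Some i).
Hypothesis frr : forall i, f (Some i) * f (Some i) = 1.
Hypothesis fbraid : forall i j : 'I_n.-1, j = i.+1 :> nat ->
  (f (Some i) * f (Some j)) ^+ 3 = 1.
Hypothesis ffar : forall i j : 'I_n.-1, (i.+1 < j) || (j.+1 < i) ->
  f (Some i) * f (Some j) = f None * f (Some j) * f (Some i).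

Lemma spin_eq_prod u v : spin_eq u v -> \prod_(a <- u) f a = \prod_(a <- v) f a.
Proof.
elim=> {u v}
    [u|u v _ ->|u v w _ -> _ ->|u u' v v' _ IHu _ IHv||i|i|i j ij|i j ij] //.
- by rewrite !big_cat /= IHu IHv.
- by rewrite !big_cons !big_nil mulg1.
- by rewrite !big_cons !big_nil !mulg1.
- by rewrite !big_cons !big_nil mulg1.
- by rewrite !big_cons !big_nil mulg1 -[RHS](fbraid ij) !expgS expg0 mulg1 !mulgA.
- by rewrite !big_cons !big_nil !mulg1 ffar ?mulgA.
Qed.

Lemma spin_lift_class u : spin_lift f (spin_class u) = \prod_(a <- u) f a.
Proof. exact/spin_eq_prod/spin_classK. Qed.

Lemma spin_liftM : {morph spin_lift f : g h / g * h}.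
Proof.
move=> g h; rewrite -[g]spin_wordK -[h]spin_wordK spin_mulE.
by rewrite !spin_lift_class big_cat.
Qed.

End SpinLift.

(* The letter [Some k], i.e. r_(k+1), goes to the transposition of k and k+1, *)
(* as points of 'I_n = {0, ..., n-1}.                                         *)
Definition perm_letter n (a : letter n) : 'S_n :=
  if a is Some k then
    tperm (Ordinal (leq_trans (ltn_ord k) (leq_pred n)))
          (Ordinal (etrans (esym (ltn_predRL k n)) (ltn_ord k)))
  else 1.

Definition spin_perm n : spin_sym n -> 'S_n := spin_lift (@perm_letter n).

Lemma spin_permM n : {morph @spin_perm n : g h / g * h}.
Proof.
apply: spin_liftM => [|i|i|i j ij|i j ij] /=; rewrite ?mulg1 ?mul1g ?tperm2 //.
  rewrite !expgS expg0 mulg1.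
  set x := tperm _ _; set y := tperm _ _.
  have xy : y ^ x = x ^ y.
    have V (s : 'S_n) a b : s ^ tperm a b = tperm a b * s * tperm a b.
      by rewrite conjgE tpermV mulgA.
    rewrite [in LHS]/y [in RHS]/x !tpermJ /x /y.
    set a := Ordinal _; set b := Ordinal _; set c := Ordinal _; set d := Ordinal _.
    have -> : b = c by apply/val_inj; rewrite /= ij.
    by rewrite tpermR tpermD ?tpermL ?tpermD //; apply/eqP => /(congr1 val) /=; lia.
  have -> : x * y * (x * y * (x * y)) = x * y * x * (y * x * y) by rewrite !mulgA.
  have -> : x * y * x = y ^ x by rewrite conjgE tpermV mulgA.
  have -> : y * x * y = x ^ y by rewrite conjgE tpermV mulgA.
  by rewrite xy -conjMg tperm2 conj1g.
by rewrite conjgC tpermJ !tpermD //; apply/eqP => /(congr1 val) /=; lia.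
Qed.

Definition spin_embed n : spin_sym n -> spin_sym n.+1 :=
  spin_lift (fun a : letter n =>
    if a is Some k then spin_r n.+1 k.+1 else spin_z n.+1).

Lemma spin_embedM n : {morph @spin_embed n : g h / g * h}.
Proof.
have lt (i : 'I_n.-1) : i < n.+1.-1 by apply: leq_trans (ltn_ord i) (leq_pred n).
apply: spin_liftM => [|i|i|i j ij|i j ij].
- exact: spin_zz.
- exact: spin_rz.
- exact: spin_rr.
- by rewrite ij spin_rr3 // -ij.
- exact: spin_far.
Qed.

Definition spin_transp n (i j : nat) : spin_sym n :=
  let up a b := spin_z n ^+ (b - a - 1) *
    (\prod_(k <- rev (iota a.+1 (b - a - 1))) spin_r n k) * spin_r n a *
    (\prod_(k <- iota a.+1 (b - a - 1)) spin_r n k) in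
  if i < j then up i j else spin_z n * up j i.

Definition spin_cycle n (s : seq nat) : spin_sym n :=
  let p := last 0 s in
  \prod_(i <- rev (take (size s).-1 s)) spin_transp n i p.

Fixpoint spin_type_from n (start : nat) (rho : seq nat) : spin_sym n :=
  if rho is r :: rho' then
    spin_cycle n (iota start r) * spin_type_from n (start + r) rho'
  else 1.

Definition spin_type n (rho : seq nat) : spin_sym n := spin_type_from n 1 rho.

Definition is_partition n (p : seq nat) : bool :=
  [&& sorted geq p, 0 \notin p & sumn p == n].

(* A partition of n has at most n parts, all of them at most n; this makes    *)
(* the partitions of n a finite type.                                         *)
Definition parts n (p : n.-bseq 'I_n.+1) : seq nat := map val p.

Definition strict_part n : Type :=
  {p : n.-bseq 'I_n.+1 | is_partition n (parts p) && uniq (parts p)}.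
HB.instance Definition _ n := Finite.on (strict_part n).
Definition strict_seq n (p : strict_part n) : seq nat := parts (val p).
Coercion strict_seq : strict_part >-> seq.

Definition odd_part n : Type :=
  {p : n.-bseq 'I_n.+1 | is_partition n (parts p) && all odd (parts p)}.
HB.instance Definition _ n := Finite.on (odd_part n).
Definition odd_seq n (p : odd_part n) : seq nat := parts (val p).
Coercion odd_seq : odd_part >-> seq.

Local Open Scope ring_scope.

Definition part_parity n (lam : strict_part n) : nat := odd (n - size lam).

(* z_rho, not to be confused with the central element z *)
Definition part_z (rho : seq nat) : nat :=
  (\prod_(j <- undup rho) (j ^ count_mem j rho * (count_mem j rho)`!))%N.

(* Boxes are (row, column), both numbered from 0: this does not affect the    *)
(* contents.                                                                  *)
Notation box := (nat * nat)%type.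

Definition content (b : box) : int := b.2%:Z - b.1%:Z.

Definition shifted_diagram (lam : seq nat) : seq box :=
  [seq (i, (i + t)%N) | i <- iota 0 (size lam), t <- iota 0 (nth 0%N lam i)].

Definition added_boxes (lam mu : seq nat) : seq box :=
  [seq b <- shifted_diagram mu | b \notin shifted_diagram lam].

Definition covers (lam mu : seq nat) : bool :=
  all [in shifted_diagram mu] (shifted_diagram lam) &&
  (size (added_boxes lam mu) == 1%N).

(* c(mu / lam); meaningful when [covers lam mu] *)
Definition skew_content (lam mu : seq nat) : int :=
  content (head (0%N, 0%N) (added_boxes lam mu)).

(* The diagram with Frobenius coordinates (a | b), as the union of its        *)
(* diagonal hooks.                                                            *)
Definition frobenius_diagram (a b : seq nat) : seq box :=
  flatten [seq (i, i) :: [seq (i, (i + t)%N) | t <- iota 1 (nth 0%N a i)]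
                      ++ [seq ((i + t)%N, i) | t <- iota 1 (nth 0%N b i)]
          | i <- iota 0 (size a)].

Definition double_diagram (lam : seq nat) : seq box :=
  frobenius_diagram (map predn lam) lam.

Definition is_young (D : seq box) : bool :=
  uniq D && all (fun b : box => ((b.1 == 0%N) || ((b.1.-1, b.2) \in D)) &&
                                ((b.2 == 0%N) || ((b.1, b.2.-1) \in D))) D.

Definition addable (D : seq box) (b : box) : bool :=
  (b \notin D) && is_young (b :: D).

Definition removable (D : seq box) (b : box) : bool :=
  (b \in D) && is_young (rem b D).

(* Every box of D and every addable box lies in this square. *)
Definition box_range (D : seq box) : seq box :=
  [seq (i, j) | i <- iota 0 (size D).+1, j <- iota 0 (size D).+1].

Definition kerov_x (D : seq box) : seq int :=
  [seq content b | b <- box_range D & addable D b].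

Definition kerov_y (D : seq box) : seq int :=
  [seq content b | b <- box_range D & removable D b].

(* [m x] is the mass at the integer point x. *)
Definition transition_measure (C : numFieldType) (D : seq box) (m : int -> C) :
    Prop :=
  [/\ forall x, 0 <= m x,
      forall x, x \notin kerov_x D -> m x = 0,
      \sum_(x <- kerov_x D) m x = 1
    & forall zeta : C, zeta \notin [seq x%:~R | x <- kerov_x D] ->
        (\prod_(y <- kerov_y D) (zeta - y%:~R)) /
        (\prod_(x <- kerov_x D) (zeta - x%:~R))
        = \sum_(x <- kerov_x D) m x / (zeta - x%:~R)].

(* Q_lam(x_1, ..., x_N) = 2^l sum_w w(x^lam prod_(i <= l, i < j) of           *)
(* (x_i + x_j) / (x_i - x_j)), w ranging over S_N / S_(N - l), l = l(lam)     *)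
(* (Macdonald, III.2 and III.8), at pairwise distinct values of the           *)
(* variables.                                                                 *)
Definition schurQ (C : fieldType) N (x : 'I_N -> C) (lam : seq nat) : C :=
  if (size lam <= N)%N then
    2 ^+ size lam / ((N - size lam)`!)%:R *
    \sum_(w : 'S_N) \prod_(i < N | (i < size lam)%N)
      (x (w i) ^+ nth 0%N lam i *
       \prod_(j < N | (i < j)%N) ((x (w i) + x (w j)) / (x (w i) - x (w j))))
  else 0.

Definition power_sum (C : fieldType) N (x : 'I_N -> C) (rho : seq nat) : C :=
  \prod_(r <- rho) \sum_(i < N) x i ^+ r.

Record spin_irr (C : numClosedFieldType) (n : nat) := SpinIrr {
  spin_dim : nat;
  spin_repr :> mx_representation C [set: spin_sym n]%G spin_dim;
  spin_repr_irr : mx_irreducible spin_repr;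
  spin_repr_z : spin_repr (spin_z n) = (-1)%:M
}.

Definition spin_char (C : numClosedFieldType) n (W : spin_irr C n)
  (g : spin_sym n) : C := \tr (W g).

Definition spin_sgn (C : numClosedFieldType) n (g : spin_sym n) : C :=
  (-1) ^+ odd_perm (spin_perm g).

(* An equality in the ring of symmetric functions amounts to its              *)
(* specialisations to finitely many variables, hence, C being infinite, to    *)
(* its values at pairwise distinct arguments.  The exponent                   *)
(* l(lam) + l(rho) + eps(lam) is even.                                        *)
Definition schur_formula (C : numClosedFieldType) n (lam : strict_part n)
    (W : spin_irr C n) : Prop :=
  forall N (x : 'I_N -> C), injective x ->
    schurQ x lam =
    \sum_(rho : odd_part n)
      2 ^+ ((size lam + size rho + part_parity lam)./2) *
      (part_z rho)%:R^-1 * spin_char W (spin_type n rho) * power_sum x rho.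

(* The sign gamma in {1, -1} is encoded as (-1)^b for a boolean b: [V lam     *)
(* false] is (lam, 1) and [V lam true] is (lam, -1).                          *)
Record spin_labelling (C : numClosedFieldType) n
    (V : strict_part n -> bool -> spin_irr C n) : Prop := SpinLabelling {
  spin_label_surj : forall W : spin_irr C n,
    exists lam gamma, mx_rsim W (V lam gamma);
  spin_label_inj : forall lam gamma lam' gamma',
    mx_rsim (V lam gamma) (V lam' gamma') <->
    lam = lam' /\ (part_parity lam = 1%N -> gamma = gamma');
  spin_label_sgn : forall lam, part_parity lam = 1%N -> forall g,
    spin_char (V lam true) g = spin_sgn C g * spin_char (V lam false) g;
  spin_label_schur : forall lam gamma, schur_formula lam (V lam gamma)
}.

(* An element of the group algebra is the function of its coefficients. *)
Definition galg (C : numClosedFieldType) n := {ffun spin_sym n -> C}.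

Section GroupAlgebra.
Variables (C : numClosedFieldType) (n : nat).

Definition galg_delta (g : spin_sym n) : galg C n := [ffun h => (h == g)%:R].

Definition galg_mul (a b : galg C n) : galg C n :=
  [ffun g => \sum_h a h * b (h^-1 * g)%g].

Definition galg_exp (a : galg C n) (k : nat) : galg C n :=
  iter k (galg_mul a) (galg_delta 1%g).

Definition jucys_murphy : galg C n :=
  \sum_(1 <= i < n) galg_delta (spin_transp n i n).

Definition galg_char (W : spin_irr C n) (a : galg C n) : C :=
  \sum_g a g * spin_char W g.

(* The coefficients at the elements of the smaller group, which embeds by     *)
(* [spin_embed], are kept and the others dropped.                             *)
Definition cond_exp (a : galg C n.+1) : galg C n :=
  [ffun g => a (spin_embed g)].

End GroupAlgebra.

(* Main.v *)
(* For a colouring phi of the n points by the rows of lam, let b_phi be the    *)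
(* sum over the stabiliser of phi of beta(g) g, where beta(g) is the constant  *)
(* coefficient of g in the Clifford algebra, in which [i j] acts as            *)
(* (c_i - c_j) / sqrt 2.  Up to a positive scalar b_phi is an idempotent, and  *)
(* Schur's formula computes the traces of all b_phi in the representation      *)
(* (lam, gamma): some sorted phi with lam_i points of colour i has b_phi <> 0, *)
(* while the colourings of higher weight vanish.  Consequently b_phi J_k^2 is  *)
(* c (c + 1) / 2 times b_phi, with c the content of the k-th box of lam.       *)
(* Conjugating J_k by [k k+1] relates the conditional expectations of J_k^(2r) *)
(* and J_(k+1)^(2r); applied to b_phi this says that, with q_c = c(c+1)/2,     *)
(* adding a box of content c divides their generating series by                *)
(* (1 - q_(c-1) t)(1 - q_(c+1) t) / (1 - q_c t)^2.  The product over the boxes *)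
(* telescopes in each row to prod_i (1 - q_(lam_i - 1) t) / (1 - q_(lam_i) t), *)
(* which is also the generating series of the moments of c(c+1)/2 for the      *)
(* transition measure of D(lam): evaluate its Cauchy transform at zeta and at  *)
(* -zeta-1, where c(c+1)/2 takes the same value.                               *)
From HB Require Import structures.
Require Import Defs.
From mathcomp Require Import all_boot all_order all_algebra all_fingroup.
From mathcomp Require Import mxrepresentation.
From mathcomp Require Import zify ring.

Set Implicit Arguments.
Unset Strict Implicit.
Unset Printing Implicit Defensive.

Import Order.TTheory GRing.Theory Num.Theory.

Local Open Scope ring_scope.

(** * Twisted group algebras and Clifford algebras *)

(** Sending z to -1 and [i j] to the Clifford element (c_i - c_j)/sqrt 2 ([cl_root]) gives the basic
    spin representation [kappa]; its normalised trace [beta] is a class function. Young subgroups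
    weighted by [beta] play the role of Young symmetrisers: for a colouring phi of the points,
    [young_elt] is a positive multiple of an idempotent ([young_elt_idem]). This is seen by adding
    points to colour classes one at a time, with [young_elt_merge] and [young_elt_own]. So the trace
    of b_phi in any representation is nonnegative, and it vanishes only if the operator does.

    The value of [beta] at [rho] is 2^((l(rho) - n)/2) when all parts are odd and 0 otherwise. Hence
    the generating function of the traces of the b_phi is Schur's expansion of Q_lambda up to a
    nonzero constant ([schur_trace]). Its leading monomial x^lambda yields a colouring with operator
    B = V(b_phi) <> 0, and positivity makes all colourings of higher weight act as 0
    ([highest_colouring]). In B J_k, the part of J_k over another colour has a square that is a
    multiple of such a vanishing operator; being self-adjoint, it vanishes against B itself. Only
    the part over the colour of k remains, and its square is a scalar in the Clifford algebra: B
    J_k^2 = c(c+1)/2 B.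

    From J_q = z [p q] J_p [p q] + [p q] with q = p + 1, and J_q J_p = z J_p J_q, comes a recursion
    linking the conditional expectations of the even powers of J_p and J_q ([jm_step],
    [jm_moment_step]). Multiplied by B it is a recursion of numbers ([jm_moment_level]). The last
    conditional expectation is a scalar by Schur's lemma, so B determines it ([jm_character]).

    As generating series the recursion is a product over the boxes that telescopes along the rows
    ([level_series]), and the moments of x(x+1)/2 under the transition measure have the same series
    ([kerov_series]). Addable corners of D(lambda) of nonzero content for a row that can grow come
    in pairs L, -L-1 with equal values of x(x+1)/2, which turns the moment into a sum over covers
    ([kerov_x_sum], [covers_sum]). *)

Record cocycle (C : fieldType) (gT : finGroupType) := Cocycle {
  cocycle_fun :> gT -> gT -> C;
  cocycleP : forall x y w, cocycle_fun x y * cocycle_fun (x * y)%g w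
                         = cocycle_fun y w * cocycle_fun x (y * w)%g;
  cocycle1g : forall x, cocycle_fun 1%g x = 1;
  cocycleg1 : forall x, cocycle_fun x 1%g = 1
}.

(** One ring construction serves twice: the trivial cocycle gives the group algebra, and the sign
    cocycle [cl_sgn] on a group of subsets gives the Clifford algebra. *)
Definition twisted (C : fieldType) (gT : finGroupType) (al : cocycle C gT) :
  Type := {ffun gT -> C}.

Section TwistedRing.
Variables (C : fieldType) (gT : finGroupType) (al : cocycle C gT).
Local Notation tw := (twisted al).

HB.instance Definition _ := GRing.Lmodule.copy tw {ffun gT -> C^o}.

Implicit Types (a b c : tw) (g h : gT).

Definition tw_fun a : gT -> C := (a : {ffun gT -> C}).
Definition tw_make (f : gT -> C) : tw := [ffun g => f g].
Definition tw_delta g : tw := tw_make (fun h => (h == g)%:R).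
Definition tw_mul a b : tw :=
  tw_make (fun g => \sum_h tw_fun a h * tw_fun b (h^-1 * g)%g * al h (h^-1 * g)%g).

Lemma tw_makeE f g : tw_fun (tw_make f) g = f g.
Proof. by rewrite /tw_fun /tw_make ffunE. Qed.

Lemma twP a b : (forall g, tw_fun a g = tw_fun b g) -> a = b.
Proof. by move=> ab; apply/ffunP. Qed.

Lemma tw_fun0 g : tw_fun 0 g = 0. Proof. by rewrite /tw_fun ffunE. Qed.
Lemma tw_funD a b g : tw_fun (a + b) g = tw_fun a g + tw_fun b g.
Proof. by rewrite /tw_fun ffunE. Qed.
Lemma tw_funZ k a g : tw_fun (k *: a) g = k * tw_fun a g.
Proof. by rewrite /tw_fun ffunE. Qed.
Lemma tw_funN a g : tw_fun (- a) g = - tw_fun a g.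
Proof. by rewrite /tw_fun ffunE. Qed.
Lemma tw_fun_sum I (r : seq I) (P : pred I) (F : I -> tw) g :
  tw_fun (\sum_(i <- r | P i) F i) g = \sum_(i <- r | P i) tw_fun (F i) g.
Proof.
by elim/big_rec2: _ => [|i x y _ <-]; rewrite ?tw_fun0 ?tw_funD.
Qed.

Lemma tw_mulA : associative tw_mul.
Proof.
move=> a b c; apply/twP => g; rewrite /tw_mul !tw_makeE.
transitivity (\sum_k \sum_h tw_fun a k * tw_fun b h * tw_fun c (h^-1 * (k^-1 * g))%g
   * (al h (h^-1 * (k^-1 * g))%g * al k (k^-1 * g)%g)).
  apply: eq_bigr => k _; rewrite tw_makeE mulr_sumr mulr_suml.
  by apply: eq_bigr => h _; rewrite !mulrA.
rewrite [RHS](eq_bigr (fun h => \sum_(k : gT) tw_fun a k * tw_fun b (k^-1 * h)%g *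
    tw_fun c (h^-1 * g)%g * (al k (k^-1 * h)%g * al h (h^-1 * g)%g))); last first.
  move=> h _; rewrite tw_makeE mulr_suml mulr_suml.
  by apply: eq_bigr => k _; rewrite !mulrA -!(mulrA _ (al _ _)) (mulrC (al _ _) (tw_fun _ _)) !mulrA.
rewrite [RHS]exchange_big; apply: eq_bigr => k _.
rewrite [RHS](reindex (fun h => k * h)%g) /=; last first.
  by exists (fun h => k^-1 * h)%g => h _; rewrite ?mulKg ?mulKVg.
apply: eq_bigr => h _; rewrite mulKg invMg -!mulgA; congr (_ * _).
have := cocycleP al k h (h^-1 * (k^-1 * g))%g.
by rewrite mulKVg => ->.
Qed.

Lemma tw_mul1 : left_id (tw_delta 1%g) tw_mul.
Proof.
move=> a; apply/twP => g; rewrite /tw_mul /tw_delta tw_makeE (bigD1 1%g) //= big1 => [|h h1].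
  by rewrite tw_makeE eqxx mul1r invg1 mul1g cocycle1g mulr1 addr0.
by rewrite tw_makeE (negPf h1) !mul0r.
Qed.

Lemma tw_mulr1 : right_id (tw_delta 1%g) tw_mul.
Proof.
move=> a; apply/twP => g; rewrite /tw_mul /tw_delta tw_makeE (bigD1 g) //= big1 => [|h h1].
  by rewrite tw_makeE mulVg eqxx mulr1 cocycleg1 mulr1 addr0.
rewrite tw_makeE -(inj_eq (mulgI h)) mulKVg mulg1 eq_sym (negPf h1).
by rewrite mulr0 mul0r.
Qed.

Lemma tw_mulDl : left_distributive tw_mul +%R.
Proof.
move=> a b c; apply/twP => g; rewrite /tw_mul tw_funD !tw_makeE -big_split /=.
by apply: eq_bigr => h _; rewrite tw_funD !mulrDl.
Qed.

Lemma tw_mulDr : right_distributive tw_mul +%R.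
Proof.
move=> a b c; apply/twP => g; rewrite /tw_mul tw_funD !tw_makeE -big_split /=.
by apply: eq_bigr => h _; rewrite tw_funD mulrDr mulrDl.
Qed.

Lemma tw_one_neq0 : tw_delta 1%g != 0.
Proof.
apply/eqP => /(congr1 (fun a => tw_fun a 1%g)); rewrite tw_makeE eqxx tw_fun0.
by move/eqP; rewrite oner_eq0.
Qed.

HB.instance Definition _ := GRing.Zmodule_isNzRing.Build tw
  tw_mulA tw_mul1 tw_mulr1 tw_mulDl tw_mulDr tw_one_neq0.

Lemma tw_mulE a b g :
  tw_fun (a * b) g = \sum_h tw_fun a h * tw_fun b (h^-1 * g)%g * al h (h^-1 * g)%g.
Proof. exact: tw_makeE. Qed.

Lemma tw_scaleAl (k : C) a b : k *: (a * b) = k *: a * b.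
Proof.
apply/twP => g; rewrite tw_funZ !tw_mulE mulr_sumr.
by apply: eq_bigr => h _; rewrite tw_funZ !mulrA.
Qed.

HB.instance Definition _ := GRing.Lmodule_isLalgebra.Build C tw tw_scaleAl.

Lemma tw_scaleAr (k : C) a b : k *: (a * b) = a * (k *: b).
Proof.
apply/twP => g; rewrite tw_funZ !tw_mulE mulr_sumr.
by apply: eq_bigr => h _; rewrite tw_funZ !mulrA (mulrC k).
Qed.

HB.instance Definition _ := GRing.Lalgebra_isAlgebra.Build C tw tw_scaleAr.

Lemma tw_deltaE g h : tw_fun (tw_delta g) h = (h == g)%:R.
Proof. exact: tw_makeE. Qed.

Lemma tw_deltaM g h : tw_delta g * tw_delta h = al g h *: tw_delta (g * h)%g.
Proof.
apply/twP => x; rewrite tw_mulE tw_funZ tw_deltaE (bigD1 g) //= big1 => [|y yg].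
  rewrite !tw_deltaE eqxx mul1r addr0 -(inj_eq (mulgI g)) mulKVg.
  by case: eqP => [->|_]; rewrite ?mulKg ?mul0r ?mulr0 // mulr1 mul1r.
by rewrite tw_deltaE (negPf yg) !mul0r.
Qed.

Lemma tw_expand a : a = \sum_g tw_fun a g *: tw_delta g.
Proof.
apply/twP => g; rewrite tw_fun_sum (bigD1 g) //= big1 => [|h hg].
  by rewrite tw_funZ tw_deltaE eqxx mulr1 addr0.
by rewrite tw_funZ tw_deltaE eq_sym (negPf hg) mulr0.
Qed.

End TwistedRing.

Section TwistedSupport.
Variables (C : fieldType) (gT : finGroupType) (al : cocycle C gT).
Implicit Types (P Q : gT -> Prop) (a b : twisted al).

(** Supports record three kinds of data below: parity, the Clifford generators involved, and
    membership in a subgroup fixing the last points. *)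
Definition tw_supp P a := forall g, tw_fun a g != 0 -> P g.

Lemma tw_suppD P a b : tw_supp P a -> tw_supp P b -> tw_supp P (a + b).
Proof.
move=> Pa Pb g; rewrite tw_funD; have [a0|/Pa //] := eqVneq (tw_fun a g) 0.
by rewrite a0 add0r => /Pb.
Qed.

Lemma tw_suppZ P k a : tw_supp P a -> tw_supp P (k *: a).
Proof. by move=> Pa g; rewrite tw_funZ mulf_eq0 negb_or => /andP[_ /Pa]. Qed.

Lemma tw_suppN P a : tw_supp P a -> tw_supp P (- a).
Proof. by rewrite -scaleN1r; apply: tw_suppZ. Qed.

Lemma tw_supp_delta P g : P g -> tw_supp P (tw_delta al g).
Proof. by move=> Pg h; rewrite tw_deltaE; have [->|_] := eqVneq h g; rewrite ?eqxx. Qed.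

Lemma tw_supp_sum P I (r : seq I) (R : pred I) (F : I -> twisted al) :
  (forall i, R i -> tw_supp P (F i)) -> tw_supp P (\sum_(i <- r | R i) F i).
Proof.
move=> PF; elim/big_rec: _ => [g|i x Ri Px]; first by rewrite tw_fun0 eqxx.
by apply: tw_suppD => //; apply: PF.
Qed.

Lemma tw_suppM P Q (R : gT -> Prop) a b :
  (forall g h, P g -> Q h -> R (g * h)%g) ->
  tw_supp P a -> tw_supp Q b -> tw_supp R (a * b).
Proof.
move=> PQR Pa Qb g; rewrite tw_mulE => abg.
have [/existsP[h /andP[/Pa Ph /Qb Qh]]|ab0] := boolP
  [exists h, (tw_fun a h != 0) && (tw_fun b (h^-1 * g)%g != 0)].
  by rewrite -[g](mulKVg h); apply: PQR.
case/eqP: abg; apply: big1 => h _; move: ab0; rewrite negb_exists.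
by move=> /forallP/(_ h); rewrite negb_and !negbK => /orP[] /eqP->; rewrite ?mulr0 !mul0r.
Qed.

Lemma tw_supp1 P : P 1%g -> tw_supp P (1 : twisted al).
Proof. exact: tw_supp_delta. Qed.

Lemma tw_suppX P a k : (forall g h, P g -> P h -> P (g * h)%g) -> P 1%g ->
  tw_supp P a -> tw_supp P (a ^+ k).
Proof.
move=> PM P1 Pa; elim: k => [|k IHk]; first exact: tw_supp1.
by rewrite exprS; apply: tw_suppM Pa IHk.
Qed.

End TwistedSupport.

(** * Clifford algebras on the group of subsets *)

Definition mask n : Type := {ffun 'I_n -> bool}.
HB.instance Definition _ n := Finite.on (mask n).

Section MaskGroup.
Variable n : nat.
Definition mask_mul (x y : mask n) : mask n := [ffun i => x i (+) y i].
Definition mask_one : mask n := [ffun i => false].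
Lemma mask_mulA : associative mask_mul.
Proof. by move=> x y w; apply/ffunP => i; rewrite !ffunE addbA. Qed.
Lemma mask_mul1 : left_id mask_one mask_mul.
Proof. by move=> x; apply/ffunP => i; rewrite !ffunE. Qed.
Lemma mask_mulr1 : right_id mask_one mask_mul.
Proof. by move=> x; apply/ffunP => i; rewrite !ffunE addbF. Qed.
Lemma mask_mulV : left_inverse mask_one id mask_mul.
Proof. by move=> x; apply/ffunP => i; rewrite !ffunE addbb. Qed.
HB.instance Definition _ := isGroup.Build (mask n)
  mask_mulA mask_mul1 mask_mulr1 mask_mulV mask_mulV.

Lemma maskM (x y : mask n) i : (x * y)%g i = x i (+) y i.
Proof. by rewrite ffunE. Qed.
Lemma mask1 i : (1%g : mask n) i = false. Proof. by rewrite ffunE. Qed.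
Lemma maskV (x : mask n) : (x^-1)%g = x. Proof. by []. Qed.

Definition mask_unit (i : 'I_n) : mask n := [ffun j => j == i].
Definition mask_par (x : mask n) := \big[addb/false]_(i < n) x i.

Lemma mask_parM x y : mask_par (x * y)%g = mask_par x (+) mask_par y.
Proof. by rewrite /mask_par -big_split; apply: eq_bigr => i _; rewrite maskM. Qed.
Lemma mask_par1 : mask_par 1%g = false.
Proof. by rewrite /mask_par big1 // => i _; rewrite mask1. Qed.
Lemma mask_par_unit i : mask_par (mask_unit i) = true.
Proof.
rewrite /mask_par (bigD1 i) //= big1 ?ffunE ?eqxx // => j ji.
by rewrite ffunE (negPf ji).
Qed.
End MaskGroup.

Section Clifford.
Variables (C : fieldType) (n : nat).

(** The sign of reordering the increasing product of generators over x followed by that over y: one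
    exchange for each i in x and each smaller j in y. *)
Definition cl_sgn (x y : mask n) : C :=
  \prod_(i < n) \prod_(j < n | (j < i)%N) (-1) ^+ (x i && y j).

Lemma cl_sgnMl x x' y : cl_sgn (x * x')%g y = cl_sgn x y * cl_sgn x' y.
Proof.
rewrite /cl_sgn -big_split; apply: eq_bigr => i _ /=.
rewrite -big_split; apply: eq_bigr => j _ /=.
by rewrite maskM andb_addl signr_addb.
Qed.

Lemma cl_sgnMr x y y' : cl_sgn x (y * y')%g = cl_sgn x y * cl_sgn x y'.
Proof.
rewrite /cl_sgn -big_split; apply: eq_bigr => i _ /=.
rewrite -big_split; apply: eq_bigr => j _ /=.
by rewrite maskM andb_addr signr_addb.
Qed.

(** [cl_sgn] is multiplicative in each argument, and any such function is a 2-cocycle. *)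
Lemma cl_sgn_cocycle x y w :
  cl_sgn x y * cl_sgn (x * y)%g w = cl_sgn y w * cl_sgn x (y * w)%g.
Proof. by rewrite cl_sgnMl cl_sgnMr; ring. Qed.

Lemma cl_sgn1 x : cl_sgn 1%g x = 1.
Proof.
by rewrite /cl_sgn big1 // => i _; rewrite big1 // => j _; rewrite mask1.
Qed.

Lemma cl_sgnr1 x : cl_sgn x 1%g = 1.
Proof.
by rewrite /cl_sgn big1 // => i _; rewrite big1 // => j _; rewrite mask1 andbF.
Qed.

Definition cl_cocycle := Cocycle cl_sgn_cocycle cl_sgn1 cl_sgnr1.
Local Notation clifford := (twisted cl_cocycle).

Definition cl_gen (i : 'I_n) : clifford := tw_delta cl_cocycle (mask_unit i).
Local Notation c := cl_gen.

Lemma cl_sgn_unit p q :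
  cl_sgn (mask_unit p) (mask_unit q) = (-1) ^+ (q < p)%N.
Proof.
rewrite /cl_sgn (bigD1 p) //= [X in _ * X]big1 ?mulr1 => [|i ip].
  have [qp|qp] := boolP (q < p)%N.
    rewrite (bigD1 q) //= big1 ?mulr1 => [|j /andP[_ jq]].
      by rewrite !ffunE !eqxx.
    by rewrite !ffunE (negPf jq) andbF.
  rewrite big1 // => j jp; rewrite !ffunE eqxx.
  by have [jq|//] := eqVneq j q; rewrite jq (negPf qp) in jp.
by rewrite big1 // => j _; rewrite !ffunE (negPf ip).
Qed.

Lemma mask_unit2 (p : 'I_n) : (mask_unit p * mask_unit p)%g = 1%g.
Proof. by apply/ffunP => i; rewrite !ffunE addbb. Qed.

Lemma cl_gen2 p : c p * c p = 1.
Proof. by rewrite tw_deltaM mask_unit2 /= cl_sgn_unit ltnn scale1r. Qed.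

Lemma cl_genC p q : p != q -> c p * c q = - (c q * c p).
Proof.
move=> pq; rewrite !tw_deltaM /= !cl_sgn_unit -scaleNr.
have -> : (mask_unit p * mask_unit q)%g = (mask_unit q * mask_unit p)%g.
  by apply/ffunP => i; rewrite !maskM addbC.
congr (_ *: _); case: (ltngtP q p) => [_|_|/val_inj e]; rewrite ?opprK //.
by rewrite e eqxx in pq.
Qed.

(** The constant coefficient is the normalised trace of the Clifford algebra. *)
Definition vac (a : clifford) : C := tw_fun a 1%g.

Lemma vacD a b : vac (a + b) = vac a + vac b. Proof. exact: tw_funD. Qed.
Lemma vacN a : vac (- a) = - vac a. Proof. exact: tw_funN. Qed.
Lemma vacB a b : vac (a - b) = vac a - vac b. Proof. by rewrite vacD vacN. Qed.
Lemma vacZ k a : vac (k *: a) = k * vac a. Proof. exact: tw_funZ. Qed.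
Lemma vac_sum I (r : seq I) (P : pred I) (F : I -> clifford) :
  vac (\sum_(i <- r | P i) F i) = \sum_(i <- r | P i) vac (F i).
Proof. exact: tw_fun_sum. Qed.
Lemma vac1 : vac 1 = 1. Proof. by rewrite /vac tw_deltaE eqxx. Qed.

(** Every mask is its own inverse, so only the pairs (h, h) contribute, symmetrically in the two
    factors. *)
Lemma vacC a b : vac (a * b) = vac (b * a).
Proof.
rewrite /vac !tw_mulE; apply: eq_bigr => h _.
by rewrite mulg1 maskV (mulrC (tw_fun a h)).
Qed.

Definition cl_in (A : {set 'I_n}) :=
  tw_supp (al := cl_cocycle) (fun x : mask n => forall i, x i -> i \in A).
Definition cl_par (b : bool) :=
  tw_supp (al := cl_cocycle) (fun x : mask n => mask_par x = b).

Lemma cl_inM A a b : cl_in A a -> cl_in A b -> cl_in A (a * b).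
Proof.
apply: tw_suppM => g h gA hA i; rewrite maskM.
by case: (boolP (g i)) => [/gA|_ /hA].
Qed.

Lemma cl_in1 A : cl_in A 1.
Proof. by apply: tw_supp1 => i; rewrite mask1. Qed.

Lemma cl_in_gen (A : {set 'I_n}) i : i \in A -> cl_in A (c i).
Proof. by move=> iA; apply: tw_supp_delta => j; rewrite ffunE => /eqP->. Qed.

Lemma cl_parM b b' x y : cl_par b x -> cl_par b' y -> cl_par (b (+) b') (x * y).
Proof. by apply: tw_suppM => g h <- <-; rewrite mask_parM. Qed.

Lemma cl_par_gen i : cl_par true (c i).
Proof. by apply: tw_supp_delta; rewrite mask_par_unit. Qed.

Lemma vac_odd a : cl_par true a -> vac a = 0.
Proof.
by move=> aT; apply/eqP; apply: contraT => /aT; rewrite mask_par1.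
Qed.

(** The empty mask is the only one that both supports can contain. *)
Lemma vac_disjoint A a b : cl_in A a -> cl_in (~: A) b ->
  vac (a * b) = vac a * vac b.
Proof.
move=> aA bA; rewrite /vac tw_mulE (bigD1 1%g) //= big1 => [|x x1].
  by rewrite invg1 mul1g cl_sgn1 mulr1 addr0.
rewrite mulg1 maskV; apply/eqP; rewrite !mulf_eq0; apply: contraT.
rewrite !negb_or => /andP[/andP[/aA xA /bA xA'] _]; case/eqP: x1.
apply/ffunP => i; rewrite mask1; apply/negP => xi.
by have := xA' i xi; rewrite inE (xA i xi).
Qed.

End Clifford.

Notation clifford C n := (twisted (cl_cocycle C n)).

Section Reflections.
Variables (C : numClosedFieldType) (n : nat).
Local Notation c := (@cl_gen C n).

Definition rt2 : C := sqrtC 2.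

Lemma rt2_neq0 : rt2 != 0. Proof. by rewrite sqrtC_eq0 pnatr_eq0. Qed.
Lemma rt2_sqr : rt2 * rt2 = 2. Proof. by rewrite -expr2 sqrtCK. Qed.

Definition cl_root (p q : 'I_n) : clifford C n := rt2^-1 *: (c p - c q).
Local Notation u := cl_root.

Lemma cl_rootN p q : u q p = - u p q.
Proof. by rewrite /u -scalerN opprB. Qed.

Lemma cl_root2 p q : p != q -> u p q * u p q = 1.
Proof.
move=> pq; rewrite /u -scalerAl -scalerAr scalerA -invfM rt2_sqr.
rewrite mulrBl !mulrBr !cl_gen2 (cl_genC C pq) opprK.
have -> : 1 + c q * c p - (c q * c p - 1) = (2 : C) *: (1 : clifford C n).
  by rewrite opprB addrACA subrr addr0 scaler_nat.
by rewrite scalerA mulVf ?scale1r // pnatr_eq0.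
Qed.

Lemma cl_gen_root i p q : p != q -> c i * u p q = - (u p q * c (tperm p q i)).
Proof.
move=> pq; rewrite /u -scalerAl -scalerAr -scalerN; congr (_ *: _).
case: tpermP => [->|->|/eqP ip /eqP iq].
- by rewrite mulrBr mulrBl !cl_gen2 opprB.
- by rewrite mulrBr mulrBl !cl_gen2 opprB.
by rewrite mulrBr mulrBl (cl_genC C ip) (cl_genC C iq) opprB opprK addrC.
Qed.

Lemma cl_rootM a b p q : p != q ->
  u a b * u p q = - (u p q * u (tperm p q a) (tperm p q b)).
Proof.
move=> pq; rewrite {1 4}/u -[in LHS]scalerAl -[in RHS]scalerAr -scalerN.
congr (_ *: _).
by rewrite mulrBl mulrBr !cl_gen_root // opprB opprK addrC.
Qed.

Lemma cl_par_root p q : cl_par true (u p q).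
Proof.
apply: tw_suppZ; apply: tw_suppD; first exact: cl_par_gen.
by apply: tw_suppN; apply: cl_par_gen.
Qed.

Lemma cl_in_root (A : {set 'I_n}) p q : p \in A -> q \in A -> cl_in A (u p q).
Proof.
move=> pA qA; apply: tw_suppZ; apply: tw_suppD; first exact: cl_in_gen.
by apply: tw_suppN; apply: cl_in_gen.
Qed.

End Reflections.

(** * The basic spin representation and its coefficient function *)

(** The counterpart of [spin_eq_prod] for values in a ring, needed because the Clifford algebra is
    not a [groupType]. *)
Lemma spin_eq_prod_ring n (R : nzRingType) (f : letter n -> R) :
  f None * f None = 1 ->
  (forall i, f (Some i) * f None = f None * f (Some i)) ->
  (forall i, f (Some i) * f (Some i) = 1) ->
  (forall i j : 'I_n.-1, j = i.+1 :> nat -> (f (Some i) * f (Some j)) ^+ 3 = 1) ->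
  (forall i j : 'I_n.-1, (i.+1 < j)%N || (j.+1 < i)%N ->
    f (Some i) * f (Some j) = f None * f (Some j) * f (Some i)) ->
  forall u v, spin_eq u v -> \prod_(a <- u) f a = \prod_(a <- v) f a.
Proof.
move=> fzz frz frr fbraid ffar u v.
elim=> {u v} [u|u v _ ->|u v w _ -> _ ->|u u' v v' _ IHu _ IHv||i|i|i j ij|i j ij] //.
- by rewrite !big_cat /= IHu IHv.
- by rewrite !big_cons !big_nil mulr1.
- by rewrite !big_cons !big_nil !mulr1.
- by rewrite !big_cons !big_nil mulr1.
- by rewrite !big_cons !big_nil mulr1 -[RHS](fbraid _ _ ij) !exprS expr0 mulr1 !mulrA.
- by rewrite !big_cons !big_nil !mulr1 ffar ?mulrA.
Qed.

Section Letters.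
Variable n : nat.

Definition letter_lo (k : 'I_n.-1) : 'I_n :=
  Ordinal (leq_trans (ltn_ord k) (leq_pred n)).
Definition letter_hi (k : 'I_n.-1) : 'I_n :=
  Ordinal (etrans (esym (ltn_predRL k n)) (ltn_ord k)).
Local Notation lo := letter_lo.
Local Notation hi := letter_hi.

Lemma letter_lohi k : lo k != hi k.
Proof. by apply/eqP => /(congr1 val) /=; lia. Qed.

Lemma letter_hilo (i j : 'I_n.-1) : j = i.+1 :> nat -> lo j = hi i.
Proof. by move=> ij; apply/val_inj. Qed.

Lemma letter_far (i j : 'I_n.-1) : (i.+1 < j)%N || (j.+1 < i)%N ->
  [/\ lo i != lo j, lo i != hi j, hi i != lo j & hi i != hi j].
Proof. by move=> ij; split; apply/eqP => /(congr1 val) /=; lia. Qed.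

Lemma tpermJ3 (a b d : 'I_n) : a != b -> a != d -> b != d ->
  (tperm a b * tperm b d * tperm a b = tperm a d)%g.
Proof.
move=> ab ad bd; have -> : (tperm a b * tperm b d * tperm a b
   = tperm b d ^ tperm a b)%g by rewrite conjgE tpermV mulgA.
by rewrite tpermJ tpermR tpermD // eq_sym.
Qed.

Lemma spin_perm_class (w : word n) :
  spin_perm (spin_class w) = (\prod_(a <- w) @perm_letter n a)%g.
Proof.
apply: spin_lift_class => [|i|i|i j ij|i j ij] /=; rewrite ?mulg1 ?mul1g ?tperm2 //.
  rewrite -[tperm _ _]/(tperm (lo i) (hi i)) -[X in (_ * X)%g]/(tperm (lo j) (hi j)).
  have ne1 := letter_lohi i; have ne2 := letter_lohi j.
  rewrite (letter_hilo ij) in ne2 *.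
  have ne3 : lo i != hi j by apply/eqP => /(congr1 val) /=; lia.
  rewrite !expgS expg0 mulg1 !mulgA tpermJ3 // -!mulgA [(tperm (hi i) _ * _)%g]mulgA.
  rewrite (tpermC (hi i)) (tpermC (lo i) (hi i)) tpermJ3 // 1?eq_sym //.
  by rewrite (tpermC (hi j)) tperm2.
rewrite -[tperm _ _]/(tperm (lo i) (hi i)) -[X in (_ * X)%g]/(tperm (lo j) (hi j)).
have [? ? ? ?] := letter_far ij.
by rewrite [LHS]conjgC tpermJ !tpermD // eq_sym.
Qed.

Lemma spin_perm_z : spin_perm (spin_z n) = 1%g.
Proof. by rewrite spin_perm_class big_seq1. Qed.

Lemma spin_perm1 : spin_perm (1%g : spin_sym n) = 1%g.
Proof. by rewrite spin_perm_class big_nil. Qed.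

Lemma spin_permV (g : spin_sym n) : spin_perm g^-1%g = (spin_perm g)^-1%g.
Proof.
by apply: (mulgI (spin_perm g)); rewrite -spin_permM !mulgV spin_perm1.
Qed.

Lemma spin_rP (p q : 'I_n) : q = p.+1 :> nat ->
  exists k, [/\ spin_r n p.+1 = spin_class [:: Some k], lo k = p & hi k = q].
Proof.
move=> qp; have lt_p : (p < n.-1)%N by have := ltn_ord q; lia.
exists (Ordinal lt_p); split; [by rewrite -spin_rE | exact/val_inj |].
exact/val_inj.
Qed.

Lemma spin_perm_r (p q : 'I_n) : q = p.+1 :> nat ->
  spin_perm (spin_r n p.+1) = tperm p q.
Proof.
move=> qp; have [k [-> <- <-]] := spin_rP qp.
by rewrite spin_perm_class big_seq1.
Qed.

Definition spin_odd (g : spin_sym n) : bool := odd_perm (spin_perm g).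

Lemma spin_oddM g h : spin_odd (g * h)%g = spin_odd g (+) spin_odd h.
Proof. by rewrite /spin_odd spin_permM odd_permM. Qed.

Lemma spin_odd1 : spin_odd 1%g = false.
Proof. by rewrite /spin_odd spin_perm1 odd_perm1. Qed.

Lemma spin_odd_z : spin_odd (spin_z n) = false.
Proof. by rewrite /spin_odd spin_perm_z odd_perm1. Qed.

Lemma spin_oddV g : spin_odd g^-1%g = spin_odd g.
Proof. by rewrite /spin_odd spin_permV odd_permV. Qed.

Local Notation z := (spin_z n).

Lemma spin_zXC (g : spin_sym n) b : (g * z ^+ b = z ^+ b * g)%g.
Proof. exact/commuteX/spin_zC. Qed.

Lemma spin_transp_up i j : (i < j)%N -> spin_transp n i j =
  (z ^+ (j - i - 1) * (\prod_(k <- rev (iota i.+1 (j - i - 1))) spin_r n k)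
    * spin_r n i * (\prod_(k <- iota i.+1 (j - i - 1)) spin_r n k))%g.
Proof. by rewrite /spin_transp => ->. Qed.

Lemma spin_transp_swap i j : (i < j)%N ->
  spin_transp n j i = (z * spin_transp n i j)%g.
Proof. by move=> ij; rewrite {1}/spin_transp ltnNge (ltnW ij) /= spin_transp_up. Qed.

Lemma spin_transpS i : spin_transp n i i.+1 = spin_r n i.
Proof.
by rewrite spin_transp_up // subSnn /= !big_nil expg0 !mul1g mulg1.
Qed.

Lemma spin_transp_rec i j : (i < j)%N -> spin_transp n i j.+1 =
  (z * spin_r n j * spin_transp n i j * spin_r n j)%g.
Proof.
move=> ij; rewrite !spin_transp_up //; last by lia.
have -> : (j.+1 - i - 1 = (j - i - 1).+1)%N by lia.
have -> : iota i.+1 (j - i - 1).+1 = rcons (iota i.+1 (j - i - 1)) j.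
  by rewrite -[(j - i - 1).+1]addn1 iotaD cats1; congr rcons; lia.
rewrite rev_rcons big_cons -cats1 big_cat big_seq1 /= expgS !mulgA.
by congr (_ * _ * _ * _ * _)%g; rewrite -!mulgA spin_zXC.
Qed.

Definition spin_tr (p q : 'I_n) : spin_sym n := spin_transp n p.+1 q.+1.

(** Every [p q] arises from a generator by the rules [spin_transp_rec] and [spin_transp_swap];
    properties of all of them are proved along these two rules. *)
Lemma spin_tr_ind (P : 'I_n -> 'I_n -> spin_sym n -> Prop) :
  (forall p q : 'I_n, q = p.+1 :> nat -> P p q (spin_r n p.+1)) ->
  (forall (p q q' : 'I_n) g, (p < q)%N -> q' = q.+1 :> nat -> P p q g ->
    P p q' (z * spin_r n q.+1 * g * spin_r n q.+1)%g) ->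
  (forall (p q : 'I_n) g, (p < q)%N -> P p q g -> P q p (z * g)%g) ->
  forall p q, p != q -> P p q (spin_tr p q).
Proof.
move=> P1 P2 P3; have up (p q : 'I_n) : (p < q)%N -> P p q (spin_tr p q).
  case: q => q lt_q; elim: q lt_q => // q IHq lt_q; rewrite ltnS leq_eqVlt.
  case/orP=> [/eqP pq|pq].
    have := P1 p (Ordinal lt_q); rewrite /spin_tr /= pq => /(_ erefl).
    by rewrite spin_transpS.
  rewrite /spin_tr /= spin_transp_rec //.
  exact: (P2 _ (Ordinal (ltnW lt_q))) (IHq _ _).
move=> p q pq; have [||/val_inj e] := ltngtP p q; first exact: up.
  by move=> qp; rewrite /spin_tr spin_transp_swap //; apply/P3/up.
by rewrite e eqxx in pq.
Qed.

Lemma spin_perm_tr p q : p != q -> spin_perm (spin_tr p q) = tperm p q.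
Proof.
move: p q; apply: (spin_tr_ind (P := fun p q g => spin_perm g = tperm p q))
  => [p q pq|p q q' g pq qq' IH|p q g pq IH].
- exact: spin_perm_r.
- rewrite !spin_permM spin_perm_z mul1g IH (spin_perm_r qq').
  rewrite (tpermC q q') (tpermC p q) tpermJ3 1?tpermC //; apply/eqP => /(congr1 val) /=; lia.
- by rewrite spin_permM spin_perm_z mul1g IH tpermC.
Qed.

Lemma spin_odd_tr p q : p != q -> spin_odd (spin_tr p q) = true.
Proof. by move=> pq; rewrite /spin_odd spin_perm_tr // odd_tperm pq. Qed.

End Letters.

Section Kappa.
Variables (C : numClosedFieldType) (n : nat).
Local Notation lo := (@letter_lo n).
Local Notation hi := (@letter_hi n).
Local Notation c := (@cl_gen C n).
Local Notation z := (spin_z n).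

Definition cl_letter (a : letter n) : clifford C n :=
  if a is Some k then cl_root C (lo k) (hi k) else -1.

Definition kappa (g : spin_sym n) : clifford C n :=
  \prod_(a <- spin_word g) cl_letter a.

Lemma cl_root_braid (a b d : 'I_n) : a != b -> a != d -> b != d ->
  cl_root C a b * cl_root C b d * cl_root C a b = - cl_root C a d.
Proof.
move=> ab ad bd; rewrite -mulrA cl_rootM // mulrN mulrA cl_root2 // mul1r.
by rewrite tpermR tpermD.
Qed.

Lemma cl_root_far (a b d e : 'I_n) : d != e -> a != d -> a != e -> b != d -> b != e ->
  cl_root C a b * cl_root C d e = - (cl_root C d e * cl_root C a b).
Proof. by move=> *; rewrite cl_rootM // !tpermD // eq_sym. Qed.

(** The roots satisfy the defining relations with z = -1, so [kappa] does not depend on the chosen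
    word. *)
Lemma kappa_class (w : word n) : kappa (spin_class w) = \prod_(a <- w) cl_letter a.
Proof.
apply: (@spin_eq_prod_ring n) (spin_classK w) => [|i|i|i j ij|i j ij].
- by rewrite mulrNN mulr1.
- by rewrite mulrN1 mulN1r.
- by rewrite /= cl_root2 // letter_lohi.
- rewrite /cl_letter; have ne1 := letter_lohi i; have ne2 := letter_lohi j.
  rewrite (letter_hilo ij) in ne2 *.
  have ne3 : lo i != hi j by apply/eqP => /(congr1 val) /=; lia.
  have E : cl_root C (hi i) (hi j) * cl_root C (lo i) (hi i) * cl_root C (hi i) (hi j)
      = - cl_root C (lo i) (hi j).
    rewrite (cl_rootN C (hi j) (hi i)) (cl_rootN C (hi i) (lo i)) mulrNN mulrN.
    by rewrite cl_root_braid 1?eq_sym // (cl_rootN C (lo i)) opprK.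
  by rewrite !exprS expr0 mulr1 !mulrA cl_root_braid // !mulNr -2!mulrA
    (mulrA (cl_root C (hi i) _)) E mulrN opprK cl_root2.
- have [? ? ? ?] := letter_far ij.
  by rewrite /cl_letter mulN1r mulNr cl_root_far // letter_lohi.
Qed.

Lemma kappaM g h : kappa (g * h)%g = kappa g * kappa h.
Proof.
rewrite -[g]spin_wordK -[h]spin_wordK spin_mulE !kappa_class big_cat /=.
by rewrite -!kappa_class.
Qed.

Lemma kappa1 : kappa 1%g = 1.
Proof. by rewrite kappa_class big_nil. Qed.

Lemma kappa_z : kappa z = -1.
Proof. by rewrite kappa_class big_seq1. Qed.

Lemma kappaVl g : kappa g^-1%g * kappa g = 1.
Proof. by rewrite -kappaM mulVg kappa1. Qed.

Lemma kappa_r (p q : 'I_n) : q = p.+1 :> nat -> kappa (spin_r n p.+1) = cl_root C p q.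
Proof.
by move=> qp; have [k [-> <- <-]] := spin_rP qp; rewrite kappa_class big_seq1.
Qed.

Lemma kappa_tr p q : p != q -> kappa (spin_tr p q) = cl_root C p q.
Proof.
move: p q; apply: (spin_tr_ind (P := fun p q g => kappa g = cl_root C p q))
  => [p q pq|p q q' g pq qq' IH|p q g pq IH].
- exact: kappa_r.
- rewrite !kappaM kappa_z mulN1r IH (kappa_r qq') -mulrA cl_rootM; last first.
    by apply/eqP => /(congr1 val) /=; lia.
  rewrite mulrN mulNr opprK mulrA cl_root2 ?mul1r ?tpermL ?tpermD //;
    by apply/eqP => /(congr1 val) /=; lia.
- by rewrite kappaM kappa_z mulN1r IH -cl_rootN.
Qed.

(** Each letter reflects the generators up to sign; the signs multiply to the sign of the
    permutation. *)
Lemma cl_gen_kappa i g :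
  c i * kappa g = (-1) ^+ spin_odd g *: (kappa g * c (spin_perm g i)).
Proof.
rewrite -[g]spin_wordK; elim: (spin_word g) i => [|a w IHw] i.
  by rewrite kappa1 spin_odd1 spin_perm1 perm1 mul1r mulr1 scale1r.
rewrite -[a :: w]/([:: a] ++ w) -spin_mulE kappaM spin_oddM spin_permM mulrA.
have -> : c i * kappa (spin_class [:: a]) = (-1) ^+ spin_odd (spin_class [:: a])
    *: (kappa (spin_class [:: a]) * c (spin_perm (spin_class [:: a]) i)).
  rewrite /spin_odd spin_perm_class kappa_class !big_seq1; case: a => [k|] /=.
    rewrite -[tperm _ _]/(tperm (lo k) (hi k)) odd_tperm letter_lohi.
    by rewrite scaleN1r cl_gen_root // letter_lohi.
  by rewrite odd_perm1 scale1r perm1 mulrN1 mulN1r.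
by rewrite -scalerAl -!mulrA IHw -scalerAr scalerA signr_addb permM.
Qed.

Lemma cl_root_kappa p q g : cl_root C p q * kappa g =
  (-1) ^+ spin_odd g *: (kappa g * cl_root C (spin_perm g p) (spin_perm g q)).
Proof.
rewrite /cl_root -scalerAl mulrBl !cl_gen_kappa -scalerBr -mulrBr -scalerAr.
by rewrite !scalerA mulrC.
Qed.

Lemma kappa_par g : cl_par (spin_odd g) (kappa g).
Proof.
rewrite -[g]spin_wordK; elim: (spin_word g) => [|a w IHw].
  by rewrite spin_odd1 kappa1; apply: tw_supp1; rewrite mask_par1.
rewrite -[a :: w]/([:: a] ++ w) -spin_mulE kappaM spin_oddM.
apply: cl_parM => //; rewrite /spin_odd spin_perm_class kappa_class !big_seq1.
case: a => [k|] /=.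
  rewrite -[tperm _ _]/(tperm (lo k) (hi k)) odd_tperm letter_lohi.
  exact: cl_par_root.
by rewrite odd_perm1; apply: tw_suppN; apply: tw_supp1; rewrite mask_par1.
Qed.

Definition beta g : C := vac (kappa g).

Lemma beta1 : beta 1%g = 1. Proof. by rewrite /beta kappa1 vac1. Qed.

Lemma beta_odd g : spin_odd g -> beta g = 0.
Proof. by move=> go; apply: vac_odd; have := @kappa_par g; rewrite go. Qed.

Lemma beta_z g : beta (z * g)%g = - beta g.
Proof. by rewrite /beta kappaM kappa_z mulN1r vacN. Qed.

Lemma betaJ g h : beta (g ^ h)%g = beta g.
Proof. by rewrite /beta conjgE kappaM vacC -kappaM mulgK. Qed.

End Kappa.

Section Kernel.
Variables (C : numClosedFieldType) (n : nat).
Local Notation z := (spin_z n).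

Lemma spin_z_neq1 : z != 1%g.
Proof.
apply/eqP => /(congr1 (@kappa C n)); rewrite kappa_z kappa1 => /(congr1 (@vac C n)).
by rewrite vacN vac1 => /eqP; rewrite -subr_eq0 -opprD oppr_eq0 (pnatr_eq0 C 2).
Qed.

Lemma size_spin_enum m : size (spin_enum n m) = (2 * (m.+1)`!)%N.
Proof.
elim: m => // m IHm; rewrite size_allpairs -/(spin_enum n m) IHm size_iota (factS m.+1); lia.
Qed.

Lemma card_spin_sym : (#|{: spin_sym n}| <= 2 * n`!)%N.
Proof.
rewrite cardE; apply: leq_trans (uniq_leq_size (enum_uniq _) (s2 := undup (spin_enum n n.-1)) _) _.
  by move=> g _; apply: mem_spin_enum.
apply: leq_trans (size_undup _) _; rewrite size_spin_enum.
by case: n.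
Qed.

Lemma spin_perm_surj (s : 'S_n) : exists g : spin_sym n, spin_perm g == s.
Proof.
have [ts -> dts] := prod_tpermP s; elim: ts dts => [|t ts IHts] /= => [_|/andP[dt]].
  by exists 1%g; rewrite spin_perm1 big_nil.
case/IHts => g /eqP Eg; exists (spin_tr t.1 t.2 * g)%g.
by rewrite spin_permM Eg spin_perm_tr // big_cons.
Qed.

Definition spin_sect (s : 'S_n) : spin_sym n := xchoose (spin_perm_surj s).

Lemma spin_sectK s : spin_perm (spin_sect s) = s.
Proof. exact/eqP/(xchooseP (spin_perm_surj s)). Qed.

(** Since z <> 1, a section of [spin_perm] and its translate by z give 2 n! distinct elements. The
    group has at most that many, so they exhaust it. *)
Lemma spin_perm_fiber (g h : spin_sym n) : spin_perm g = spin_perm h ->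
  h = g \/ h = (z * g)%g.
Proof.
pose f (sb : 'S_n * bool) : spin_sym n := (z ^+ sb.2 * spin_sect sb.1)%g.
have fE s b : spin_perm (f (s, b)) = s.
  rewrite /f spin_permM spin_sectK; case: b => /=; first by rewrite expg1 spin_perm_z mul1g.
  by rewrite expg0 spin_perm1 mul1g.
have f_inj : injective f.
  move=> [s b] [s' b'] E; have Es : s = s' by rewrite -(fE s b) E fE.
  move: E; rewrite -Es /f /= => /mulIg; case: b b' => [] [] //= => /eqP.
    by rewrite expg1 expg0 (negPf spin_z_neq1).
  by rewrite expg1 expg0 eq_sym (negPf spin_z_neq1).
have [|f' fK f'K] := inj_card_bij f_inj.
  by rewrite card_prod card_bool card_Sn mulnC card_spin_sym.
rewrite -[g]f'K -[h]f'K; case: (f' g) (f' h) => [s b] [s' b']; rewrite !fE => <-.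
rewrite /f /= mulgA; case: b b' => [] [] /=; rewrite ?expg1 ?expg0 ?mulg1 ?mul1g; auto.
by right; rewrite spin_zz mul1g.
Qed.

(** [kappa] separates g from z g. Identities in the group can thus be checked on permutations and in
    the Clifford algebra, without handling words. *)
Lemma spin_sym_inj (g h : spin_sym n) :
  spin_perm g = spin_perm h -> kappa C g = kappa C h -> g = h.
Proof.
move=> /spin_perm_fiber[-> //|->]; rewrite kappaM kappa_z mulN1r => /eqP.
rewrite -addr_eq0 -mulr2n -scaler_nat scaler_eq0 pnatr_eq0 /= => /eqP k0.
by have := kappaVl C g; rewrite k0 mulr0 => /esym/eqP; rewrite oner_eq0.
Qed.

Lemma spin_trK (p q : 'I_n) : p != q -> (spin_tr p q * spin_tr p q)%g = 1%g.
Proof.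
move=> pq; apply: spin_sym_inj.
  by rewrite spin_permM !spin_perm_tr // tperm2 spin_perm1.
by rewrite kappaM !kappa_tr // cl_root2 // kappa1.
Qed.

Lemma spin_trV (p q : 'I_n) : p != q -> ((spin_tr p q)^-1 = spin_tr p q)%g.
Proof. by move=> pq; apply: (mulgI (spin_tr p q)); rewrite mulgV spin_trK. Qed.

Lemma spin_trJ (p q : 'I_n) g : p != q -> (spin_tr p q ^ g =
  z ^+ spin_odd g * spin_tr (spin_perm g p) (spin_perm g q))%g.
Proof.
move=> pq; have gpq : spin_perm g p != spin_perm g q by rewrite (inj_eq perm_inj).
have zE b : spin_perm (z ^+ (b : bool))%g = 1%g.
  by case: b; rewrite ?expg0 ?expg1 ?spin_perm_z ?spin_perm1.
apply: spin_sym_inj.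
  rewrite conjgE !spin_permM spin_permV !spin_perm_tr // zE mul1g.
  by rewrite -conjgE tpermJ.
rewrite conjgE !kappaM !kappa_tr // cl_root_kappa -scalerAr mulrA kappaVl mul1r.
case: (spin_odd g); rewrite ?expg0 ?expg1 ?kappa_z ?kappa1.
  by rewrite expr1 scaleN1r mulN1r.
by rewrite scale1r mul1r.
Qed.

End Kernel.

(** * Young elements *)

Section TrivialCocycle.
Variables (C : fieldType) (gT : finGroupType).
Definition triv_cocycle : cocycle C gT.
Proof. by exists (fun _ _ => 1) => *; rewrite ?mulr1. Defined.
End TrivialCocycle.

Notation grp_alg C gT := (twisted (triv_cocycle C gT)).

Section GroupAlgebra.
Variables (C : fieldType) (gT : finGroupType).
Local Notation GA := (grp_alg C gT).
Local Notation dl g := (tw_delta (triv_cocycle C gT) g).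
Implicit Types (a b : GA) (g h : gT).

Lemma ga_mulE a b g : tw_fun (a * b) g = \sum_h tw_fun a h * tw_fun b (h^-1 * g)%g.
Proof. by rewrite tw_mulE; apply: eq_bigr => h _; rewrite mulr1. Qed.

Lemma ga_deltaM g h : dl g * dl h = dl (g * h)%g.
Proof. by rewrite tw_deltaM scale1r. Qed.

Lemma ga_mul_delta a g h : tw_fun (a * dl g) h = tw_fun a (h * g^-1)%g.
Proof.
rewrite ga_mulE (bigD1 (h * g^-1)%g) //= big1 => [|x xh].
  by rewrite addr0 tw_deltaE invMg invgK mulgKV eqxx mulr1.
rewrite tw_deltaE; case: eqP => [E|_]; last by rewrite mulr0.
by case/eqP: xh; rewrite -E invMg invgK mulKVg.
Qed.

Lemma ga_delta_mul a g h : tw_fun (dl g * a) h = tw_fun a (g^-1 * h)%g.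
Proof.
rewrite ga_mulE (bigD1 g) //= big1 => [|x xh]; last first.
  by rewrite tw_deltaE (negPf xh) mul0r.
by rewrite addr0 tw_deltaE eqxx mul1r.
Qed.

End GroupAlgebra.

(** The double cover of the Young subgroup of the colour classes. *)
Definition stab_col n (T : eqType) (psi : 'I_n -> T) : pred (spin_sym n) :=
  fun g => [forall i, psi (spin_perm g i) == psi i].

Definition recolour n (T : eqType) (psi : 'I_n -> T) k s : 'I_n -> T :=
  fun i => if i == k then s else psi i.

Section ColourStabilisers.
Variables (n : nat) (T : eqType).
Implicit Types (psi : 'I_n -> T) (g h : spin_sym n).

Lemma stab_colP psi g :
  reflect (forall i, psi (spin_perm g i) = psi i) (stab_col psi g).
Proof. by apply: (iffP forallP) => H i; apply/eqP. Qed.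

Lemma stab_colM psi g h : stab_col psi g -> stab_col psi h -> stab_col psi (g * h)%g.
Proof.
by move=> /stab_colP Kg /stab_colP Kh; apply/stab_colP => i; rewrite spin_permM permM Kh Kg.
Qed.

Lemma stab_colV psi g : stab_col psi g -> stab_col psi g^-1%g.
Proof.
move=> /stab_colP Kg; apply/stab_colP => i.
by rewrite spin_permV -[in RHS](permKV (spin_perm g) i) Kg.
Qed.

Lemma stab_colMr psi g h : stab_col psi h -> stab_col psi (g * h)%g = stab_col psi g.
Proof.
move=> Kh; apply/idP/idP => [Kgh|Kg]; last exact: stab_colM.
by rewrite -(mulgK h g); apply/stab_colM/stab_colV.
Qed.

Lemma stab_colMl psi g h : stab_col psi h -> stab_col psi (h * g)%g = stab_col psi g.
Proof.
move=> Kh; apply/idP/idP => [Kgh|Kg]; last exact: stab_colM.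
by rewrite -(mulKg h g); apply/stab_colM/Kgh/stab_colV.
Qed.

Lemma stab_col_tr psi p q : p != q -> psi p = psi q -> stab_col psi (spin_tr p q).
Proof.
move=> pq Epq; apply/stab_colP => i; rewrite spin_perm_tr //.
by case: tpermP => [->|->|].
Qed.

Lemma stab_col_z psi : stab_col psi (spin_z n).
Proof. by apply/stab_colP => i; rewrite spin_perm_z perm1. Qed.

End ColourStabilisers.

Ltac tw_ring := apply/twP => ?; rewrite !(tw_funD, tw_funN, tw_funZ); ring.

Section YoungIdempotents.
Variables (C : numClosedFieldType) (n : nat).
Local Notation GA := (grp_alg C (spin_sym n)).
Local Notation dl g := (tw_delta (triv_cocycle C (spin_sym n)) g).
Local Notation c := (@cl_gen C n).
Local Notation u := (@cl_root C n).
Local Notation K := (@stab_col n _).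
Local Notation beta := (@beta C n).

(** The spin analogue of a row symmetriser: the basic spin character takes the place of the trivial
    character. *)
Definition young_elt (T : eqType) (psi : 'I_n -> T) : GA :=
  tw_make _ (fun g => if K psi g then beta g else 0).
Local Notation b := young_elt.

Definition jm_on (A : {set 'I_n}) (k : 'I_n) : GA := \sum_(j in A) dl (spin_tr j k).

Lemma young_eltE (T : eqType) (psi : 'I_n -> T) g :
  tw_fun (b psi) g = if K psi g then beta g else 0.
Proof. exact: tw_makeE. Qed.

Lemma eq_young_elt (T T' : eqType) (psi : 'I_n -> T) (psi' : 'I_n -> T') :
  K psi =1 K psi' -> b psi = b psi'.
Proof. by move=> E; apply/twP => g; rewrite !young_eltE E. Qed.

Lemma young_eltC (T : eqType) (psi : 'I_n -> T) g : K psi g ->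
  dl g * b psi = b psi * dl g.
Proof.
move=> Kg; apply/twP => h; rewrite ga_mul_delta ga_delta_mul !young_eltE.
rewrite stab_colMl ?stab_colMr ?stab_colV //; case: ifP => // _.
by rewrite -[LHS](betaJ C _ g^-1%g) conjgE invgK !mulgA mulgV mul1g.
Qed.

Lemma young_elt_jm2 (T : eqType) (psi : 'I_n -> T) (A : {set 'I_n}) k g : k \notin A ->
  tw_fun (b psi * jm_on A k * jm_on A k) g =
  \sum_(i in A) \sum_(j in A) tw_fun (b psi) (g * spin_tr i k * spin_tr j k)%g.
Proof.
move=> kA; rewrite {2}/jm_on mulr_sumr tw_fun_sum; apply: eq_bigr => i iA.
rewrite ga_mul_delta {1}/jm_on mulr_sumr tw_fun_sum; apply: eq_bigr => j jA.
have neq x : x \in A -> x != k by move=> xA; apply: contraNneq kA => <-.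
by rewrite ga_mul_delta !(spin_trV C) ?neq.
Qed.

Lemma cl_gen_comm (i j : 'I_n) :
  c i * c j + c j * c i = (2 * (i == j)%:R : C) *: 1.
Proof.
have [->|ij] := eqVneq i j; last by rewrite cl_genC // addNr mulr0 scale0r.
by rewrite cl_gen2 mulr1 scaler_nat.
Qed.

Lemma double_inj (x y : clifford C n) : x + x = y + y -> x = y.
Proof.
rewrite -!mulr2n -!scaler_nat => /(congr1 (GRing.scale (2 : C)^-1)).
by rewrite !scalerA mulVf ?pnatr_eq0 // !scale1r.
Qed.

Lemma cl_root_comm i j k : i != k -> j != k ->
  u i k * u j k + u j k * u i k = ((i == j)%:R + 1 : C) *: 1.
Proof.
move=> ik jk; rewrite /u -!scalerAl -!scalerAr !scalerA -scalerDr -invfM rt2_sqr.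
have -> : (c i - c k) * (c j - c k) + (c j - c k) * (c i - c k) =
  (c i * c j + c j * c i) - (c i * c k + c k * c i) - (c j * c k + c k * c j)
   + (c k * c k + c k * c k).
  rewrite !mulrBl !mulrBr.
  set x1 := c i * c j; set x2 := c i * c k; set x3 := c k * c j; set x4 := c k * c k.
  set x5 := c j * c i; set x6 := c j * c k; set x7 := c k * c i.
  by tw_ring.
rewrite !cl_gen_comm (negPf ik) (negPf jk) eqxx mulr1 !mulr0 !scale0r !subr0.
by rewrite -scalerDl scalerA mulrDr mulrA mulVf ?pnatr_eq0 // mul1r.
Qed.

Definition qfun (m : nat) : C := (m * m.+1)%:R / 2.

(** Twice the square is the sum over i, j of the anticommutators, which are 1, or 2 if i = j
    ([cl_root_comm]): in total |A|^2 + |A|. *)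
Lemma cl_jm2 (A : {set 'I_n}) k : k \notin A ->
  (\sum_(i in A) u i k) * (\sum_(i in A) u i k) = qfun #|A| *: 1.
Proof.
move=> kA; have neq x : x \in A -> x != k by move=> xA; apply: contraNneq kA => <-.
apply: double_inj; rewrite mulr_suml -[in RHS]scalerDl.
under eq_bigr do rewrite mulr_sumr.
rewrite {2}exchange_big -big_split /=.
under eq_bigr => i iA do rewrite -big_split /=.
rewrite (eq_bigr (fun i => \sum_(j in A) ((i == j)%:R + 1 : C) *: 1)); last first.
  by move=> i iA; apply: eq_bigr => j jA; rewrite cl_root_comm // neq.
rewrite (eq_bigr (fun i => (1 + #|A|%:R : C) *: 1)).
  rewrite sumr_const scalerMnl /qfun; congr (_ *: _).
  by rewrite -mulr_natl natrM -[#|A|.+1]addn1 natrD; field.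
move=> i iA; rewrite -scaler_suml big_split /= sumr_const; congr ((_ + _) *: _).
by rewrite (bigD1 i) //= eqxx big1 ?addr0 // => j /andP[_ /negPf]; rewrite eq_sym => ->.
Qed.

(* On the whole colour class of k, the Jucys--Murphy sum acts in the basic    *)
(* representation by Clifford elements, and there its square is a scalar.     *)
Lemma young_elt_own (T : eqType) (psi : 'I_n -> T) (A : {set 'I_n}) k : k \notin A ->
  (forall j, j \in A -> psi j = psi k) ->
  b psi * jm_on A k * jm_on A k = qfun #|A| *: b psi.
Proof.
move=> kA Ak; apply/twP => g; rewrite young_elt_jm2 // tw_funZ young_eltE.
have neq x : x \in A -> x != k by move=> xA; apply: contraNneq kA => <-.
have Ktr x : x \in A -> K psi (spin_tr x k).
  by move=> xA; apply: stab_col_tr; [apply: neq | apply: Ak].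
transitivity (if K psi g then \sum_(i in A) \sum_(j in A)
    vac (kappa C g * (u i k * u j k)) else 0).
  case: ifP => Kg; last first.
    rewrite big1 // => i iA; rewrite big1 // => j jA.
    by rewrite young_eltE !stab_colMr ?Kg ?Ktr.
  apply: eq_bigr => i iA; apply: eq_bigr => j jA.
  rewrite young_eltE !stab_colMr ?Kg ?Ktr // /beta !kappaM.
  by rewrite !kappa_tr ?neq // mulrA.
case: ifP => _; last by rewrite mulr0.
under eq_bigr do rewrite -vac_sum -mulr_sumr.
rewrite -vac_sum -mulr_sumr.
under eq_bigr do rewrite -mulr_sumr.
by rewrite -mulr_suml cl_jm2 // -scalerAr mulr1 vacZ.
Qed.

(** For even g put i = g(k); then c k [kappa g] = [kappa g] c i, and [kappa g] commutes with the sum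
    S of the generators of A and k. The left side is half the trace of [kappa g] (S - c i - |A| c
    k)(c i - c k). The terms with S cancel, the constants give |A| - 1, and the term in c k c i
    gives |A| + 1. *)
Lemma beta_merge (A : {set 'I_n}) k g : k \notin A ->
  (forall i, (spin_perm g i \in k |: A) = (i \in k |: A)) ->
  spin_perm g k \in A ->
  \sum_(j in A | j != spin_perm g k) beta (g * spin_tr j k * spin_tr (spin_perm g k) k)%g
  = #|A|%:R * beta g.
Proof.
move=> kA gA; set i := spin_perm g k => iA.
have neq x : x \in A -> x != k by move=> xA; apply: contraNneq kA => <-.
have [go|ge] := boolP (spin_odd g).
  rewrite beta_odd // mulr0 big1 // => j /andP[jA _]; apply: beta_odd.
  by rewrite !spin_oddM go !spin_odd_tr ?neq.
have ck : c k * kappa C g = kappa C g * c i by rewrite cl_gen_kappa (negPf ge) scale1r.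
pose S := \sum_(j in k |: A) c j.
have SC : S * kappa C g = kappa C g * S.
  rewrite mulr_suml mulr_sumr; symmetry.
  rewrite [LHS](reindex_inj (perm_inj (s := spin_perm g))) /=.
  apply: eq_big => j; first exact: gA.
  by move=> _; rewrite cl_gen_kappa (negPf ge) scale1r.
transitivity (\sum_(j in A | j != i) vac (kappa C g * (u j k * u i k))).
  apply: eq_bigr => j /andP[jA ji].
  by rewrite /beta !kappaM !kappa_tr ?neq // mulrA.
rewrite -vac_sum -mulr_sumr -mulr_suml.
have -> : \sum_(j in A | j != i) u j k = (rt2 C)^-1 *: (S - c i - #|A|%:R *: c k).
  rewrite /u -scaler_sumr; congr (_ *: _); rewrite sumrB sumr_const.
  rewrite /S big_setU1 //= (bigD1 (P := mem A) i) //= (cardD1 i A) iA add1n.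
  have -> : #|[pred j | (j \in A) && (j != i)]| = #|[predD1 A & i]|.
    by apply: eq_card => j; rewrite !inE andbC.
  rewrite scaler_nat mulrS; set x := c k *+ _; set y := \sum_(_ | _) _.
  tw_ring.
rewrite /cl_root -scalerAl -[in X in _ * (_ *: X)]scalerAr scalerA -invfM rt2_sqr.
have -> : (S - c i - #|A|%:R *: c k) * (c i - c k) =
  S * c i - S * c k + (#|A|%:R - 1 : C) *: 1 - (#|A|%:R + 1 : C) *: (c k * c i).
  rewrite !mulrBl !mulrBr -!scalerAl !cl_gen2 (cl_genC C (neq i iA)).
  set x := S * c i; set y := S * c k; set w := c k * c i.
  tw_ring.
rewrite -scalerAr vacZ mulrBr mulrDr mulrBr vacB vacD vacB -!scalerAr !vacZ mulr1.
(* Pass S to the left of [kappa C g], replace [kappa C g] c i by c k [kappa C g], and rotate under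
   the trace. *)
have -> : vac (kappa C g * (S * c i)) = vac (kappa C g * (S * c k)).
  by rewrite mulrA -SC -mulrA -ck mulrA vacC.
have -> : vac (kappa C g * (c k * c i)) = - vac (kappa C g).
  rewrite (cl_genC C) 1?eq_sym ?neq // mulrN vacN mulrA -ck -mulrA vacC -mulrA.
  by rewrite cl_gen2 mulr1.
by rewrite -/(beta g); field.
Qed.

End YoungIdempotents.

Section Merging.
Variables (C : numClosedFieldType) (n : nat).
Local Notation dl g := (tw_delta (triv_cocycle C (spin_sym n)) g).
Local Notation K := (@stab_col n _).
Local Notation beta := (@beta C n).
Local Notation b := (young_elt C).

Section OneStep.
Variables (T : eqType) (psi : 'I_n -> T) (k : 'I_n) (s : T).
Hypothesis psi_k : forall j, j != k -> psi j != psi k.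
Local Notation psi' := (recolour psi k s).
Let A := [set j | (j != k) && (psi j == s)].

Let neqA x : x \in A -> x != k. Proof. by rewrite inE => /andP[]. Qed.
Let kA : k \notin A. Proof. by rewrite inE eqxx. Qed.
Let psi'k : psi' k = s. Proof. by rewrite /recolour eqxx. Qed.
Let psi'A x : (x \in k |: A) = (psi' x == s).
Proof. by rewrite !inE /recolour; case: eqP => //=; rewrite eqxx. Qed.

Let K_fix g : K psi g -> spin_perm g k = k.
Proof.
move=> /stab_colP Kg; apply/eqP; apply: contraTT isT => /psi_k.
by rewrite Kg eqxx.
Qed.

Let K_sub g : K psi g -> K psi' g.
Proof.
move=> Kg; have gk := K_fix Kg; apply/stab_colP => i; rewrite /recolour.
rewrite -{1}gk (inj_eq perm_inj); case: eqP => // _.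
by move/stab_colP: Kg.
Qed.

Let K_sup g : K psi' g -> spin_perm g k = k -> K psi g.
Proof.
move=> /stab_colP Kg gk; apply/stab_colP => i; have := Kg i; rewrite /recolour.
by rewrite -{1}gk (inj_eq perm_inj); case: eqP => // ->; rewrite gk.
Qed.

Let K_tr j : j \in A -> K psi' (spin_tr j k).
Proof.
move=> jA; apply: stab_col_tr (neqA jA) _; rewrite psi'k /recolour (negPf (neqA jA)).
by apply/eqP; move: jA; rewrite inE => /andP[].
Qed.

(** The isolated point k joins the class A. At g in the old stabiliser only the pairs i = j
    contribute, each with beta(g). At g in the new stabiliser that moves k, the index j must be the
    image of k and i any other element of A, which is the sum in [beta_merge]. *)
Lemma young_elt_merge :
  b psi * jm_on C A k * jm_on C A k = #|A|%:R *: b psi'.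
Proof.
apply/twP => g; rewrite young_elt_jm2 // tw_funZ young_eltE.
have permE i j : i \in A -> j \in A -> spin_perm (g * spin_tr i k * spin_tr j k)%g k =
    tperm j k (tperm i k (spin_perm g k)).
  by move=> iA jA; rewrite !spin_permM !spin_perm_tr ?neqA // !permM.
have [Kg|nKg] := boolP (K psi g).
  rewrite K_sub //; rewrite (eq_bigr (fun=> beta g)); first by rewrite sumr_const mulr_natl.
  move=> i iA; rewrite (bigD1 i) //= big1 => [|j /andP[jA ji]].
    by rewrite addr0 -mulgA (spin_trK C) ?neqA // mulg1 young_eltE Kg.
  rewrite young_eltE; case: ifP => // /K_fix; rewrite permE // K_fix // tpermR.
  rewrite tpermD // 1?eq_sym ?neqA //.
  by move=> ik; have := neqA iA; rewrite ik eqxx.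
have [Kg|nKg'] := boolP (K psi' g); last first.
  rewrite mulr0 big1 // => i iA; rewrite big1 // => j jA.
  rewrite young_eltE; case: ifP => // /K_sub.
  by rewrite !stab_colMr ?K_tr // (negPf nKg').
have gkA : spin_perm g k \in A.
  have : spin_perm g k \in k |: A by rewrite psi'A; move/stab_colP: Kg => ->; rewrite psi'k.
  by rewrite in_setU1 => /orP[/eqP /(K_sup Kg)|//]; rewrite (negPf nKg).
rewrite -(beta_merge C kA) //; last first.
  by move=> i; rewrite !psi'A; move/stab_colP: Kg => ->.
rewrite (bigID (fun i => i == spin_perm g k)) /= [X in X + _]big1 ?add0r.
  apply: eq_bigr => i /andP[iA ik]; rewrite (bigD1 (spin_perm g k)) //= big1 ?addr0.
    have kg : k != spin_perm g k by rewrite eq_sym neqA.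
    by rewrite young_eltE K_sup ?stab_colMr ?K_tr // permE // (@tpermD _ i) // tpermL.
  move=> j /andP[jA jk]; rewrite young_eltE; case: ifP => // /K_fix.
  rewrite permE // (@tpermD _ i) // 1?eq_sym ?neqA // tpermD // 1?eq_sym ?neqA //.
  by move=> E; have := neqA gkA; rewrite E eqxx.
move=> i /andP[_ /eqP ik]; rewrite big1 // => j jA; rewrite young_eltE.
case: ifP => // /K_fix; rewrite permE ?ik // tpermL tpermR => E.
by have := neqA jA; rewrite E eqxx.
Qed.

Lemma young_elt_new : A = set0 -> b psi' = b psi.
Proof.
move=> A0; apply: eq_young_elt => g; apply/idP/idP => [Kg|/K_sub //].
apply: K_sup => //; have : spin_perm g k \in k |: A.
  by rewrite psi'A; move/stab_colP: Kg => ->; rewrite psi'k.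
by rewrite A0 setU0 inE => /eqP.
Qed.

Lemma young_elt_comm : b psi * b psi' = b psi' * b psi.
Proof.
rewrite (tw_expand (b psi)) mulr_suml mulr_sumr; apply: eq_bigr => g _.
rewrite -scalerAl -scalerAr young_eltE; case: ifP => [Kg|]; last by rewrite !scale0r.
by rewrite young_eltC // K_sub.
Qed.

(** By merging, [b psi] is a left factor of [b psi']. *)
Lemma young_elt_absorb d : b psi * b psi = d *: b psi ->
  b psi * b psi' = d *: b psi'.
Proof.
move=> idem; have [A0|A0] := eqVneq A set0; first by rewrite young_elt_new.
have m0 : (#|A|%:R : C) != 0 by rewrite pnatr_eq0 cards_eq0.
have -> : b psi' = #|A|%:R^-1 *: (b psi * jm_on C A k * jm_on C A k).
  by rewrite young_elt_merge scalerA mulVf // scale1r.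
by rewrite -scalerAr !mulrA idem -!scalerAl !scalerA mulrC.
Qed.

(** Write the second factor by merging. Absorbing [b psi] gives d, and the square of the sum over A,
    now inside the class of k, acts on [b psi'] by [young_elt_own]; the scalar is d q(|A|)/|A| >
    0. *)
Lemma young_elt_idem_step d : 0 < d -> b psi * b psi = d *: b psi ->
  exists2 d', 0 < d' & b psi' * b psi' = d' *: b psi'.
Proof.
move=> d0 idem; have [A0|A0] := eqVneq A set0.
  by exists d; rewrite // young_elt_new.
have m0 : (0 : C) < #|A|%:R by rewrite ltr0n card_gt0.
exists (#|A|%:R^-1 * (d * qfun C #|A|)).
  apply: mulr_gt0; rewrite ?invr_gt0 //; apply: mulr_gt0 => //.
  by rewrite /qfun divr_gt0 ?ltr0n // muln_gt0 card_gt0 A0.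
have E : b psi' = #|A|%:R^-1 *: (b psi * jm_on C A k * jm_on C A k).
  by rewrite young_elt_merge scalerA mulVf ?scale1r // gt_eqF.
rewrite {2}E -scalerAr !mulrA -young_elt_comm (young_elt_absorb idem).
rewrite -!scalerAl young_elt_own //; first by rewrite !scalerA /qfun !mulrA.
move=> j jA; by rewrite psi'k; apply/eqP; rewrite -psi'A in_setU1 jA orbT.
Qed.
End OneStep.

(** The stabiliser is {1, z}, so the element is 1 - z. *)
Lemma young_elt_discrete (T : eqType) (psi : 'I_n -> T) : injective psi ->
  b psi * b psi = 2 *: b psi.
Proof.
move=> psi_inj; have zd : spin_z n == 1%g = false by apply/negbTE/(spin_z_neq1 C).
have -> : b psi = dl 1%g - dl (spin_z n).
  apply/twP => g; rewrite young_eltE tw_funD tw_funN !tw_deltaE.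
  have [Kg|nKg] := boolP (K psi g).
    have g1 : spin_perm 1%g = spin_perm g.
      by apply/permP => i; apply/psi_inj; rewrite spin_perm1 perm1; move/stab_colP: Kg => ->.
    have [->|->] := spin_perm_fiber C g1.
      by rewrite beta1 eqxx eq_sym zd subr0.
    by rewrite mulg1 -[spin_z n]mulg1 beta_z beta1 mulg1 eqxx zd sub0r.
  have [E|_] := eqVneq g 1%g.
    by case/stab_colP: nKg => i; rewrite E spin_perm1 perm1.
  have [E|_] := eqVneq g (spin_z n); last by rewrite subr0.
  by case/negP: nKg; rewrite E stab_col_z.
rewrite mulrBl !mulrBr !ga_deltaM !mul1g mulg1 spin_zz opprB.
by rewrite scaler_nat mulr2n; tw_ring.
Qed.

Lemma young_elt_idem (T : eqType) (psi : 'I_n -> T) :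
  exists2 d, 0 < d & b psi * b psi = d *: b psi.
Proof.
(* Points below p already have their colour; each remaining point is alone in its class. *)
pose ps p (i : 'I_n) : T + 'I_n := if (i < p)%N then inl (psi i) else inr i.
suff H p : (p <= n)%N -> exists2 d, 0 < d & b (ps p) * b (ps p) = d *: b (ps p).
  have [d d0] := H n (leqnn n); exists d => //.
  have -> // : b psi = b (ps n).
  apply: eq_young_elt => g; apply/eq_forallb => i; rewrite /ps !ltn_ord.
  by apply/eqP/eqP => [->|[]].
elim: p => [_|p IHp lt_p].
  by exists 2; rewrite ?ltr0n //; apply: young_elt_discrete => i j [].
have [d d0 idem] := IHp (ltnW lt_p); pose k := Ordinal lt_p.
have -> : b (ps p.+1) = b (recolour (ps p) k (inl (psi k))).
  apply: eq_young_elt => g; apply/eq_forallb => i.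
  have E j : ps p.+1 j = recolour (ps p) k (inl (psi k)) j.
    rewrite /ps /recolour ltnS leq_eqVlt -(inj_eq val_inj) /=.
    by case: eqP => [jp|//]; congr (inl (psi _)); apply/val_inj.
  by rewrite !E.
apply: young_elt_idem_step idem => // j jk.
by rewrite /ps ltnn; case: ifP.
Qed.

End Merging.

(** * Young elements in a spin representation *)

Section IdempotentTrace.
Variables (C : numFieldType) (m : nat) (E : 'M[C]_m) (d : C).
Hypotheses (d_gt0 : 0 < d) (idemE : E *m E = d *: E).

(** In a full-rank factorisation E = A B the hypothesis forces B A = d, and tr(A B) = tr(B A). *)
Lemma mxtrace_quasi_idem : \tr E = d * (\rank E)%:R.
Proof.
have d0 : d != 0 by rewrite gt_eqF.
have := mulmx_base E; have := row_base_free E; have := col_base_full E.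
move: (col_base E) (row_base E) => A B fullA freeB AB.
have /(row_free_inj freeB)/(row_full_inj fullA) BA : A *m (B *m A) *m B = A *m d%:M *m B.
  rewrite mul_mx_scalar -scalemxAl AB -idemE.
  by transitivity (A *m B *m (A *m B)); [rewrite !mulmxA | rewrite !AB].
by rewrite -[in LHS]AB mxtrace_mulC BA mxtrace_scalar mulr_natr.
Qed.

Lemma mxtrace_quasi_idem_ge0 : 0 <= \tr E.
Proof. by rewrite mxtrace_quasi_idem mulr_ge0 ?ler0n // ltW. Qed.

Lemma mxtrace_quasi_idem_eq0 : \tr E = 0 -> E = 0.
Proof.
move/eqP; rewrite mxtrace_quasi_idem mulf_eq0 gt_eqF //= pnatr_eq0 mxrank_eq0.
by move/eqP.
Qed.
End IdempotentTrace.

Section SpinModule.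
Variables (C : numClosedFieldType) (n : nat) (W : spin_irr C n).
Local Notation GA := (grp_alg C (spin_sym n)).
Local Notation dl g := (tw_delta (triv_cocycle C (spin_sym n)) g).
Local Notation d := (spin_dim W).
Local Notation b := (young_elt C).

Lemma spin_reprM g h : W (g * h)%g = W g *m W h.
Proof. by rewrite repr_mxM ?inE. Qed.

Lemma spin_repr1 : W 1%g = 1%:M. Proof. exact: repr_mx1. Qed.

Definition ga_repr (x : GA) : 'M[C]_d := \sum_g tw_fun x g *: W g.
Local Notation V := ga_repr.

Lemma ga_repr_is_linear : linear V.
Proof.
move=> k x y; rewrite /V scaler_sumr -big_split; apply: eq_bigr => g _ /=.
by rewrite tw_funD tw_funZ scalerDl scalerA.
Qed.
HB.instance Definition _ := GRing.isLinear.Build C GA 'M[C]_d _ V ga_repr_is_linear.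

Lemma ga_repr_delta g : V (dl g) = W g.
Proof.
rewrite /V (bigD1 g) //= big1 => [|h hg]; rewrite tw_deltaE ?eqxx ?scale1r ?addr0 //.
by rewrite (negPf hg) scale0r.
Qed.

Lemma ga_reprM x y : V (x * y) = V x *m V y.
Proof.
rewrite [x in LHS]tw_expand [y in LHS]tw_expand mulr_suml linear_sum /= mulmx_suml.
apply: eq_bigr => g _; rewrite mulr_sumr linear_sum /= mulmx_sumr.
apply: eq_bigr => h _; rewrite -scalerAl -scalerAr !linearZ /= ga_deltaM ga_repr_delta.
by rewrite spin_reprM -scalemxAl !scalerA mulrC.
Qed.

Lemma mxtrace_ga_repr x : \tr (V x) = \sum_g tw_fun x g * spin_char W g.
Proof. by rewrite /V linear_sum; apply: eq_bigr => g _; rewrite linearZ. Qed.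

Lemma young_repr_ge0 (T : eqType) (psi : 'I_n -> T) : 0 <= \tr (V (b psi)).
Proof.
have [e e0 idem] := young_elt_idem C psi.
by apply: (mxtrace_quasi_idem_ge0 e0); rewrite -ga_reprM idem linearZ.
Qed.

Lemma young_repr_eq0 (T : eqType) (psi : 'I_n -> T) :
  \tr (V (b psi)) = 0 -> V (b psi) = 0.
Proof.
have [e e0 idem] := young_elt_idem C psi.
by apply: (mxtrace_quasi_idem_eq0 e0); rewrite -ga_reprM idem linearZ.
Qed.

Section InvariantForm.
(** The standard hermitian form averaged over the group, for which the group acts by isometries and
    involutions are self-adjoint. *)
Definition inv_form (x y : 'rV[C]_d) : C :=
  \sum_g \sum_i (x *m W g) 0 i * ((y *m W g) 0 i)^*.

Lemma inv_form_sum (I : finType) (P : pred I) (F : I -> 'rV[C]_d) y :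
  inv_form (\sum_(j | P j) F j) y = \sum_(j | P j) inv_form (F j) y.
Proof.
rewrite /inv_form [RHS]exchange_big; apply: eq_bigr => g _ /=.
rewrite [RHS]exchange_big; apply: eq_bigr => i _ /=.
by rewrite mulmx_suml summxE mulr_suml.
Qed.

Lemma inv_form_sumr (I : finType) (P : pred I) (F : I -> 'rV[C]_d) x :
  inv_form x (\sum_(j | P j) F j) = \sum_(j | P j) inv_form x (F j).
Proof.
rewrite /inv_form [RHS]exchange_big; apply: eq_bigr => g _ /=.
rewrite [RHS]exchange_big; apply: eq_bigr => i _ /=.
by rewrite mulmx_suml summxE rmorph_sum mulr_sumr.
Qed.

Lemma inv_formJ x y h : inv_form (x *m W h) (y *m W h) = inv_form x y.
Proof.
rewrite /inv_form [RHS](reindex_inj (mulgI h)); apply: eq_bigr => g _.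
by rewrite spin_reprM !mulmxA.
Qed.

Lemma inv_form_eq0 x : inv_form x x = 0 -> x = 0.
Proof.
move=> /eqP; have ge0 g i : 0 <= (x *m W g) 0 i * ((x *m W g) 0 i)^*.
  exact: mul_conjC_ge0.
rewrite psumr_eq0 => [/allP/(_ 1%g)|g _]; last by apply: sumr_ge0.
rewrite mem_index_enum psumr_eq0 => [/(_ isT)/allP x0|i _]; last exact: ge0.
apply/rowP => i; have := x0 i; rewrite mem_index_enum spin_repr1 mulmx1.
by move=> /(_ isT); rewrite mul_conjC_eq0 mxE => /eqP.
Qed.
End InvariantForm.

(* The operator is self-adjoint for an invariant hermitian form. *)
Lemma jm_on_sqr_eq0 (A : {set 'I_n}) k p (M : 'M[C]_(p, d)) : k \notin A ->
  M *m V (jm_on C A k) *m V (jm_on C A k) = 0 -> M *m V (jm_on C A k) = 0.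
Proof.
move=> kA MBB; have neq x : x \in A -> x != k by move=> xA; apply: contraNneq kA => <-.
pose B := V (jm_on C A k); have BE : B = \sum_(j in A) W (spin_tr j k).
  by rewrite /B /jm_on linear_sum /=; apply: eq_bigr => j _; rewrite ga_repr_delta.
have adj x y : inv_form (x *m B) y = inv_form x (y *m B).
  rewrite BE !mulmx_sumr inv_form_sum inv_form_sumr; apply: eq_bigr => j jA.
  rewrite -[RHS](inv_formJ _ _ (spin_tr j k)) -mulmxA -spin_reprM.
  by rewrite (spin_trK C) ?neq // spin_repr1 mulmx1.
apply/row_matrixP => i; rewrite row0; apply: inv_form_eq0.
rewrite row_mul -/B -adj -!row_mul MBB row0 /inv_form.
by rewrite big1 // => g _; rewrite big1 // => j _; rewrite mul0mx mxE mul0r.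
Qed.

Section HighestWeight.
Variables (l : nat) (phi : 'I_n -> 'I_l).
Hypothesis phi_sorted : forall i j : 'I_n, (i <= j)%N -> (phi i <= phi j)%N.
Hypothesis phi_highest : forall k (s : 'I_l), (s < phi k)%N -> V (b (recolour phi k s)) = 0.

(* The square of this sum maps b_phi to b_(recolour phi k s), which vanishes. *)
Lemma highest_other_row k (s : 'I_l) : (s < phi k)%N ->
  V (b phi) *m V (jm_on C [set j | phi j == s] k) = 0.
Proof.
(* psi isolates k, so that both phi and its recolouring arise from psi by merging k into a class. As
   b_phi absorbs b_psi, the factor b_psi can be inserted and merged with the class of s. *)
move=> sk; pose psi i := if i == k then None else Some (phi i).
have nsk : (phi k == s) = false by apply/eqP => E; rewrite E ltnn in sk.
set A := [set j | _]; have kA : k \notin A by rewrite inE nsk.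
apply: jm_on_sqr_eq0 kA _.
have psi_k j : j != k -> psi j != psi k by rewrite /psi eqxx => /negPf->.
have EA : A = [set j | (j != k) && (psi j == Some s)].
  apply/setP => j; rewrite !inE /psi; have [->|//] := eqVneq j k.
  by rewrite nsk.
have E1 : b phi = b (recolour psi k (Some (phi k))).
  apply: eq_young_elt => g; apply/eq_forallb => i; rewrite /recolour /psi.
  have E j : (if j == k then Some (phi k) else if j == k then None else Some (phi j)) = Some (phi j).
    by case: eqP => [->|].
  by rewrite !E.
have E2 : b (recolour phi k s) = b (recolour psi k (Some s)).
  apply: eq_young_elt => g; apply/eq_forallb => i; rewrite /recolour /psi.
  have E j : (if j == k then Some s else if j == k then None else Some (phi j)) =
     Some (if j == k then s else phi j).
    by case: eqP.
  by rewrite !E.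
have [e e0 idem] := young_elt_idem C psi.
have E3 : b phi = e^-1 *: (b phi * b psi).
  rewrite E1 -(young_elt_comm C _ psi_k) (young_elt_absorb _ psi_k idem) scalerA mulVf ?scale1r //.
  by rewrite gt_eqF.
rewrite E3 linearZ /= -!scalemxAl -!ga_reprM -!mulrA (mulrA (b psi)) EA.
by rewrite young_elt_merge // -E2 -scalerAr linearZ /= ga_reprM phi_highest // mulmx0 !scaler0.
Qed.

(** As phi is sorted, the points before k are those of its own colour together with whole classes of
    smaller colour, and the latter contribute 0. The own-colour sum O commutes with b_phi, so each
    of the two factors J can be replaced by O, and [young_elt_own] evaluates the square. *)
Lemma highest_jm (k : 'I_n) :
  V (b phi) *m V (jm_on C [set j : 'I_n | (j < k)%N] k ^+ 2) =
  qfun C #|[set j : 'I_n | (j < k)%N && (phi j == phi k)]| *: V (b phi).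
Proof.
set own := [set j : 'I_n | _ && _]; set J := jm_on _ _ _.
pose O := jm_on C own k.
have kown : k \notin own by rewrite inE ltnn.
have JE : J = O + \sum_(s < l | (s < phi k)%N) jm_on C [set j | phi j == s] k.
  rewrite /J /jm_on (bigID (fun j => phi j == phi k)) /=; congr (_ + _).
    by apply: eq_bigl => j; rewrite !inE.
  rewrite (exchange_big_dep (fun j => (phi j < phi k)%N)) /=; last first.
    by move=> s j sk; rewrite inE => /eqP->.
  apply: eq_big => [j|j /andP[jk pjk]].
    rewrite inE; apply/andP/idP => [[jk /eqP npj]|pj].
      rewrite ltn_neqAle phi_sorted ?(ltnW jk) // andbT.
      by apply/eqP => /val_inj.
    split; last by apply: contraTneq pj => ->; rewrite ltnn.
    by rewrite ltnNge; apply: contraTN pj => /phi_sorted; rewrite -leqNgt.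
  rewrite (bigD1 (phi j)) /=; last first.
    rewrite inE eqxx andbT ltn_neqAle phi_sorted ?andbT.
      by apply: contra pjk => /eqP/val_inj->.
    by apply: ltnW; move: jk; rewrite inE.
  by rewrite big1 ?addr0 // => s /andP[/andP[_]]; rewrite inE => /eqP->; rewrite eqxx.
have bJ : V (b phi) *m V J = V (b phi) *m V O.
  rewrite JE linearD mulmxDr -[RHS]addr0; congr (_ + _).
  rewrite (linear_sum V) mulmx_sumr big1 // => s sk; exact: highest_other_row.
have OC : V (b phi) *m V O = V O *m V (b phi).
  rewrite -!ga_reprM /O /jm_on mulr_sumr mulr_suml; congr V; apply: eq_bigr => j.
  rewrite inE => /andP[jk /eqP pj]; rewrite young_eltC //; apply: stab_col_tr => //.
  by apply: contraTneq jk => ->; rewrite ltnn.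
rewrite expr2 ga_reprM mulmxA bJ OC -mulmxA bJ mulmxA -OC -!ga_reprM young_elt_own //.
  by rewrite linearZ.
by move=> j; rewrite inE => /andP[_ /eqP].
Qed.
End HighestWeight.

End SpinModule.

(** * Counting permutations by cycle type *)

Section CycleLists.
Variable T : finType.
Implicit Types (s t : seq T) (ss tt : seq (seq T)) (f : T -> T) (p : {perm T}).

(** A cycle decomposition with fixed points listed as singletons; the order of the cycles and their
    starting points are free. *)
Definition cycle_list p ss : bool :=
  [&& perm_eq (flatten ss) (enum T), all (fun s => fcycle p s) ss & [::] \notin ss].

Lemma cycle_list_uniq p ss : cycle_list p ss -> uniq (flatten ss).
Proof. by case/and3P=> /perm_uniq->; rewrite enum_uniq. Qed.

Lemma cycle_list_mem p ss x : cycle_list p ss -> x \in flatten ss.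
Proof. by case/and3P=> /perm_mem->; rewrite mem_enum. Qed.

Lemma cycle_list_ex p : exists ss, cycle_list p ss.
Proof.
pose f := (p : T -> T); have f_inj : injective f by exact: perm_inj.
exists [seq fingraph.orbit f x | x <- enum (froots f)]; apply/and3P; split.
- apply/allP => x _ /=; apply/eqP; rewrite (count_uniq_mem _ (enum_uniq _)) mem_enum.
  have csym : connect_sym (frel f) by exact: fconnect_sym.
  rewrite count_flatten -map_comp.
  have /eq_in_map-> : {in enum (froots f), count_mem x \o fingraph.orbit f
      =1 (fun y => (y == froot f x) : nat)}.
    move=> y; rewrite mem_enum => /eqP ry /=.
    rewrite (count_uniq_mem _ (orbit_uniq f y)) -fconnect_orbit.
    by rewrite -(root_connect csym) ry eq_sym eq_sym.
  rewrite sumn_count (eq_count (a2 := pred1 (froot f x))) //.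
  by rewrite (count_uniq_mem _ (enum_uniq _)) mem_enum; congr nat_of_bool; apply: roots_root.
- by apply/allP => s /mapP[x _ ->]; apply: cycle_orbit.
- by apply/negP => /mapP[x _ /(congr1 size)]; rewrite size_orbit -orderSpred.
Qed.

Definition cyc_succ (m k : nat) := if (k.+1 < m)%N then k.+1 else 0%N.

Lemma fcycle_index f s x x0 : uniq s -> fcycle f s -> x \in s ->
  f x = nth x0 s (cyc_succ (size s) (index x s)).
Proof.
case: s => // y s us fs xs; rewrite (eqP (next_cycle fs xs)) next_nth xs /cyc_succ /= ltnS.
case: ltnP => [lt_i|ge_i]; last by rewrite nth_default.
exact: set_nth_default.
Qed.

Lemma cycle_lists_conj f g ss tt x0 : uniq (flatten ss) -> uniq (flatten tt) ->
  all (fun s => fcycle f s) ss -> all (fun s => fcycle g s) tt ->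
  map size ss = map size tt -> forall x, x \in flatten ss ->
  nth x0 (flatten tt) (index (f x) (flatten ss)) = g (nth x0 (flatten tt) (index x (flatten ss))).
Proof.
elim: ss tt => [|s ss IH] [|t tt] //=; rewrite !cat_uniq.
case/and3P=> us /hasPn ns uss /and3P[ut /hasPn nt utt] /andP[fs fss] /andP[gt gtt] [st sz] x.
rewrite mem_cat => /orP[xs|xss].
  have ix : (index x s < size s)%N by rewrite index_mem.
  have lt_s : (cyc_succ (size s) (index x s) < size s)%N.
    by rewrite /cyc_succ; case: ifP => // _; apply: leq_ltn_trans ix.
  have fE := fcycle_index x0 us fs xs.
  have fxs : f x \in s by rewrite fE mem_nth.
  rewrite !index_cat xs fxs !nth_cat -!st ix index_mem fxs.
  rewrite fE index_uniq // [in RHS](@fcycle_index g t _ x0) // ?mem_nth -?st //.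
  by rewrite index_uniq // -st.
have nxs : x \notin s by apply: ns.
have [s' s'ss xs'] := flattenP xss.
have fxs' : f x \in flatten ss.
  apply/flattenP; exists s' => //; have fs' := allP fss _ s'ss.
  by rewrite (eqP (next_cycle fs' xs')) mem_next.
have nfxs : f x \notin s by apply: ns.
rewrite !index_cat (negPf nxs) (negPf nfxs) !nth_cat -!st !ltnNge !leq_addr /=.
by rewrite !addKn IH.
Qed.

(** The conjugating permutation matches the two concatenated lists entry by entry. *)
Lemma cycle_list_conj p q ss tt : cycle_list p ss -> cycle_list q tt ->
  map size ss = map size tt -> exists w, q = (p ^ w)%g.
Proof.
move=> Hs Ht sz; have [us ut] := (cycle_list_uniq Hs, cycle_list_uniq Ht).
have szst : size (flatten ss) = size (flatten tt) by rewrite !size_flatten /shape sz.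
pose w x := nth x (flatten tt) (index x (flatten ss)).
have ix x : (index x (flatten ss) < size (flatten tt))%N.
  by rewrite -szst index_mem (cycle_list_mem _ Hs).
have w_inj : injective w.
  move=> x y; rewrite /w (set_nth_default x _ (ix y)) => /eqP.
  rewrite nth_uniq // => /eqP.
  by apply: (index_inj x); apply: cycle_list_mem Hs.
have [_ fss _] := and3P Hs; have [_ gtt _] := and3P Ht.
exists (perm w_inj); apply: (mulgI (perm w_inj)); rewrite -conjgC; apply/permP => x.
rewrite !permM !permE /w -(cycle_lists_conj x us ut fss gtt sz (cycle_list_mem x Hs)).
by apply: set_nth_default.
Qed.

Lemma cycle_list_order p ss s x : cycle_list p ss -> s \in ss -> x \in s ->
  fingraph.order p x = size s.
Proof.
move=> Hs s_ss xs; have [_ /allP/(_ _ s_ss) fs _] := and3P Hs.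
apply: order_cycle fs _ _ xs; have := cycle_list_uniq Hs.
elim: ss s_ss {Hs} => //= t ss IH; rewrite inE cat_uniq => /orP[/eqP->|/IH us].
  by case/and3P.
by case/and3P=> _ _ /us.
Qed.

Lemma cycle_list_card p ss j : cycle_list p ss ->
  #|[set x | fingraph.order p x == j]| = (j * count_mem j (map size ss))%N.
Proof.
move=> Hs; have us := cycle_list_uniq Hs; have [pe _ _] := and3P Hs.
rewrite cardE /enum_mem size_filter -enumT -(seq.permP pe).
rewrite (eq_count (a2 := fun x => fingraph.order p x == j)); last first.
  by move=> x; rewrite /= inE.
rewrite count_flatten.
have : {subset ss <= ss} by []; elim: {1 3 4}ss => [|s tt IH] /=; first by rewrite muln0.
move=> sub; rewrite IH => [|t t_tt]; last by apply: sub; rewrite inE t_tt orbT.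
rewrite mulnDr; congr (_ + _)%N.
have s_ss : s \in ss by apply: sub; rewrite mem_head.
rewrite (eq_in_count (a2 := fun=> size s == j)).
  by have [<-|_] := eqVneq (size s) j; rewrite ?muln0 ?muln1 ?count_predT // count_pred0.
by move=> x xs /=; rewrite (cycle_list_order Hs s_ss xs).
Qed.

End CycleLists.

Section PartZ.
Implicit Types (r s : seq nat).

Lemma perm_part_z r s : perm_eq r s -> part_z r = part_z s.
Proof.
move=> rs; rewrite /part_z (perm_big _ (perm_undup (perm_mem rs))) /=.
by apply: eq_bigr => j _; rewrite (seq.permP rs).
Qed.

Lemma part_z_cons x r : part_z (x :: r) = (part_z r * (x * (count_mem x r).+1))%N.
Proof.
rewrite /part_z /=; have [xr|xr] := ifP.
  have xu : x \in undup r by rewrite mem_undup.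
  rewrite !(bigD1_seq x xu (undup_uniq r)) /= eqxx add1n expnS factS.
  rewrite (eq_bigr (fun j => (j ^ count_mem j r * (count_mem j r)`!)%N)); first by ring.
  by move=> j /negPf; rewrite eq_sym => ->.
rewrite big_cons /= eqxx (count_memPn (negbT xr)) addn0 expn1 (_ : 1`! = 1)%N // !muln1 mulnC.
congr (_ * _)%N; rewrite big_seq [RHS]big_seq; apply: eq_bigr => j.
by rewrite mem_undup => jr; have [E|//] := eqVneq x j; rewrite E jr in xr.
Qed.

Lemma part_z_gt0 r : 0 \notin r -> (0 < part_z r)%N.
Proof.
elim: r => [|x r IH]; first by rewrite /part_z /= big_nil.
rewrite inE negb_or part_z_cons => /andP[x0 /IH r0].
by rewrite !muln_gt0 r0 lt0n eq_sym x0.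
Qed.

Lemma sumn_mult r m : all (fun j => j < m)%N r ->
  (\sum_(b < m) b * count_mem (val b) r = sumn r)%N.
Proof.
elim: r => [|x r IH] /=; first by move=> _; rewrite big1 // => b _; rewrite muln0.
case/andP=> xm /IH <-; under eq_bigr do rewrite mulnDr.
rewrite big_split /=; congr (_ + _)%N; rewrite (bigD1 (Ordinal xm)) //= eqxx muln1.
rewrite big1 ?addn0 // => i ix; have [E|_] := eqVneq x (val i); last by rewrite muln0.
by case/eqP: ix; apply/val_inj.
Qed.
End PartZ.

Lemma perm_cycle_list (T : finType) (p : {perm T}) ss tt :
  perm_eq ss tt -> cycle_list p ss = cycle_list p tt.
Proof.
move=> st; rewrite /cycle_list (perm_mem st) (perm_all _ st).
by rewrite (permPl (perm_flatten st)).
Qed.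

Lemma cycle_list_rot (T : finType) (p : {perm T}) s ss k :
  cycle_list p (s :: ss) -> cycle_list p (rot k s :: ss).
Proof.
case/and3P=> /= pe /andP[fs fss]; rewrite inE negb_or => /andP[s0 ss0].
apply/and3P; split => /=.
- by apply: perm_trans pe; rewrite perm_cat2r perm_rot.
- by rewrite rot_cycle fs.
- by rewrite inE negb_or ss0 andbT eq_sym -size_eq0 size_rot size_eq0 eq_sym.
Qed.

Section PermTypes.
Variable n : nat.

(** The cycle type is expressed by the number of points on cycles of each length, which involves no
    choice of a cycle list. *)
Definition perm_type (p : 'S_n) (r : seq nat) : bool :=
  [forall j : 'I_n.+1, #|[set x | fingraph.order p x == j]| == (j * count_mem (val j) r)%N].

Lemma cycle_list_sizes (p : 'S_n) ss : cycle_list p ss ->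
  [/\ sumn (map size ss) = n, 0%N \notin map size ss & all (fun j => j < n.+1)%N (map size ss)].
Proof.
case/and3P=> /perm_size; rewrite size_flatten size_enum_ord => sz _ n0; split=> //.
  by apply: contra n0 => /mapP[s s_ss /esym/eqP]; rewrite size_eq0 => /eqP<-.
apply/allP => j j_ss; rewrite ltnS -[X in (_ <= X)%N]sz.
by rewrite (perm_sumn (perm_to_rem j_ss)) /= leq_addr.
Qed.

Lemma perm_typeE (p : 'S_n) ss r : cycle_list p ss -> 0%N \notin r ->
  all (fun j => j < n.+1)%N r -> perm_type p r = perm_eq (map size ss) r.
Proof.
move=> Hs r0 rn; have [_ ss0 ssn] := cycle_list_sizes Hs.
apply/forallP/idP => [H|/seq.permP H j]; last by rewrite (cycle_list_card _ Hs) -H.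
apply/allP => j; rewrite mem_cat => j_in; apply/eqP.
have jn : (j < n.+1)%N by case/orP: j_in => [/(allP ssn)|/(allP rn)].
have j0 : (0 < j)%N.
  by rewrite lt0n; apply: contraTneq j_in => ->; rewrite (negPf ss0) (negPf r0).
have /eqP := H (Ordinal jn); rewrite (cycle_list_card _ Hs) /= => /eqP.
by rewrite eqn_pmul2l // => /eqP.
Qed.

Local Notation mx := (@ord_max n).
Local Notation lf := (lift mx).

(** The new point is placed just before i in the cycle of i, or as a fixed point; every permutation
    of n + 1 points arises exactly once. *)
Definition perm_insert (t : 'S_n) (o : option 'I_n) : 'S_n.+1 :=
  if o is Some i then (lift_perm mx mx t * tperm (lf i) mx)%g else lift_perm mx mx t.

Lemma perm_insert_max t o : perm_insert t o mx = if o is Some i then lf i else mx.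
Proof. by case: o => [i|]; rewrite /= ?permM lift_perm_id ?tpermR. Qed.

Lemma perm_insert_inj : injective (fun to => perm_insert to.1 to.2).
Proof.
move=> [t o] [t' o'] /= E.
have eo : o = o'.
  have := congr1 (fun s : 'S_n.+1 => s mx) E; rewrite !perm_insert_max.
  case: (o) (o') => [i|] [j|] //= => [/lift_inj-> //|/eqP|/eqP].
    by rewrite eq_sym (negPf (neq_lift _ _)).
  by rewrite (negPf (neq_lift _ _)).
have E' : lift_perm mx mx t = lift_perm mx mx t'.
  by move: E; rewrite -eo; case: (o) => [i /mulIg|].
rewrite eo; congr (_, _); apply/permP => i; apply: (@lift_inj _ mx).
by rewrite -(lift_perm_lift mx mx t) -(lift_perm_lift mx mx t') E'.
Qed.

Lemma big_perm_insert (R : Type) (idx : R) (op : Monoid.com_law idx)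
    (F : 'S_n.+1 -> R) :
  \big[op/idx]_s F s = \big[op/idx]_t \big[op/idx]_o F (perm_insert t o).
Proof.
have [|g gK Kg] := inj_card_bij perm_insert_inj.
  by rewrite card_prod card_option card_ord !card_Sn factS mulnC.
rewrite pair_big /= (reindex (fun to => perm_insert to.1 to.2)) //=.
by exists g => x _; [apply: gK | apply: Kg].
Qed.

Lemma cycle_list_insert_none t ss : cycle_list t ss ->
  cycle_list (perm_insert t None) ([:: mx] :: map (map lf) ss).
Proof.
case/and3P=> pe fss n0; apply/and3P; split=> /=.
- rewrite -map_flatten; apply: uniq_perm => [||x]; rewrite ?enum_uniq //=.
    rewrite map_inj_uniq ?(perm_uniq pe) ?enum_uniq ?andbT //; last exact: lift_inj.
    by apply/mapP => -[i _ /eqP]; rewrite (negPf (neq_lift _ _)).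
  rewrite mem_enum inE; case: (unliftP mx x) => [i ->|->]; rewrite ?eqxx //.
  by rewrite mem_map ?(perm_mem pe) ?mem_enum ?orbT //; exact: lift_inj.
- rewrite lift_perm_id eqxx /=; apply/allP => s' /mapP[s /(allP fss) fs ->].
  rewrite cycle_map; apply: sub_cycle fs => x y /= /eqP<-.
  by rewrite lift_perm_lift.
- rewrite inE /=; apply/negP => /mapP[s s_ss /(congr1 size)]; rewrite size_map.
  by move/esym/eqP; rewrite size_eq0 => /eqP s0; rewrite -s0 s_ss in n0.
Qed.

Lemma perm_insert_lift t i x :
  perm_insert t (Some i) (lf x) = if t x == i then mx else lf (t x).
Proof.
rewrite /= permM lift_perm_lift; case: eqP => [->|/eqP tx]; first exact: tpermL.
by rewrite tpermD ?neq_lift // (inj_eq lift_inj) eq_sym.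
Qed.

Arguments perm_insert : simpl never.

Lemma cycle_list_insert_some t i s ss : cycle_list t ((i :: s) :: ss) ->
  cycle_list (perm_insert t (Some i)) ((mx :: lf i :: map lf s) :: map (map lf) ss).
Proof.
move=> Hs; have us := cycle_list_uniq Hs; have [_ fs n0s] := and3P Hs.
have /and3P[pe _ n0] := cycle_list_insert_none Hs.
apply/and3P; split; [exact: pe | move=> /= | by move: n0; rewrite !inE].
have /andP[ni us'] : (i \notin s ++ flatten ss) && uniq (s ++ flatten ss) by [].
move: ni; rewrite mem_cat negb_or => /andP[nis niss].
have /andP[fis fss] : path (frel t) i (rcons s i) && all (fun s => fcycle t s) ss by [].
apply/andP; split.
  rewrite -/(perm_insert t (Some i)) perm_insert_max eqxx /=.
  suff pth s' x : path (frel t) x (rcons s' i) -> i \notin s' ->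
      path (frel (perm_insert t (Some i))) (lf x) (rcons (map lf s') mx) by apply: pth.
  elim: s' x => [|y s' IH] x.
    by move=> /andP[/eqP tx _] _; rewrite /= perm_insert_lift tx eqxx /= eqxx.
  rewrite inE negb_or eq_sym => /andP[/eqP tx /IH pth] /andP[/negPf yi /pth pth'].
  apply/andP; split; last exact: pth'.
  by rewrite /= perm_insert_lift tx yi eqxx.
apply/allP => s' /mapP[s1 s1ss ->]; have fs1 := allP fss _ s1ss.
rewrite cycle_map; apply: (@sub_in_cycle _ [in s1] (frel t)) fs1; last exact/allP.
move=> x y /= xs ys /eqP E; rewrite -/(perm_insert t (Some i)) perm_insert_lift E.
have [yi|_] := eqVneq y i; last exact: eqxx.
by case/negP: niss; rewrite -yi; apply/flattenP; exists s1.
Qed.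

Lemma perm_insert_sizes t i ss : cycle_list t ss ->
  exists2 tt, cycle_list (perm_insert t (Some i)) tt &
    fingraph.order t i \in map size ss /\
    map size tt = (fingraph.order t i).+1 :: map size (behead tt) /\
    perm_eq (map size ss) (fingraph.order t i :: map size (behead tt)).
Proof.
move=> Hs; have /flattenP[s s_ss is_] := cycle_list_mem i Hs.
have os := cycle_list_order Hs s_ss is_.
have := Hs; rewrite (perm_cycle_list _ (perm_to_rem s_ss)).
move/(cycle_list_rot (index i s)); rewrite rot_index //.
set s' := drop _ _ ++ _ => /cycle_list_insert_some Ht.
have ss' : size s = (size s').+1.
  by rewrite -(size_rot (index i s)) rot_index.
eexists; first exact: Ht; rewrite os; split; first exact: map_f.
split; first by rewrite /= size_map ss'.
rewrite /= (perm_trans (perm_map size (perm_to_rem s_ss))) //= perm_cons.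
by rewrite -map_comp; apply/eq_subset_permP || (rewrite (eq_map (g := size)) // => x; rewrite /= size_map).
Qed.

End PermTypes.

Lemma perm_consl (T : eqType) (a : T) (R r : seq T) :
  perm_eq (a :: R) r = (a \in r) && perm_eq R (rem a r).
Proof.
apply/idP/andP => [H|[ar H]].
  have ar : a \in r by rewrite -(perm_mem H) mem_head.
  by split=> //; rewrite -(perm_cons a) (perm_trans H) // perm_to_rem.
by rewrite (perm_trans _ (_ : perm_eq (a :: rem a r) r)) ?perm_cons // perm_sym perm_to_rem.
Qed.

Lemma big_option (R : Type) (idx : R) (op : Monoid.com_law idx) (I : finType)
    (F : option I -> R) :
  \big[op/idx]_o F o = op (F None) (\big[op/idx]_i F (Some i)).
Proof.
rewrite (bigD1 None) //=; congr (op _ _).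
rewrite (reindex_omap Some id) /=; last by case.
by apply: eq_bigl => i; rewrite eqxx.
Qed.

Section CountTypes.
Implicit Type r : seq nat.

Definition type_count n r := #|[set p : 'S_n | perm_type p r]|.

Lemma perm_typeP n (p : 'S_n) ss r : cycle_list p ss -> 0%N \notin r -> sumn r = n ->
  perm_type p r = perm_eq (map size ss) r.
Proof.
move=> Hs r0 rn; apply: perm_typeE => //; apply/allP => j jr.
by rewrite ltnS -rn (perm_sumn (perm_to_rem jr)) leq_addr.
Qed.

Lemma type_insert_none n (t : 'S_n) r : 0%N \notin r -> sumn r = n.+1 ->
  perm_type (perm_insert t None) r = (1 \in r)%N && perm_type t (rem 1%N r).
Proof.
move=> r0 rn; have [ss Hs] := cycle_list_ex t.
rewrite (perm_typeP (cycle_list_insert_none Hs)) //= -map_comp.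
rewrite (eq_map (g := size)); last by move=> s /=; rewrite size_map.
rewrite perm_consl; case: (boolP (1%N \in r)) => //= r1.
rewrite (perm_typeP Hs) //; first by apply: contra r0; apply: mem_rem.
by move: rn; rewrite (perm_sumn (perm_to_rem r1)) /= => -[].
Qed.

Lemma type_insert_some n (t : 'S_n) i r : 0%N \notin r -> sumn r = n.+1 ->
  let a := fingraph.order t i in
  perm_type (perm_insert t (Some i)) r = (a.+1 \in r)%N && perm_type t (a :: rem a.+1 r).
Proof.
move=> r0 rn a; have [ss Hs] := cycle_list_ex t.
have [tt Ht [ass [Et sst]]] := perm_insert_sizes i Hs.
rewrite (perm_typeP Ht) // Et -/a perm_consl; case: (boolP (a.+1 \in r)) => //= r1.
have a0 : (0 < a)%N by rewrite /a -orderSpred.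
rewrite (perm_typeP Hs).
- by rewrite (permPl sst) -/a perm_cons.
- rewrite inE negb_or eq_sym -lt0n a0; by apply: contra r0; apply: mem_rem.
by move: rn; rewrite (perm_sumn (perm_to_rem r1)) /= => -[].
Qed.

(** Removing the last point deletes a 1-cycle or shortens a cycle of length a + 2. The factor counts
    the points on cycles of length a + 1, before any of which the last point can be put back. *)
Lemma type_count_rec n r : 0%N \notin r -> sumn r = n.+1 ->
  type_count n.+1 r = ((1 \in r) * type_count n (rem 1 r) +
    \sum_(a < n) (a.+2 \in r) * (a.+1 * (count_mem a.+1 r).+1)
                 * type_count n (a.+1 :: rem a.+2 r))%N.
Proof.
move=> r0 rn; rewrite /type_count -sum1_card big_mkcond /=.
rewrite (eq_bigr (fun s : 'S_n.+1 => perm_type s r : nat)); last first.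
  by move=> s _; rewrite inE; case: ifP.
rewrite big_perm_insert; under eq_bigr => t _ do rewrite big_option /= type_insert_none //.
rewrite big_split /=; congr (_ + _)%N.
  rewrite -sum1_card big_distrr [RHS]big_mkcond /=; apply: eq_bigr => t _.
  by rewrite inE; case: (1%N \in r); case: (perm_type _ _).
under eq_bigr => t _ do under eq_bigr => i _ do rewrite type_insert_some //.
transitivity (\sum_(t : 'S_n) \sum_(a < n) (a.+2 \in r) *
    (a.+1 * (count_mem a.+1 r).+1) * perm_type t (a.+1 :: rem a.+2 r))%N; last first.
  rewrite exchange_big; apply: eq_bigr => a _ /=.
  rewrite -big_distrr -sum1_card [in RHS]big_mkcond; congr (_ * _)%N.
  by apply: eq_bigr => t _; rewrite inE; case: (perm_type _ _).
apply: eq_bigr => t _.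
have lt_o i : ((fingraph.order t i).-1 < n)%N.
  by rewrite -ltnS orderSpred ltnS (leq_trans (max_card _)) // card_ord.
rewrite (partition_big (fun i => Ordinal (lt_o i)) xpredT) //=; apply: eq_bigr => a _.
rewrite (eq_bigr (fun=> ((a.+2 \in r) && perm_type t (a.+1 :: rem a.+2 r)) : nat)); last first.
  by move=> i /eqP/(congr1 val) /= <-; rewrite orderSpred.
rewrite sum_nat_const -mulnA; case: (a.+2 \in r); rewrite ?muln0 ?mul0n //= !mul1n.
have [tt|_] := boolP (perm_type _ _); rewrite ?muln0 // !muln1.
have lt_a : (a.+1 < n.+1)%N by rewrite ltnS.
have /eqP := forallP tt (Ordinal lt_a); rewrite /= eqxx count_mem_rem.
rewrite (_ : (a.+2 == a.+1) = false) ?subn0 ?add1n => [<-|]; last by apply/negbTE; lia.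
by apply: eq_card => i; rewrite inE unfold_in -[eqn _ _]/(_ == _ :> nat) -eqSS orderSpred.
Qed.

(** Each term of the recursion, times z_r, is n! times b times the multiplicity of b in r; these
    products b times multiplicity add up to n + 1 in the inductive step. *)
Theorem type_count_part_z n r : 0%N \notin r -> sumn r = n ->
  (type_count n r * part_z r = n`!)%N.
Proof.
elim: n r => [|n IH] r r0 rn.
  have -> : r = [::].
    case: r r0 rn => // x r; rewrite inE negb_or => /andP[x0 _] /= /eqP.
    by rewrite addn_eq0 => /andP[/eqP E]; rewrite E eqxx in x0.
  rewrite /part_z /= big_nil muln1 /type_count (_ : [set _ | _] = setT).
    by rewrite cardsT card_Sn.
  apply/setP => p; rewrite !inE; apply/forallP => j /=; rewrite muln0 cards_eq0.
  by apply/eqP/setP => -[].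
have cnt b : b \in r -> part_z r = (part_z (rem b r) * (b * count_mem b r))%N.
  move=> br; rewrite (perm_part_z (perm_to_rem br)) part_z_cons count_mem_rem eqxx.
  by rewrite subn1 prednK // -has_count has_pred1.
have sub0 b : 0%N \notin rem b r by apply: contra r0; apply: mem_rem.
have sz b : b \in r -> (b + sumn (rem b r) = n.+1)%N.
  by move=> br; rewrite -rn (perm_sumn (perm_to_rem br)).
rewrite type_count_rec // mulnDl.
have -> : (((1 \in r) * type_count n (rem 1 r)) * part_z r = n`! * (1 * count_mem 1%N r))%N.
  case: (boolP (1%N \in r)) => [r1|/count_memPn->]; last by rewrite !mul0n !muln0.
  rewrite (cnt _ r1) /= mul1n mulnA IH //; by have := sz _ r1; lia.
rewrite big_distrl /= (eq_bigr (fun a : 'I_n => n`! * (a.+2 * count_mem a.+2 r)))%N.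
  rewrite -big_distrr -mulnDr factS mulnC; congr (_ * _)%N.
  rewrite -rn -(@sumn_mult r n.+2); last first.
    apply/allP => j jr; rewrite ltnS -rn (perm_sumn (perm_to_rem jr)); exact: leq_addr.
  by rewrite !big_ord_recl /= mul0n add0n.
move=> a _; case: (boolP (a.+2 \in r)) => [ra|/count_memPn->]; last by rewrite !mul0n !muln0.
rewrite (cnt _ ra) /= mul1n.
have <- : (type_count n (a.+1 :: rem a.+2 r) * part_z (a.+1 :: rem a.+2 r) = n`!)%N.
  apply: IH; first by rewrite inE negb_or sub0.
  by have := sz _ ra; rewrite /=; lia.
rewrite part_z_cons count_mem_rem (_ : (a.+2 == a.+1) = false) ?subn0; first by ring.
by apply/negbTE; lia.
Qed.

End CountTypes.

Lemma part_ex n r : is_partition n r -> exists p : n.-bseq 'I_n.+1, parts p = r.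
Proof.
case/and3P=> _ r0 /eqP rn; have sz : (size (map (@inord n) r) <= n)%N.
  rewrite size_map -rn; elim: r r0 {rn} => //= x r IH; rewrite inE negb_or => /andP[x0 /IH].
  by rewrite eq_sym -lt0n in x0; lia.
exists (Bseq sz); rewrite /parts /= -map_comp map_id_in // => j jr /=.
by rewrite inordK // ltnS -rn (perm_sumn (perm_to_rem jr)) leq_addr.
Qed.

Lemma parts_inj n : injective (@parts n).
Proof. by move=> p q /(inj_map val_inj)/val_inj. Qed.

Lemma odd_seq_inj n : injective (@odd_seq n).
Proof. by move=> p q /parts_inj/val_inj. Qed.

Lemma odd_seqP n (r : odd_part n) : is_partition n r /\ all odd r.
Proof. by apply/andP; apply: (valP r). Qed.

Lemma odd_part_ex n r : is_partition n r -> all odd r ->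
  exists p : odd_part n, odd_seq p = r.
Proof.
move=> pr or; have [p Ep] := part_ex pr.
have Hp : is_partition n (parts p) && all odd (parts p) by rewrite Ep pr or.
by exists (exist _ p Hp).
Qed.

Section SumByType.
Variables (C : numFieldType) (n : nat) (F : 'S_n -> C) (tau : seq nat -> 'S_n).
Hypothesis FJ : forall p w, F (p ^ w)%g = F p.
Hypothesis tauP : forall r, is_partition n r ->
  exists2 ss, cycle_list (tau r) ss & map size ss = r.
Hypothesis F_even : forall r, is_partition n r -> ~~ all odd r -> F (tau r) = 0.

Let sizes (p : 'S_n) := sort geq (map size (xchoose (cycle_list_ex p))).

Let sizesP p : exists2 ss, cycle_list p ss & map size ss = sizes p.
Proof.
have Hs := xchooseP (cycle_list_ex p); set ss := xchoose _ in Hs.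
exists (sort (relpre size geq) ss); last by rewrite -sort_map.
by rewrite (perm_cycle_list _ (_ : perm_eq _ ss)) // perm_sort.
Qed.

Let sizes_part p : is_partition n (sizes p).
Proof.
have [ss Hs Es] := sizesP p; have [sn n0 _] := cycle_list_sizes Hs.
by rewrite /is_partition -{2 3}Es sn n0 eqxx andbT /= sort_sorted.
Qed.

Let sizes_uniq p r : is_partition n r -> perm_type p r = (r == sizes p).
Proof.
move=> pr; have [sr r0 /eqP rn] := and3P pr; have [ss Hs Es] := sizesP p.
rewrite (perm_typeP Hs) // Es; apply/idP/eqP => [E|->]; last exact: perm_refl.
apply: (@sorted_eq _ geq) => //.
- by move=> x y w xy yw; apply: leq_trans yw xy.
- by move=> x y; rewrite /geq /= andbC -eqn_leq => /eqP.
- by have [] := and3P (sizes_part p).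
- by rewrite perm_sym.
Qed.

Let F_sizes p : F p = F (tau (sizes p)).
Proof.
have [ss Hs Es] := sizesP p; have [tt Ht Et] := tauP (sizes_part p).
have [w ->] := cycle_list_conj Hs Ht (etrans Es (esym Et)).
by rewrite FJ.
Qed.

(** A sum over conjugacy classes: n!/z_r is the class size, and types with an even part contribute
    0. *)
Lemma sum_by_type :
  \sum_p F p = \sum_(r : odd_part n) n`!%:R / (part_z r)%:R * F (tau r).
Proof.
transitivity (\sum_(p : 'S_n) \sum_(r : odd_part n) (perm_type p r)%:R * F (tau r)).
  apply: eq_bigr => p _; have [op|nop] := boolP (all odd (sizes p)).
    have [r Er] := odd_part_ex (sizes_part p) op.
    rewrite (bigD1 r) //= big1 => [|r' r'r].
      rewrite addr0 F_sizes sizes_uniq ?Er ?eqxx ?mul1r //.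
    have [pr' _] := odd_seqP r'; rewrite sizes_uniq // -Er.
    by rewrite (inj_eq (@odd_seq_inj n)) (negPf r'r) mul0r.
  rewrite F_sizes F_even ?sizes_part // big1 // => r _.
  have [pr or] := odd_seqP r; rewrite sizes_uniq //.
  case: eqP => [E|_]; last by rewrite mul0r.
  by rewrite -E or in nop.
rewrite exchange_big; apply: eq_bigr => r _.
have [/and3P[_ r0 /eqP rn] _] := odd_seqP r.
rewrite -mulr_suml -(type_count_part_z r0 rn); congr (_ * _).
rewrite natrM mulfK ?pnatr_eq0 -?lt0n ?part_z_gt0 //.
rewrite /type_count -sum1_card natr_sum [RHS]big_mkcond; apply: eq_bigr => p _.
by rewrite inE; case: (perm_type _ _).
Qed.
End SumByType.

(** * The elements [rho]: cycle types and values of [beta] *)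

Section SpinCycles.
Variable n : nat.

Definition spin_cyc (s : seq 'I_n) : spin_sym n := spin_cycle n (map (fun i : 'I_n => i.+1) s).

Lemma spin_cyc_rcons s p : spin_cyc (rcons s p) = (\prod_(i <- rev s) spin_tr i p)%g.
Proof.
rewrite /spin_cyc /spin_cycle map_rcons last_rcons size_rcons -cats1 take_size_cat //.
by rewrite -map_rev big_map.
Qed.

Lemma spin_type_fromE start r (t : seq 'I_n) :
  map (fun i : 'I_n => i.+1) t = iota start (sumn r) ->
  spin_type_from n start r = (\prod_(s <- reshape r t) spin_cyc s)%g.
Proof.
elim: r start t => [|x r IH] start t /= Et; first by rewrite big_nil.
have sz : size t = (x + sumn r)%N by rewrite -(size_map (fun i : 'I_n => i.+1)) Et size_iota.
rewrite big_cons (IH _ (drop x t)); last by rewrite map_drop Et iotaD drop_size_cat ?size_iota.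
by congr (_ * _)%g; rewrite /spin_cyc map_take Et iotaD take_size_cat ?size_iota.
Qed.

Lemma spin_typeE r : sumn r = n ->
  spin_type n r = (\prod_(s <- reshape r (enum 'I_n)) spin_cyc s)%g.
Proof.
move=> rn; apply: spin_type_fromE; rewrite rn (map_comp succn val) val_enum_ord.
by rewrite (iotaDl 1).
Qed.

Lemma star_perm (p : 'I_n) q (g := (\prod_(i <- q) tperm i p)%g) : uniq (p :: q) ->
  fcycle g (p :: q) /\ (forall x, x \notin p :: q -> g x = x).
Proof.
rewrite {}/g; elim: q => [|a q IH].
  by rewrite big_nil /= perm1 eqxx; split=> // x _; rewrite perm1.
rewrite /= inE negb_or big_cons => /and3P[/andP[pa pq] aq uq].
have [|fc fx] := IH; first by rewrite /= pq.
set g := (\prod_(i <- q) _)%g in fc fx *.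
have ga : g a = a by apply: fx; rewrite inE negb_or eq_sym pa.
split=> [|x]; last first.
  rewrite !inE !negb_or => /and3P[xp xa xq]; rewrite permM tpermD 1?eq_sym //.
  by apply: fx; rewrite inE negb_or xp.
rewrite /= permM tpermR ga eqxx /=; move: fc => /=.
case: (q) pq aq uq => [|y s] /= pq aq uq.
  by rewrite permM tpermL.
rewrite permM tpermL => /andP[-> fp] /=.
move: pq aq; rewrite !inE !negb_or => /andP[py ps] /andP[ay as_].
have {py ps ay as_} : all (fun x => (p != x) && (a != x)) (y :: s).
  rewrite /= py ay /=; apply/allP => x xs; apply/andP; split.
    by apply: contraNneq ps => ->.
  by apply: contraNneq as_ => ->.
elim: s y fp {uq} => [|x s IHs] y /= /andP[/eqP gy fp] /andP[/andP[py ay] Hs].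
  by rewrite permM tpermD // gy eqxx.
by rewrite permM tpermD // gy eqxx; apply: IHs.
Qed.

Lemma spin_cyc_perm s : s != [::] -> uniq s ->
  fcycle (spin_perm (spin_cyc s)) (rev s) /\
  (forall x, x \notin s -> spin_perm (spin_cyc s) x = x).
Proof.
case/lastP: s => // s p _ us; rewrite spin_cyc_rcons.
have us' : uniq (p :: rev s) by rewrite -rev_rcons rev_uniq.
have -> : spin_perm (\prod_(i <- rev s) spin_tr i p)%g = (\prod_(i <- rev s) tperm i p)%g.
  move: us' => /= /andP[]; elim: (rev s) => [|a q IH]; first by rewrite !big_nil spin_perm1.
  rewrite inE negb_or => /andP[pa pq] /andP[_ uq].
  by rewrite !big_cons spin_permM IH // spin_perm_tr // eq_sym.
have [fc fx] := star_perm us'; rewrite rev_rcons; split=> // x xs.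
by apply: fx; rewrite -rev_rcons mem_rev.
Qed.

Lemma spin_cycs_perm ss (g := spin_perm (\prod_(s <- ss) spin_cyc s)%g) :
  [::] \notin ss -> uniq (flatten ss) ->
  all (fun s => fcycle g s) (map rev ss) /\ (forall x, x \notin flatten ss -> g x = x).
Proof.
rewrite {}/g; elim: ss => [|s ss IH] /=; first by rewrite big_nil spin_perm1; split=> // x _; rewrite perm1.
rewrite inE negb_or eq_sym cat_uniq big_cons spin_permM => /andP[s0 n0] /and3P[us nss uss].
have [fs fsx] := spin_cyc_perm s0 us; have [fss fssx] := IH n0 uss.
set g := spin_perm _ in fs fsx *; set h := spin_perm _ in fss fssx *.
split; last first.
  by move=> x; rewrite mem_cat negb_or => /andP[xs xss]; rewrite permM fsx ?fssx.
apply/andP; split.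
  apply: (@sub_in_cycle _ [in s] (frel g)) fs; last by apply/allP => x; rewrite mem_rev.
  move=> x y /= xs ys /eqP gx; rewrite permM gx fssx //.
  by apply: contra nss => yss; apply/hasP; exists y.
apply/allP => s' s's; have fs' := allP fss _ s's.
apply: (@sub_in_cycle _ [in s'] (frel h)) fs'; last exact/allP.
move=> x y /= xs' ys' /eqP hx; rewrite permM fsx ?hx //.
apply: contra nss => xs; apply/hasP; exists x => //.
have [t tss Et] := mapP s's; apply/flattenP; exists t => //.
by rewrite -mem_rev -Et.
Qed.

Lemma reshape_nonempty (T : eqType) (r : seq nat) (t : seq T) :
  0%N \notin r -> sumn r = size t -> [::] \notin reshape r t.
Proof.
move=> r0 rn; apply: contra r0 => /(map_f size); rewrite -[map _ _]/(shape _).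
by rewrite reshapeKl // rn.
Qed.

Lemma spin_type_cycle_list r : is_partition n r ->
  exists2 ss, cycle_list (spin_perm (spin_type n r)) ss & map size ss = r.
Proof.
case/and3P=> _ r0 /eqP rn; rewrite spin_typeE //.
have rsz : sumn r = size (enum 'I_n) by rewrite size_enum_ord.
set ss := reshape _ _; have fss : flatten ss = enum 'I_n by rewrite reshapeKr // rsz.
have n0 : [::] \notin ss by apply: reshape_nonempty.
have us : uniq (flatten ss) by rewrite fss enum_uniq.
have [fs _] := spin_cycs_perm n0 us.
exists (map rev ss); last first.
  rewrite -map_comp (eq_map (g := size)) => [|s /=]; last by rewrite size_rev.
  by rewrite -[map _ _]/(shape ss) reshapeKl // rsz.
apply/and3P; split=> //.
  rewrite -fss; apply/seq.permP => P; rewrite !count_flatten -map_comp.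
  by congr sumn; apply: eq_map => s /=; rewrite count_rev.
apply: contra n0 => /mapP[s sss /(congr1 size)]; rewrite size_rev => /esym/eqP.
by rewrite size_eq0 => /eqP<-.
Qed.

End SpinCycles.

Section BetaSpinType.
Variables (C : numClosedFieldType) (n : nat).
Local Notation c := (@cl_gen C n).
Local Notation u := (@cl_root C n).
Local Notation rt := (rt2 C).

Lemma cl_in_sub (A B : {set 'I_n}) (a : clifford C n) :
  A \subset B -> cl_in A a -> cl_in B a.
Proof. by move=> /subsetP AB aA x /aA xA i /xA /AB. Qed.

Lemma vac_gen (i : 'I_n) (a : clifford C n) : cl_in (~: [set i]) a -> vac (c i * a) = 0.
Proof.
move=> ai; have ii : cl_in [set i] (c i) by apply: cl_in_gen; rewrite inE.
by rewrite (vac_disjoint ii ai) (vac_odd (@cl_par_gen C n i)) mul0r.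
Qed.

Lemma cl_in_star (A : {set 'I_n}) p q (a : clifford C n) : p \in A -> {subset q <= A} ->
  cl_in A a -> cl_in A (\prod_(i <- q) u i p * a).
Proof.
move=> pA; elim: q => [|i q IH] qA aA; first by rewrite big_nil mul1r.
rewrite big_cons -mulrA; apply: cl_inM.
  by apply: cl_in_root => //; apply: qA; rewrite mem_head.
by apply: IH => // j jq; apply: qA; rewrite inE jq orbT.
Qed.

(** The two values are computed together because splitting off a factor (c i - c p)/sqrt 2 exchanges
    them: c i occurs nowhere else, so only the part with c p survives. *)
Lemma vac_star p q (a : clifford C n) : uniq (p :: q) ->
  cl_in (~: [set x in p :: q]) a ->
  vac (\prod_(i <- q) u i p * a) = (if odd (size q) then 0 else rt ^- size q) * vac a /\
  vac (c p * (\prod_(i <- q) u i p * a)) =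
    (if odd (size q) then - rt ^- size q else 0) * vac a.
Proof.
elim: q => [|i q IH] upq aA.
  rewrite big_nil mul1r expr0 invr1 mul1r mul0r; split=> //.
  by apply: vac_gen; apply: cl_in_sub aA; rewrite setCS sub1set !inE eqxx.
have [] := IH.
- by move: upq => /= /andP[]; rewrite inE negb_or => /andP[_ ->] /andP[_ ->].
- by apply: cl_in_sub aA; rewrite setCS; apply/subsetP => x; rewrite !inE => /orP[]->; rewrite ?orbT.
rewrite big_cons -mulrA /u; set Y := \prod_(_ <- _) _ * a => E1 E2.
move: upq => /= /andP[]; rewrite inE negb_or => /andP[pi pq] /andP[iq uq].
have Yi : cl_in (~: [set i]) Y.
  apply: cl_in_star; first by rewrite !inE.
    by move=> x xq; rewrite !inE; apply: contraNneq iq => <-.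
  by apply: cl_in_sub aA; rewrite setCS sub1set !inE eqxx orbT.
have pYi : cl_in (~: [set i]) (c p * Y).
  by apply: cl_inM Yi; apply: cl_in_gen; rewrite !inE.
rewrite /cl_root -scalerAl mulrBl -scalerAr mulrBr !vacZ !vacB.
rewrite (vac_gen Yi) E2 sub0r (mulrA (c p) (c p)) cl_gen2 mul1r E1.
rewrite (mulrA (c p) (c i)) (cl_genC C pi) mulNr vacN -mulrA (vac_gen pYi) oppr0 sub0r.
rewrite exprSr invfM; case: (odd _) => /=; split; ring.
Qed.

Lemma kappa_spin_cyc s (p : 'I_n) : uniq (rcons s p) ->
  kappa C (spin_cyc (rcons s p)) = \prod_(i <- rev s) u i p.
Proof.
rewrite spin_cyc_rcons rcons_uniq => /andP[ps _].
have : p \notin rev s by rewrite mem_rev.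
elim: (rev s) => [|i q IH]; first by rewrite !big_nil kappa1.
rewrite inE negb_or => /andP[pi pq]; rewrite !big_cons kappaM IH //.
by rewrite kappa_tr // eq_sym.
Qed.

(** Disjoint cycles involve disjoint sets of generators, so the trace is multiplicative over
    them. *)
Lemma kappa_cycs (ss : seq (seq 'I_n)) : [::] \notin ss -> uniq (flatten ss) ->
  cl_in [set x in flatten ss] (kappa C (\prod_(s <- ss) spin_cyc s)%g) /\
  beta C (\prod_(s <- ss) spin_cyc s)%g =
    \prod_(s <- ss) (if odd (size s) then rt ^- (size s).-1 else 0).
Proof.
elim: ss => [|s ss IH] /=.
  by rewrite !big_nil kappa1 beta1; split=> //; apply: cl_in1.
rewrite inE negb_or eq_sym cat_uniq => /andP[s0 n0] /and3P[us nss uss].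
have [inY betaY] := IH n0 uss; rewrite !big_cons /beta kappaM.
case/lastP: s s0 us nss => // s p _ us nss; rewrite kappa_spin_cyc //.
set Y := kappa C _ in inY betaY *.
have up : uniq (p :: rev s) by rewrite -rev_rcons rev_uniq.
have mem_s x : (x \in p :: rev s) = (x \in rcons s p) by rewrite -rev_rcons mem_rev.
split.
  apply: cl_in_star; first by rewrite inE mem_cat mem_rcons mem_head.
    by move=> x xs; rewrite inE mem_cat -mem_s inE xs orbT.
  by apply: cl_in_sub inY; apply/subsetP => x; rewrite !inE mem_cat orbC => ->.
have [|-> _] := vac_star up (a := Y).
  apply: cl_in_sub inY; apply/subsetP => x; rewrite !inE => xss.
  rewrite -[~~ _]/(~~ (x \in p :: rev s)) mem_s; apply: contra nss => xs.
  by apply/hasP; exists x.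
rewrite -/(beta C _) betaY size_rev size_rcons /=; congr (_ * _).
by case: (odd _).
Qed.

Lemma beta_spin_type r : is_partition n r ->
  beta C (spin_type n r) = if all odd r then rt ^+ size r / rt ^+ n else 0.
Proof.
case/and3P=> _ r0 /eqP rn; rewrite spin_typeE //.
have rsz : sumn r = size (enum 'I_n) by rewrite size_enum_ord.
set ss := reshape _ _; have fss : flatten ss = enum 'I_n by rewrite reshapeKr // rsz.
have n0 : [::] \notin ss by apply: reshape_nonempty.
have us : uniq (flatten ss) by rewrite fss enum_uniq.
have [_ ->] := kappa_cycs n0 us.
rewrite -(big_map size predT (fun x => if odd x then rt ^- x.-1 else 0)) -[map _ _]/(shape ss).
rewrite reshapeKl ?rsz // -rn.
elim: r r0 {rn rsz ss fss n0 us} => [|x r IH]; first by rewrite big_nil /= expr0 divr1.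
rewrite inE negb_or big_cons => /andP[x0 /IH->] /=; case: (odd x); rewrite /= ?mul0r //.
case: (all _ _); rewrite ?mulr0 //; case: x x0 => // x _ /=.
rewrite exprS -[x.+1]addn1 -addnA exprD add1n exprS.
have rt0 := rt2_neq0 C; have rtx := expf_neq0 x rt0; have rtr := expf_neq0 (sumn r) rt0.
by field; rewrite ?rt0 ?rtx ?rtr.
Qed.

End BetaSpinType.

Section ColourSums.
Variables (R : comNzRingType) (n N : nat) (x : 'I_N -> R).

Lemma find_block (T : eqType) (ss : seq (seq T)) i k : uniq (flatten ss) ->
  (k < size ss)%N -> i \in nth [::] ss k -> find (fun s => i \in s) ss = k.
Proof.
elim: ss k => // s ss IH [|k] /=; first by move=> _ _ ->.
rewrite cat_uniq => /and3P[_ nss uss] kss ik; case: ifP => [is_|_]; last by rewrite (IH k).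
case/hasP: nss; exists i => //; apply/flattenP; exists (nth [::] ss k) => //.
exact: mem_nth.
Qed.

(** An invariant colouring is a free choice of one colour per cycle. This is how the power sums of
    Schur's formula appear. *)
Lemma colour_sum (p : 'S_n) ss : cycle_list p ss ->
  \sum_(phi : {ffun 'I_n -> 'I_N} | [forall i, phi (p i) == phi i]) \prod_i x (phi i)
  = \prod_(s <- ss) \sum_i x i ^+ size s.
Proof.
move=> Hs; have us := cycle_list_uniq Hs; have [_ fss n0] := and3P Hs.
pose m := size ss; pose S (k : 'I_m) := nth [::] ss k.
have mem_S k : S k \in ss by apply: mem_nth.
have blk_lt i : (find (fun s => i \in s) ss < m)%N.
  rewrite /m -has_find; have /flattenP[s s_ss is_] := cycle_list_mem i Hs.
  by apply/hasP; exists s.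
pose blk i := Ordinal (blk_lt i).
have blkP i k : i \in S k -> blk i = k.
  by move=> ik; apply/val_inj/(find_block us) => //=.
have mem_blk i : i \in S (blk i).
  by rewrite /S /=; apply: (nth_find [::] (a := fun s => i \in s)); rewrite has_find.
have rep_ex k : exists i, i \in S k.
  have := mem_S k; case: (S k) => [|i s _]; first by rewrite (negPf n0).
  by exists i; rewrite mem_head.
pose rep k := xchoose (rep_ex k); have mem_rep k : rep k \in S k by apply: xchooseP.
have blk_p i : blk (p i) = blk i.
  apply: blkP; have fs := allP fss _ (mem_S (blk i)).
  by rewrite (eqP (next_cycle fs (mem_blk i))) mem_next.
have inv_blk (phi : {ffun 'I_n -> 'I_N}) i j :
    [forall i, phi (p i) == phi i] -> j \in S (blk i) -> phi i = phi j.
  move=> /forallP inv ij; have fs := allP fss _ (mem_S (blk i)).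
  move: ij; rewrite -(fconnect_cycle fs (mem_blk i)) => /iter_findex <-.
  by elim: (findex _ _ _) => //= k ->; rewrite (eqP (inv _)).
rewrite (big_nth [::]) big_mkord bigA_distr_bigA /=.
rewrite (reindex_onto (fun f : {ffun 'I_m -> 'I_N} => [ffun i => f (blk i)])
   (fun phi : {ffun 'I_n -> 'I_N} => [ffun k => phi (rep k)])) /=; last first.
  by move=> phi inv; apply/ffunP => i; rewrite !ffunE; apply/esym/inv_blk.
apply: eq_big => [f|f _].
  apply/andP; split; first by apply/forallP => i; rewrite !ffunE blk_p.
  by apply/eqP/ffunP => k; rewrite !ffunE; congr (f _); apply: blkP.
rewrite (partition_big blk xpredT) //=; apply: eq_bigr => k _.
rewrite (eq_bigr (fun=> x (f k))) => [|i /eqP <-]; last by rewrite ffunE.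
rewrite prodr_const; congr (_ ^+ _); rewrite -/(S k).
have uSk : uniq (S k).
  move: us (mem_S k); elim: (ss) => //= s tt IH; rewrite cat_uniq inE => /and3P[us' _ /IH H].
  by case/orP=> [/eqP->|/H].
by rewrite -(card_uniqP uSk); apply: eq_card => i; rewrite unfold_in -[eqn _ _]/(blk i == k);
  apply/eqP/idP => [<-|/blkP].
Qed.

End ColourSums.

(** * Schur's formula and the highest colouring *)

Lemma half_pow (C : numClosedFieldType) e : ~~ odd e -> (2 : C) ^+ e./2 = rt2 C ^+ e.
Proof.
move=> ev; rewrite -{2}(odd_double_half e) (negPf ev) add0n -muln2 mulnC exprM.
by rewrite expr2 rt2_sqr.
Qed.

Section SchurTrace.
Variables (C : numClosedFieldType) (n : nat) (W : spin_irr C n).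
Local Notation V := (ga_repr W).
Local Notation b := (young_elt C).
Local Notation rt := (rt2 C).

Lemma spin_char_z g : spin_char W (spin_z n * g)%g = - spin_char W g.
Proof.
by rewrite /spin_char spin_reprM spin_repr_z mul_scalar_mx scaleN1r linearN.
Qed.

Lemma spin_charJ g h : spin_char W (g ^ h)%g = spin_char W g.
Proof.
by rewrite /spin_char conjgE spin_reprM mxtrace_mulC -spin_reprM mulgK.
Qed.

Section FixedVariables.
Variables (N : nat) (x : 'I_N -> C).

Definition weight_sum (g : spin_sym n) : C :=
  \sum_(phi : {ffun 'I_n -> 'I_N} | stab_col phi g) \prod_i x (phi i).
Local Notation G g := (spin_char W g * beta C g * weight_sum g).

Lemma weight_sum_perm g h : spin_perm g = spin_perm h -> weight_sum g = weight_sum h.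
Proof. by move=> gh; apply: eq_bigl => phi; rewrite /stab_col gh. Qed.

Lemma weight_sumJ g h : weight_sum (g ^ h)%g = weight_sum g.
Proof.
rewrite /weight_sum (reindex (fun phi : {ffun 'I_n -> 'I_N} =>
   [ffun i => phi (spin_perm h^-1%g i)])) /=; last first.
  exists (fun phi : {ffun 'I_n -> 'I_N} => [ffun i => phi (spin_perm h i)]) => phi _;
  by apply/ffunP => i; rewrite !ffunE spin_permV ?permK ?permKV.
apply: eq_big => [phi|phi _].
  apply/stab_colP/stab_colP => H i.
    have := H (spin_perm h i); rewrite !ffunE conjgE !spin_permM !permM.
    by rewrite spin_permV !permK.
  by rewrite !ffunE conjgE !spin_permM !permM spin_permV permK H.
rewrite (reindex_inj (perm_inj (s := spin_perm h))) /=; apply: eq_bigr => i _.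
by rewrite ffunE spin_permV permK.
Qed.

(** Both the spin character and [beta] change sign under z, so their product descends to
    permutations. *)
Let Gz g h : spin_perm g = spin_perm h -> G g = G h.
Proof.
move=> gh; rewrite (weight_sum_perm gh).
by have [->|->] := spin_perm_fiber C gh; rewrite ?spin_char_z ?beta_z ?mulrNN.
Qed.

Lemma sum_spin_sym : \sum_g G g = 2 * \sum_(p : 'S_n) G (spin_sect p).
Proof.
rewrite (partition_big (@spin_perm n) xpredT) //= mulr_sumr; apply: eq_bigr => p _.
rewrite (eq_bigr (fun=> G (spin_sect p))) => [|g /eqP gp]; last first.
  by apply: Gz; rewrite spin_sectK.
rewrite sumr_const mulr_natl; congr (_ *+ _).
rewrite (eq_card (B := [set spin_sect p; (spin_z n * spin_sect p)%g])).
  have zs : spin_sect p != (spin_z n * spin_sect p)%g.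
    by rewrite eq_sym -[X in _ != X]mul1g (inj_eq (mulIg _)) (spin_z_neq1 C).
  by rewrite cards2 zs.
move=> g; rewrite unfold_in -[X in X = _]/(spin_perm g == p) in_set2; apply/eqP/orP => [gp|[] /eqP->].
- have E : spin_perm (spin_sect p) = spin_perm g by rewrite spin_sectK gp.
  by have [->|->] := spin_perm_fiber C E; rewrite eqxx; auto.
- exact: spin_sectK.
by rewrite spin_permM spin_perm_z mul1g spin_sectK.
Qed.

Lemma sum_young_trace :
  \sum_(phi : {ffun 'I_n -> 'I_N}) \tr (V (b phi)) * \prod_i x (phi i) = \sum_g G g.
Proof.
under eq_bigr => phi _ do rewrite mxtrace_ga_repr mulr_suml.
rewrite exchange_big; apply: eq_bigr => g _; rewrite /weight_sum mulr_sumr big_mkcond.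
rewrite [RHS]big_mkcond; apply: eq_bigr => phi _ /=; rewrite young_eltE.
by case: ifP => _; rewrite ?mul0r // (mulrC (beta C g)).
Qed.

Lemma weight_sum_type r : is_partition n r -> weight_sum (spin_type n r) = power_sum x r.
Proof.
move=> pr; have [ss Hs Es] := spin_type_cycle_list pr.
rewrite /weight_sum /power_sum -[in RHS]Es big_map -(colour_sum x Hs).
by apply: eq_bigl.
Qed.

(** The factor 2 counts the lifts of a permutation, n!/z_r is the class size, and [beta] at [r]
    supplies rt^(l(r) - n). *)
Lemma sum_young_types :
  \sum_(phi : {ffun 'I_n -> 'I_N}) \tr (V (b phi)) * \prod_i x (phi i) =
  2 * n`!%:R / rt ^+ n * \sum_(r : odd_part n)
    rt ^+ size r / (part_z r)%:R * spin_char W (spin_type n r) * power_sum x r.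
Proof.
rewrite sum_young_trace sum_spin_sym.
rewrite (@sum_by_type _ _ _ (fun r => spin_perm (spin_type n r))).
- rewrite -mulrA -mulrA; congr (_ * _); rewrite mulrA !mulr_sumr; apply: eq_bigr => r _.
  have [pr or] := odd_seqP r.
  rewrite (Gz (h := spin_type n (odd_seq r))) ?spin_sectK // beta_spin_type // or weight_sum_type //.
  by ring.
- move=> p w; rewrite -(weight_sumJ (spin_sect p) (spin_sect w)) -(spin_charJ (spin_sect p) (spin_sect w)).
  rewrite -(betaJ C (spin_sect p) (spin_sect w)); apply: Gz.
  by rewrite !conjgE !spin_permM spin_permV !spin_sectK.
- exact: spin_type_cycle_list.
move=> r pr nor; rewrite (Gz (h := spin_type n r)) ?spin_sectK //.
by rewrite beta_spin_type // (negPf nor) mulr0 mul0r.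
Qed.
End FixedVariables.

(** Schur's expansion and the trace sum depend on rho through the same term 2^(l(rho)/2) z_rho^-1
    chi([rho]) p_rho; everything else is the constant k0. *)
Lemma schur_trace lam : schur_formula lam W -> exists2 k0 : C, k0 != 0 &
  forall N (x : 'I_N -> C), injective x ->
    \sum_(phi : {ffun 'I_n -> 'I_N}) \tr (V (b phi)) * \prod_i x (phi i)
    = k0 * schurQ x lam.
Proof.
move=> HS; have rt0 e : rt ^+ e != 0 by rewrite expf_neq0 // rt2_neq0.
exists (2 * n`!%:R / rt ^+ n / rt ^+ (size lam + part_parity lam)).
  by rewrite !mulf_neq0 ?invr_eq0 // pnatr_eq0 // -lt0n fact_gt0.
move=> N x x_inj; rewrite sum_young_types (HS N x x_inj) -[RHS]mulrA.
congr (_ * _); rewrite mulr_sumr; apply: eq_bigr => r _.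
rewrite half_pow.
  rewrite -addnA [(size (odd_seq r) + _)%N]addnC addnA.
  by move: (size lam + _)%N => e; rewrite exprD !mulrA mulVf ?mul1r.
(* The exponent is even: l(rho) has the parity of n since all parts are odd, and eps has the parity
   of n - l(lambda). *)
have [/and3P[_ r0 /eqP rn] or] := odd_seqP r.
have szl : (size lam <= n)%N.
  by rewrite /strict_seq /parts size_map size_bseq.
have on : odd (size (odd_seq r)) = odd n.
  rewrite -[in RHS]rn; elim: (odd_seq r) or => //= y s IH /andP[oy /IH->].
  by rewrite oddD oy.
by rewrite !oddD /part_parity oddb oddB // on; case: (odd n); case: (odd (size lam)).
Qed.

End SchurTrace.

(** * The leading term of the Q-function *)

Section Vandermonde.
Variables (C : fieldType) (l : nat).
Implicit Types (a : 'I_l -> C).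

Definition vdm a : C := \prod_(i < l) \prod_(j < l | (i < j)%N) (a i - a j).

Lemma vdm_perm a (w : 'S_l) : vdm (fun i => a (w i)) = (-1) ^+ w * vdm a.
Proof.
have vdmE f : vdm f = \det (Vandermonde l (\row_i - f i)).
  rewrite det_Vandermonde; apply: eq_bigr => i _; apply: eq_bigr => j _.
  by rewrite !mxE opprK addrC.
rewrite !vdmE.
have -> : Vandermonde l (\row_i - a (w i)) = col_perm w (Vandermonde l (\row_i - a i)).
  by apply/matrixP => i j; rewrite !mxE.
by rewrite col_permE det_mulmx det_perm odd_permV mulrC.
Qed.

(** With exactly l(lambda) variables the double product is, up to the sign of w, vdm(x^2)/vdm(x)^2,
    and the sum over w becomes the alternant with exponents lambda. *)
Lemma schurQ_full (x : 'I_l -> C) lam : size lam = l -> injective x ->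
  schurQ x lam * vdm x ^+ 2 = 2 ^+ l * vdm (fun i => x i ^+ 2) *
    \sum_(w : 'S_l) (-1) ^+ w * \prod_i x (w i) ^+ nth 0%N lam i.
Proof.
move=> szl x_inj; rewrite /schurQ szl leqnn subnn fact0 divr1 -!mulrA; congr (_ * _).
rewrite mulr_suml mulr_sumr; apply: eq_bigr => w _.
rewrite [X in X * _](eq_bigl xpredT) => [|i]; last by rewrite ltn_ord.
rewrite big_split /= -mulrA [RHS]mulrA [RHS]mulrC; congr (_ * _).
have sgn2 : ((-1) ^+ w * (-1) ^+ w : C) = 1 by rewrite -expr2 sqrr_sign.
have -> : vdm x ^+ 2 = vdm (fun i => x (w i)) ^+ 2 by rewrite vdm_perm exprMn sqrr_sign mul1r.
rewrite [RHS]mulrC -(vdm_perm (fun i => x i ^+ 2)) expr2 /vdm -!big_split /=.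
apply: eq_bigr => i _; rewrite -!big_split /=; apply: eq_bigr => j ij.
have d0 : x (w i) - x (w j) != 0.
  by rewrite subr_eq0 (inj_eq x_inj) (inj_eq perm_inj) -val_eqE /= ltn_eqF.
by field.
Qed.
End Vandermonde.

Section Digits.
Variables (n l : nat).

(* Kronecker substitution: digit_val a reads a in base n + 1, as no colour     *)
(* occurs more than n times.                                                   *)
Definition digit_wt (i : 'I_l) := (n.+1 ^ (l - i.+1))%N.
Definition digit_val (a : 'I_l -> nat) := (\sum_i a i * digit_wt i)%N.

Lemma digit_wt_lt (i j : 'I_l) : (0 < n)%N -> (i < j)%N -> (digit_wt j < digit_wt i)%N.
Proof. by move=> n0 ij; rewrite /digit_wt ltn_exp2l //; have := ltn_ord j; lia. Qed.

Lemma digit_tail (i : 'I_l) : (\sum_(j < l | i < j) n * digit_wt j < digit_wt i)%N.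
Proof.
rewrite /digit_wt; have [m Em] : exists m, (l - i.+1 = m)%N by eexists.
elim: m i Em => [|m IH] i Em.
  rewrite Em expn0 big_pred0 // => j; apply/negbTE; have := ltn_ord j; lia.
have lt_i : (i.+1 < l)%N by lia.
have := IH (Ordinal lt_i); rewrite /= => /(_ ltac:(lia)) IH1.
rewrite (bigD1 (Ordinal lt_i)) //=.
have -> : (l - i.+1 = (l - i.+2).+1)%N by lia.
rewrite expnS mulSn addnC ltn_add2r; apply: leq_ltn_trans IH1.
apply: eq_leq; apply: eq_bigl => j; rewrite -val_eqE /=; lia.
Qed.

Lemma digit_val_lt (a b : 'I_l -> nat) (i : 'I_l) : (forall j, a j <= n)%N ->
  (forall j : 'I_l, (j < i)%N -> a j = b j) -> (a i < b i)%N ->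
  (digit_val a < digit_val b)%N.
Proof.
move=> an ab abi; rewrite /digit_val.
rewrite (bigID (fun j : 'I_l => j < i)%N) [X in (_ < X)%N](bigID (fun j : 'I_l => j < i)%N) /=.
rewrite (eq_bigr (fun j => b j * digit_wt j)%N) => [|j ji]; last by rewrite ab.
rewrite ltn_add2l (bigD1 i) ?ltnn //= [X in (_ < X)%N](bigD1 i) ?ltnn //=.
apply: leq_trans (leq_addr _ _); apply: leq_trans (leq_mul abi (leqnn _)).
rewrite mulSn addnC ltn_add2r; apply: leq_ltn_trans (digit_tail i).
rewrite (eq_bigl (fun j : 'I_l => i < j)%N); first by apply: leq_sum => j _; rewrite leq_mul.
by move=> j; rewrite -val_eqE /=; lia.
Qed.

Lemma first_diff (a b : 'I_l -> nat) : a =1 b \/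
  exists2 i, a i != b i & forall j : 'I_l, (j < i)%N -> a j = b j.
Proof.
have [/existsP[i0 Hi0]|] := boolP [exists i, a i != b i]; last first.
  by rewrite negb_exists => /forallP ab; left=> i; apply/eqP; rewrite -[_ == _]negbK ab.
right; case: (@arg_minnP _ i0 (fun i => a i != b i) (fun i => val i) Hi0) => i Hi min_i; exists i => // j ji.
by apply/eqP; apply: contraLR ji => /min_i; rewrite -leqNgt.
Qed.

Lemma digit_val_inj (a b : 'I_l -> nat) : (forall j, a j <= n)%N -> (forall j, b j <= n)%N ->
  digit_val a = digit_val b -> a =1 b.
Proof.
move=> an bn ab; have [//|[i abi lt_i]] := first_diff a b.
case: (ltngtP (a i) (b i)) abi => // [lt_ab|lt_ba] _.
  by have := digit_val_lt an lt_i lt_ab; rewrite ab ltnn.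
have := digit_val_lt bn (fun j ji => esym (lt_i j ji)) lt_ba.
by rewrite ab ltnn.
Qed.

(** At the first index moved by w the smaller indices are already taken, so the leading changed
    digit decreases. *)
Lemma digit_val_perm (a : 'I_l -> nat) (w : 'S_l) : (forall j, a j <= n)%N ->
  (forall i j : 'I_l, (i < j)%N -> (a j < a i)%N) -> w != 1%g ->
  (digit_val (fun i => a (w i)) < digit_val a)%N.
Proof.
move=> an dec w1; have [E|[i ai lt_i]] := first_diff (fun i => a (w i)) a.
  case/eqP: w1; apply/permP => i; rewrite perm1; apply/val_inj.
  by case: (ltngtP (w i) i) => // /dec; rewrite E ltnn.
apply: (digit_val_lt (i := i)) => //; apply: (dec).
have wfix (j : 'I_l) : (j < i)%N -> w j = j.
  move=> /lt_i E; apply/val_inj; by case: (ltngtP (w j) j) => // /dec; rewrite E ltnn.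
case: (ltngtP (w i) i) => // [wi|/val_inj E]; last by rewrite E eqxx in ai.
by have /perm_inj E := wfix _ wi; rewrite E ltnn in wi.
Qed.

End Digits.

Section PolyTools.
Variable C : numFieldType.
Implicit Types p q : {poly C}.

Lemma poly_nat_eq p q m0 : (forall m, (m0 <= m)%N -> p.[m%:R] = q.[m%:R]) -> p = q.
Proof.
move=> pq; apply/eqP; rewrite -subr_eq0; apply/eqP.
apply: (@roots_geq_poly_eq0 _ _ [seq (m0 + i)%:R | i <- iota 0 (size (p - q))]).
- apply/allP => x /mapP[i _ ->]; rewrite /root hornerD hornerN pq ?subrr //.
  exact: leq_addr.
- rewrite map_inj_uniq ?iota_uniq // => i j /eqP.
  by rewrite eqr_nat eqn_add2l => /eqP.
by rewrite size_map size_iota.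
Qed.

Lemma size_XnsubXn a b : (b < a)%N -> size ('X^a - 'X^b : {poly C}) = a.+1.
Proof. by move=> ba; rewrite size_polyDl ?size_polyXn ?size_polyN ?size_polyXn. Qed.

Lemma monic_XnsubXn a b : (b < a)%N -> ('X^a - 'X^b : {poly C}) \is monic.
Proof.
move=> ba; rewrite monicE lead_coefDl ?lead_coefXn //.
by rewrite size_polyN !size_polyXn.
Qed.

Definition same_monic p q := [/\ p \is monic, q \is monic & size p = size q].

Lemma same_monicM p q p' q' : same_monic p q -> same_monic p' q' ->
  same_monic (p * p') (q * q').
Proof.
case=> mp mq pq [mp' mq' pq']; split; rewrite ?monicMl //.
by rewrite !size_Mmonic ?monic_neq0 // pq pq'.
Qed.

Lemma same_monic_prod I (r : seq I) (P : pred I) (F G : I -> {poly C}) :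
  (forall i, P i -> same_monic (F i) (G i)) ->
  same_monic (\prod_(i <- r | P i) F i) (\prod_(i <- r | P i) G i).
Proof.
move=> FG; elim/big_rec2: _ => [|i x y Pi xy]; first by split; rewrite ?monic1.
by apply: same_monicM => //; apply: FG.
Qed.
End PolyTools.

Section StrictParts.
Variables (n : nat) (lam : strict_part n).
Local Notation L i := (nth 0%N lam i).

Lemma strict_seqP : is_partition n lam /\ uniq lam.
Proof. by apply/andP; apply: (valP lam). Qed.

Lemma strict_dec i j : (i < j)%N -> (j < size lam)%N -> (L j < L i)%N.
Proof.
have [/and3P[sl _ _] ul] := strict_seqP.
have sg : sorted gtn lam by rewrite gtn_sorted_uniq_geq ul.
move=> ij jl; apply: (sorted_ltn_nth _ 0%N sg) => //; last by rewrite inE (ltn_trans ij).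
by move=> x y w xy yw; apply: ltn_trans yw xy.
Qed.

Lemma strict_le i : (L i <= n)%N.
Proof.
have [/and3P[_ _ /eqP ln] _] := strict_seqP.
case: (ltnP i (size lam)) => il; last by rewrite nth_default.
by rewrite -[X in (_ <= X)%N]ln (perm_sumn (perm_to_rem (mem_nth 0%N il))) leq_addr.
Qed.
End StrictParts.

Section HighestColouring.
Variables (C : numClosedFieldType) (n : nat) (W : spin_irr C n) (lam : strict_part n).
Hypotheses (n_gt0 : (0 < n)%N) (schurW : schur_formula lam W).
Local Notation l := (size lam).
Local Notation L i := (nth 0%N lam i).
Local Notation V := (ga_repr W).
Local Notation b := (young_elt C).
Local Notation wt := (@digit_wt n l).

Definition colour_wt (phi : 'I_n -> 'I_l) := (\sum_k wt (phi k))%N.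
Let top := digit_val n (fun i : 'I_l => L i).

(** The substitution x_i = X^(wt i) turns the trace sum into P, the squared Vandermonde into E1, the
    Vandermonde of the squares into E2 and the alternant of lambda into Sp. *)
Let P : {poly C} := \sum_(phi : {ffun 'I_n -> 'I_l}) \tr (V (b phi)) *: 'X^(colour_wt phi).
Let E1 : {poly C} := \prod_(i < l) \prod_(j < l | (i < j)%N) ('X^(wt i) - 'X^(wt j)) ^+ 2.
Let E2 : {poly C} := \prod_(i < l) \prod_(j < l | (i < j)%N) ('X^(wt i * 2) - 'X^(wt j * 2)).
Let Sp : {poly C} := \sum_(w : 'S_l) (-1) ^+ w *: 'X^(digit_val n (fun i => L (w^-1%g i))).

Let same_E : same_monic E1 E2.
Proof.
apply: same_monic_prod => i _; apply: same_monic_prod => j ij.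
have lt1 := digit_wt_lt n_gt0 ij; have lt2 : (wt j * 2 < wt i * 2)%N by rewrite ltn_pmul2r.
split; [exact/monic_exp/monic_XnsubXn | exact: monic_XnsubXn |].
rewrite expr2 size_Mmonic ?monic_neq0 ?monic_XnsubXn // !size_XnsubXn //=; lia.
Qed.

Let monic_S : Sp \is monic /\ size Sp = top.+1.
Proof.
have Srest : (size (Sp - 'X^top)%R <= top)%N.
  rewrite /Sp (bigD1 1%g) //= odd_perm1 scale1r.
  have -> : digit_val n (fun i => L ((1 : 'S_l)^-1%g i)) = top.
    by apply: eq_bigr => i _; rewrite invg1 perm1.
  rewrite addrAC subrr add0r; apply: (leq_trans (size_sum _ _ _)).
  apply/bigmax_leqP => w w1; apply: leq_trans (size_scale_leq _ _) _.
  rewrite size_polyXn; apply: digit_val_perm => [j|i j ij|].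
  - exact: strict_le.
  - exact: strict_dec.
  by rewrite eq_invg1.
have SE : Sp = 'X^top + (Sp - 'X^top) by rewrite addrC subrK.
have lt_s : (size (Sp - 'X^top)%R < size ('X^top : {poly C}))%N by rewrite size_polyXn.
by rewrite monicE SE lead_coefDl // size_polyDl // lead_coefXn eqxx size_polyXn.
Qed.

(** Both sides agree at every natural m >= 2, where the arguments m^(wt i) are pairwise distinct as
    Schur's formula requires. *)
Let leadP : exists2 k, k != 0 & P * E1 = k *: (E2 * Sp).
Proof.
have [k k0 Hk] := schur_trace schurW.
exists (k * 2 ^+ l); first by rewrite mulf_neq0 // expf_neq0 // pnatr_eq0.
apply: (@poly_nat_eq _ _ _ 2) => m m2; pose x (i : 'I_l) : C := m%:R ^+ wt i.
have x_inj : injective x.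
  move=> i j; rewrite /x -!natrX => /eqP; rewrite eqr_nat eqn_exp2l // => /eqP E.
  apply/val_inj; case: (ltngtP i j) => // /(digit_wt_lt n_gt0); by rewrite E ltnn.
have PE : P.[m%:R] = k * schurQ x lam.
  rewrite -Hk // horner_sum; apply: eq_bigr => phi _.
  by rewrite hornerZ hornerXn /x -prodrXr.
have E1E : E1.[m%:R] = vdm x ^+ 2.
  rewrite /vdm /E1 horner_prod -prodrXl; apply: eq_bigr => i _.
  rewrite horner_prod -prodrXl; apply: eq_bigr => j _.
  by rewrite horner_exp hornerD hornerN !hornerXn.
have E2E : E2.[m%:R] = vdm (fun i => x i ^+ 2).
  rewrite /vdm /E2 horner_prod; apply: eq_bigr => i _.
  rewrite horner_prod; apply: eq_bigr => j _.
  by rewrite hornerD hornerN !hornerXn /x -!exprM.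
rewrite hornerZ !hornerM PE E1E E2E -mulrA schurQ_full // -!mulrA; do 3 congr (_ * _).
rewrite horner_sum; apply: eq_bigr => w _; rewrite hornerZ hornerXn; congr (_ * _).
under eq_bigr do rewrite -exprM; rewrite prodrXr; congr (_ ^+ _).
rewrite /digit_val [RHS](reindex_inj (perm_inj (s := w))) /=; apply: eq_bigr => i _.
by rewrite permK mulnC.
Qed.

(** E1 and E2 are monic of equal degree, so P inherits the degree of the monic Sp and has leading
    coefficient k. *)
Let sizeP : size P = top.+1 /\ lead_coef P != 0.
Proof.
have [k k0 E] := leadP; have [mE1 mE2 sE] := same_E; have [mS sS] := monic_S.
have lP : lead_coef P = k.
  rewrite -(lead_coef_Mmonic P mE1) E lead_coefZ lead_coef_Mmonic //.
  by rewrite (monicP mE2) mulr1.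
split; last by rewrite lP.
have P0 : P != 0 by rewrite -lead_coef_eq0 lP.
have := congr1 (fun p : {poly C} => size p) E; rewrite /= size_scale // size_Mmonic // sE.
rewrite size_Mmonic ?monic_neq0 // sS addnS /=.
have : (0 < size E2)%N by rewrite size_poly_gt0 monic_neq0.
have : (0 < size P)%N by rewrite size_poly_gt0.
move: (size P) (size E2) => x y; lia.
Qed.

Let coefP e : P`_e = \sum_(phi : {ffun 'I_n -> 'I_l} | colour_wt phi == e) \tr (V (b phi)).
Proof.
rewrite coef_sum [RHS]big_mkcond; apply: eq_bigr => phi _.
by rewrite coefZ coefXn eq_sym; case: eqP; rewrite ?mulr1 ?mulr0.
Qed.

(** A coefficient of P beyond its degree is a sum of nonnegative traces equal to 0, so each trace
    vanishes and with it the operator. *)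
Lemma young_repr_above (phi : 'I_n -> 'I_l) : (top < colour_wt phi)%N -> V (b phi) = 0.
Proof.
move=> top_phi; have [sP _] := sizeP.
have /eqP : P`_(colour_wt phi) = 0 by rewrite nth_default // sP.
rewrite coefP psumr_eq0 => [/allP/(_ (finfun phi))|psi _]; last exact: young_repr_ge0.
have E : colour_wt (finfun phi) = colour_wt phi.
  by apply: eq_bigr => k _; rewrite ffunE.
have -> : b (finfun phi) = b phi.
  by apply: eq_young_elt => g; apply: eq_forallb => i; rewrite !ffunE.
by rewrite mem_index_enum E eqxx => /(_ isT)/eqP/young_repr_eq0.
Qed.

Lemma colour_wtE (phi : 'I_n -> 'I_l) :
  colour_wt phi = digit_val n (fun i => #|[set k | phi k == i]|).
Proof.
rewrite /colour_wt (partition_big phi xpredT) //=; apply: eq_bigr => i _.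
rewrite (eq_bigr (fun=> wt i)) => [|k /eqP->//]; rewrite sum_nat_const; congr (_ * _)%N.
by apply: eq_card => k; rewrite inE.
Qed.

(** The leading coefficient of P is a nonzero sum of traces, and the digits of its degree determine
    the size of every colour class. *)
Lemma young_repr_content : exists2 phi : 'I_n -> 'I_l, V (b phi) != 0 &
  forall i : 'I_l, #|[set k | phi k == i]| = L i.
Proof.
have [sP lP] := sizeP; move: lP; rewrite lead_coefE sP /= coefP.
have [/existsP[phi /andP[/eqP top_phi phi0]] _|] := boolP
  [exists phi : {ffun 'I_n -> 'I_l}, (colour_wt phi == top) && (V (b phi) != 0)].
  exists phi => //; apply: (@digit_val_inj n l _ (fun i : 'I_l => L i)) => [j|j|].
  - by rewrite -[X in (_ <= X)%N]card_ord max_card.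
  - exact: strict_le.
  by rewrite -colour_wtE top_phi.
rewrite negb_exists => /forallP H; rewrite big1 ?eqxx // => phi top_phi.
by have := H phi; rewrite top_phi /= negbK => /eqP->; rewrite mxtrace0.
Qed.

Lemma recolour_wt (phi : 'I_n -> 'I_l) k (s : 'I_l) : (s < phi k)%N ->
  (colour_wt phi < colour_wt (recolour phi k s))%N.
Proof.
move=> sk; rewrite /colour_wt (bigD1 k) //= [X in (_ < X)%N](bigD1 k) //=.
rewrite {1}/recolour eqxx (eq_bigr (fun j => wt (recolour phi k s j))) => [|j /negPf jk].
  by rewrite ltn_add2r digit_wt_lt.
by rewrite /recolour jk.
Qed.

(** Permuting the points conjugates b_phi, which preserves both nonvanishing and the class sizes. *)
Lemma young_repr_sorted : exists phi : 'I_n -> 'I_l, [/\ V (b phi) != 0,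
  forall i : 'I_l, #|[set k | phi k == i]| = L i &
  forall i j : 'I_n, (i <= j)%N -> (phi i <= phi j)%N].
Proof.
have [phi phi0 phiL] := young_repr_content.
pose t := [tuple phi i | i < n]; pose leo := (fun i j : 'I_l => i <= j)%N.
have /tuple_permP[w Ew] : perm_eq (sort leo t) t by rewrite perm_sort.
pose psi i := phi (w i); have psiE i : psi i = nth (psi i) (sort leo t) i.
  by rewrite Ew nth_mktuple tnth_mktuple.
exists psi; split=> [|i|i j ij].
- pose g := spin_sect w; have gw : spin_perm g = w by apply: spin_sectK.
  have E : b psi = tw_delta _ g * b phi * tw_delta _ g^-1%g.
    apply/twP => h; rewrite ga_mul_delta ga_delta_mul invgK !young_eltE.
    have -> : (g^-1 * (h * g) = h ^ g)%g by rewrite conjgE.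
    rewrite betaJ; congr (if _ then _ else _).
    apply/stab_colP/stab_colP => H i.
      have := H (w^-1%g i); rewrite /psi conjgE !spin_permM spin_permV gw !permM.
      by rewrite permKV.
    have := H (w i); rewrite /psi conjgE !spin_permM spin_permV gw !permM.
    by rewrite permK.
  apply: contraNneq phi0; rewrite E !ga_reprM !ga_repr_delta => /(congr1 (fun M => W g^-1%g *m M *m W g)).
  rewrite mulmx0 mul0mx !mulmxA -spin_reprM mulVg spin_repr1 mul1mx -mulmxA -spin_reprM.
  by rewrite mulVg spin_repr1 mulmx1 => ->.
- rewrite -phiL -(card_imset _ (perm_inj (s := w))); apply: eq_card => k.
  rewrite !inE; apply/imsetP/eqP => [[j]|pk].
    by rewrite inE => /eqP <- ->.
  by exists (w^-1%g k); rewrite ?inE ?/psi permKV ?pk.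
rewrite (psiE i) (psiE j).
have tr : transitive leo by move=> x y u; apply: leq_trans.
have rf : reflexive leo by move=> x; apply: leqnn.
have so : sorted leo (sort leo t) by apply: sort_sorted => x y; apply: leq_total.
rewrite (set_nth_default (psi j)) ?size_sort ?size_tuple //.
by apply: (sorted_leq_nth tr rf _ so); rewrite ?inE ?size_sort ?size_tuple.
Qed.

(** Moving a point to a row of smaller index raises the weight above [top], so the hypotheses of
    [highest_jm] hold for the sorted colouring. *)
Theorem highest_colouring : exists phi : 'I_n -> 'I_l, [/\ V (b phi) != 0,
  forall i : 'I_l, #|[set k | phi k == i]| = L i &
  forall k : 'I_n, V (b phi) *m V (jm_on C [set j : 'I_n | (j < k)%N] k ^+ 2) =
    qfun C #|[set j : 'I_n | (j < k)%N && (phi j == phi k)]| *: V (b phi)].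
Proof.
have [phi [phi0 phiL phi_sorted]] := young_repr_sorted.
exists phi; split=> // k; apply: highest_jm => // j s sj.
apply: young_repr_above; apply: leq_trans (recolour_wt sj); rewrite ltnS.
rewrite colour_wtE /top; apply: eq_leq; apply: eq_bigr => i _.
by rewrite phiL.
Qed.

End HighestColouring.

(** * Restriction to smaller subgroups and the Jucys-Murphy recursion *)

Section Embedding.
Variables (C : numClosedFieldType) (n : nat).
Local Notation wd := (widen_ord (leqnSn n)).
Local Notation mx := (@ord_max n).
Local Notation em := (@spin_embed n).

Lemma widen_inj : injective wd.
Proof. by move=> i j /(congr1 val) /= /val_inj. Qed.

Definition embed_letter (a : letter n) : spin_sym n.+1 :=
  if a is Some k then spin_r n.+1 k.+1 else spin_z n.+1.

Lemma spin_embed_class (w : word n) : em (spin_class w) = (\prod_(a <- w) embed_letter a)%g.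
Proof.
have lt (i : 'I_n.-1) : (i < n.+1.-1)%N by apply: leq_trans (ltn_ord i) (leq_pred n).
apply: spin_lift_class => [|i|i|i j ij|i j ij].
- exact: spin_zz.
- exact: spin_rz.
- exact: spin_rr.
- by rewrite ij spin_rr3 // -ij.
- exact: spin_far.
Qed.

Lemma spin_embed1 : em 1%g = 1%g.
Proof. by rewrite spin_embed_class big_nil. Qed.

Lemma spin_embed_z : em (spin_z n) = spin_z n.+1.
Proof. by rewrite spin_embed_class big_seq1. Qed.

Lemma spin_embed_r (p q : 'I_n) : q = p.+1 :> nat -> em (spin_r n p.+1) = spin_r n.+1 p.+1.
Proof.
by move=> qp; have [k [-> <- _]] := spin_rP qp; rewrite spin_embed_class big_seq1.
Qed.

Lemma spin_embed_tr (p q : 'I_n) : p != q -> em (spin_tr p q) = spin_tr (wd p) (wd q).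
Proof.
move: p q; apply: (spin_tr_ind (P := fun p q g => em g = spin_tr (wd p) (wd q)))
  => [p q pq|p q q' g pq qq' IH|p q g pq IH].
- by rewrite (spin_embed_r pq) /spin_tr /= pq spin_transpS.
- rewrite !spin_embedM spin_embed_z IH (spin_embed_r qq') /spin_tr /= qq'.
  by rewrite [RHS]spin_transp_rec.
by rewrite spin_embedM spin_embed_z IH /spin_tr /= [RHS]spin_transp_swap.
Qed.

Lemma spin_perm_embed g :
  (forall i, spin_perm (em g) (wd i) = wd (spin_perm g i)) /\ spin_perm (em g) mx = mx.
Proof.
rewrite -[g]spin_wordK; elim: (spin_word g) => [|a w [IH IHmx]].
  by rewrite spin_embed1 !spin_perm1 perm1; split=> // i; rewrite !perm1.
rewrite -[a :: w]/([:: a] ++ w) -spin_mulE spin_embedM !spin_permM.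
have [E Emx] : (forall i, spin_perm (em (spin_class [:: a])) (wd i) =
    wd (spin_perm (spin_class [:: a]) i)) /\ spin_perm (em (spin_class [:: a])) mx = mx.
  rewrite spin_embed_class spin_perm_class !big_seq1; case: a => [k|] /=.
    rewrite -[tperm _ _]/(tperm (letter_lo k) (letter_hi k)).
    rewrite (@spin_perm_r n.+1 (wd (letter_lo k)) (wd (letter_hi k))) //.
    split=> [i|]; last by rewrite tpermD // -val_eqE /=; have := ltn_ord k; lia.
    rewrite !permE /= !(inj_eq widen_inj) //.
    by case: ifP => // _; case: ifP.
  by rewrite spin_perm_z; split=> [i|]; rewrite !perm1.
split=> [i|]; first by rewrite !permM E IH.
by rewrite permM Emx IHmx.
Qed.

Lemma spin_embed_inj : injective em.
Proof.
move=> g h E; have gh : spin_perm g = spin_perm h.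
  apply/permP => i; apply: widen_inj.
  by rewrite -!(spin_perm_embed _).1 E.
have [->//|hz] := spin_perm_fiber C gh; move/eqP: E.
rewrite hz spin_embedM spin_embed_z -[X in X == _]mul1g (inj_eq (mulIg _)) eq_sym.
by rewrite (negPf (spin_z_neq1 C _)).
Qed.

Lemma spin_embed_surj (u : spin_sym n.+1) : spin_perm u mx = mx -> exists g, u = em g.
Proof.
move=> umx; have lt_u i : (spin_perm u (wd i) < n)%N.
  rewrite ltn_neqAle -ltnS ltn_ord andbT -[X in _ != X]/(val mx) (inj_eq val_inj).
  rewrite -{1}umx (inj_eq perm_inj) -val_eqE /= neq_ltn ltn_ord //.
pose f i := Ordinal (lt_u i); have f_inj : injective f.
  move=> i j /(congr1 val) /= /val_inj/perm_inj; exact: widen_inj.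
have [E Emx] := spin_perm_embed (spin_sect (perm f_inj)).
have Eu : spin_perm (em (spin_sect (perm f_inj))) = spin_perm u.
  apply/permP => i; case: (ltnP i n) => [lt_i|ge_i].
    have -> : i = wd (Ordinal lt_i) by apply/val_inj.
    by rewrite E spin_sectK permE; apply/val_inj.
  have -> : i = mx by apply/val_inj/eqP; rewrite eqn_leq ge_i -ltnS ltn_ord.
  by rewrite Emx umx.
have [->|->] := spin_perm_fiber C Eu; first by eexists.
by exists (spin_z n * spin_sect (perm f_inj))%g; rewrite spin_embedM spin_embed_z.
Qed.

End Embedding.

Section EvaluateCondExp.
Variables (C : numClosedFieldType) (n : nat) (W : spin_irr C n).
Local Notation em := (@spin_embed n).
Local Notation GA := (grp_alg C (spin_sym n.+1)).
Local Notation dl g := (tw_delta (triv_cocycle C (spin_sym n.+1)) g).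
Local Notation d := (spin_dim W).

(** Conditional expectation followed by W; by [evMl] and [evMr] it respects multiplication by
    elements of the smaller group. *)
Definition ev (x : GA) : 'M[C]_d := \sum_g tw_fun x (em g) *: W g.

Lemma ev_is_linear : linear ev.
Proof.
move=> k x y; rewrite /ev scaler_sumr -big_split; apply: eq_bigr => g _ /=.
by rewrite tw_funD tw_funZ scalerDl scalerA.
Qed.
HB.instance Definition _ := GRing.isLinear.Build C GA 'M[C]_d _ ev ev_is_linear.

Lemma evZ k x : ev (k *: x) = k *: ev x. Proof. exact: linearZ. Qed.
Lemma ev0 : ev 0 = 0. Proof. exact: linear0. Qed.
Lemma ev_sum I (r : seq I) (P : pred I) (F : I -> GA) :
  ev (\sum_(i <- r | P i) F i) = \sum_(i <- r | P i) ev (F i).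
Proof. exact: linear_sum. Qed.

Lemma ev_delta h : ev (dl (em h)) = W h.
Proof.
rewrite /ev (bigD1 h) //= big1 => [|g gh]; rewrite tw_deltaE ?eqxx ?scale1r ?addr0 //.
by rewrite (inj_eq (@spin_embed_inj C n)) (negPf gh) scale0r.
Qed.

Lemma spin_embedV h : em h^-1%g = (em h)^-1%g.
Proof. by apply: (mulgI (em h)); rewrite -spin_embedM !mulgV spin_embed1. Qed.

Lemma ev_mul_delta x h : ev (x * dl (em h)) = ev x *m W h.
Proof.
rewrite /ev mulmx_suml (reindex_inj (mulIg h)) /=; apply: eq_bigr => g _.
by rewrite ga_mul_delta -spin_embedV -spin_embedM mulgK spin_reprM scalemxAl.
Qed.

Lemma ev_delta_mul x h : ev (dl (em h) * x) = W h *m ev x.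
Proof.
rewrite /ev mulmx_sumr (reindex_inj (mulgI h)) /=; apply: eq_bigr => g _.
by rewrite ga_delta_mul -spin_embedV -spin_embedM mulKg spin_reprM scalemxAr.
Qed.

Definition fixes_max (u : spin_sym n.+1) : Prop := spin_perm u ord_max = ord_max.

Lemma evMr x y : tw_supp fixes_max y -> ev (x * y) = ev x *m ev y.
Proof.
move=> yH; rewrite (tw_expand y) mulr_sumr !ev_sum mulmx_sumr.
apply: eq_bigr => u _; have [->|/yH/(spin_embed_surj C)[g ->]] := eqVneq (tw_fun y u) 0.
  by rewrite !scale0r mulr0 ev0 mulmx0.
by rewrite -scalerAr !evZ ev_mul_delta ev_delta -scalemxAr.
Qed.

Lemma evMl x y : tw_supp fixes_max x -> ev (x * y) = ev x *m ev y.
Proof.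
move=> xH; rewrite (tw_expand x) mulr_suml !ev_sum mulmx_suml.
apply: eq_bigr => u _; have [->|/xH/(spin_embed_surj C)[g ->]] := eqVneq (tw_fun x u) 0.
  by rewrite !scale0r mul0r ev0 mul0mx.
by rewrite -scalerAl !evZ ev_delta_mul ev_delta -scalemxAl.
Qed.

Lemma ev_z x : ev (dl (spin_z n.+1) * x) = - ev x.
Proof.
by rewrite -spin_embed_z ev_delta_mul spin_repr_z mul_scalar_mx scaleN1r.
Qed.

Lemma ev1 : ev 1 = 1%:M.
Proof. by rewrite -[1]/(dl 1%g) -(spin_embed1 n) ev_delta spin_repr1. Qed.

End EvaluateCondExp.

(* In terms of generating series in t, the pair (P, T) is determined by        *)
(* P = t (A P + y) and T = t (T A + P A) + P.                                  *)
Fixpoint jm_pair (M : pzRingType) (A : M) (y : nat -> M) k : M * M :=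
  if k is k'.+1 then
    let: (P, T) := jm_pair A y k' in (A * P + y k', T * A + P * A + (A * P + y k'))
  else (0, 0).

(** * The recursion between consecutive Jucys-Murphy sums, in an abstract ring *)

Section StepAlgebra.
Variables (R M : pzRingType) (phi : {additive R -> M}) (a b r Z : R) (A : M).
Hypotheses (ZC : forall x, Z * x = x * Z) (ZZ : Z * Z = 1) (rr : r * r = 1).
Hypotheses (bE : b = Z * r * a * r + r) (ba : b * a = Z * a * b).
Hypotheses (phiZ : forall x, phi (Z * x) = - phi x) (phi_r : phi r = 0).
Hypotheses (phi_a : forall x, phi (x * a) = phi x * A) (phi_al : forall x, phi (a * x) = A * phi x).
Hypothesis (phi_odd : forall k, phi (b ^+ k.*2.+1) = 0).
Local Notation Y k := (phi (b ^+ k.*2)).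
Local Notation P k := (jm_pair (A * A) (fun i => phi (b ^+ i.*2)) k).1.
Local Notation T k := (jm_pair (A * A) (fun i => phi (b ^+ i.*2)) k).2.

Let ar : a * r = Z * r * b - Z.
Proof.
rewrite {1}bE mulrDr -!mulrA rr mulr1 addrK.
by rewrite (mulrA r) -ZC -(mulrA Z r) (mulrA Z Z) ZZ mul1r mulrA rr mul1r.
Qed.

Let rb : r * b = Z * a * r + 1.
Proof. by rewrite -mulrA ar mulrBr ZZ subrK !mulrA ZZ mul1r. Qed.

Let ZXC k x : Z ^+ k * x = x * Z ^+ k.
Proof. by elim: k => [|k IH]; rewrite ?mul1r ?mulr1 // exprS -mulrA IH mulrA ZC mulrA. Qed.

Let abX i j : a ^+ i * b ^+ j = Z ^+ (i * j) * b ^+ j * a ^+ i.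
Proof.
have ab : a * b = Z * b * a by rewrite -mulrA ba !mulrA ZZ mul1r.
have aX k : a * b ^+ k = Z ^+ k * b ^+ k * a.
  elim: k => [|k IH]; first by rewrite !expr0 mulr1 !mul1r.
  rewrite [b ^+ k.+1]exprSr mulrA IH -mulrA ab !mulrA -!(mulrA (Z ^+ k)) -ZC !mulrA.
  by rewrite -exprSr.
elim: i => [|i IH]; first by rewrite mul0n !expr0 !mul1r mulr1.
rewrite exprSr -mulrA aX !mulrA -ZXC -!mulrA (mulrA (a ^+ i)) IH !mulrA -exprD mulSn.
by [].
Qed.

Let phiZX k x : phi (Z ^+ k * x) = (-1) ^+ k * phi x.
Proof.
by elim: k => [|k IH]; rewrite ?mul1r // !exprS -mulrA phiZ IH mulN1r mulNr.
Qed.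

Let phi_aX k x : phi (x * a ^+ k) = phi x * A ^+ k.
Proof. by elim: k => [|k IH]; rewrite ?mulr1 // !exprSr !mulrA phi_a IH. Qed.

Let YA k : A * Y k = Y k * A.
Proof.
rewrite -phi_al -phi_a -[a]expr1 abX mul1n expr1 -mulrA phiZX.
by rewrite -signr_odd odd_double mul1r.
Qed.

Let PA k : A * P k = P k * A.
Proof.
elim: k => [|k] /=; first by rewrite mulr0 mul0r.
case: jm_pair => p t /= IH; rewrite mulrDr mulrDl YA; congr (_ + _).
by rewrite -!mulrA -IH.
Qed.

(** Each b passed by r leaves z a r + 1 ([rb]); vanishing odd moments of b remove the constant at
    every second step. *)
Let U k : phi (r * b ^+ k.*2) = - (A * P k) /\ phi (r * b ^+ k.*2.+1) = P k.+1.
Proof.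
have US j : phi (r * b ^+ j.+1) = - (A * phi (r * b ^+ j)) + phi (b ^+ j).
  by rewrite exprS mulrA rb mulrDl mul1r raddfD -!mulrA phiZ phi_al.
elim: k => [|k [_ IH]].
  have U0 : phi (r * b ^+ 0) = 0 by rewrite mulr1.
  by rewrite US U0 mulr0 oppr0 /= mulr0.
have E : phi (r * b ^+ k.+1.*2) = - (A * P k.+1) by rewrite doubleS US IH phi_odd addr0.
split=> //; rewrite US E mulrN opprK mulrA /=.
by case: (jm_pair _ _ k).
Qed.

(** One a is carried across the right r and becomes b, at the cost of a term containing a single
    r. *)
Let F i j : phi (r * a ^+ i.+1 * r * b ^+ j) =
  - phi (r * a ^+ i * r * b ^+ j.+1) + (-1) ^+ (i * j) * phi (r * b ^+ j) * A ^+ i.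
Proof.
have E : r * a ^+ i.+1 * r * b ^+ j =
    Z * (r * a ^+ i * r * b ^+ j.+1) - Z * (Z ^+ (i * j) * (r * b ^+ j * a ^+ i)).
  transitivity (r * a ^+ i * (a * r) * b ^+ j); first by rewrite exprSr !mulrA.
  rewrite ar mulrBr mulrBl exprS !mulrA -(ZC (r * a ^+ i)) !mulrA; congr (_ - _).
  by rewrite -!mulrA abX -!mulrA (mulrA r (Z ^+ _)) -ZXC -!mulrA.
by rewrite E raddfB !phiZ opprK phiZX phi_aX mulrA.
Qed.

(** Here a, b, r, Z stand for J_p, J_(p+1), [p p+1], z. Iterating [F] turns all 2k factors a into b,
    so that r r = 1 cancels; the terms with a single r are given by [U] and sum to -T k. *)
Lemma jm_step k : phi (r * (a ^+ 2) ^+ k * r) = Y k - T k.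
Proof.
have FS s : (s <= k.*2)%N -> phi (r * a ^+ k.*2 * r) =
    (-1) ^+ s * phi (r * a ^+ (k.*2 - s) * r * b ^+ s) +
    \sum_(t < s) (-1) ^+ t * phi (r * b ^+ t) * A ^+ (k.*2 - t.+1).
  elim: s => [|s IH] sk; first by rewrite big_ord0 addr0 mul1r mulr1 subn0.
  rewrite IH ?(ltnW sk) // big_ord_recr /=.
  have -> : (k.*2 - s = (k.*2 - s.+1).+1)%N by lia.
  rewrite F mulrDr [(-1) ^+ s.+1]exprS mulN1r mulrN mulNr
    -!addrA; congr (_ + _); rewrite addrC; congr (_ + _).
  rewrite !mulrA; congr (_ * _ * _); rewrite -[(-1) ^+ (_ * _)]signr_odd oddM.
  case: (boolP (odd s)) => so; last by rewrite andbF mulr1.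
  by rewrite oddB // odd_double /= so mulr1.
rewrite -exprM mul2n (FS _ (leqnn _)) subnn expr0 mulr1 rr mul1r -signr_odd odd_double mul1r.
congr (_ + _).
elim: {FS}k => [|k IH]; first by rewrite big_ord0 /= oppr0.
rewrite doubleS !big_ord_recr /= !subSS subSnn subnn expr0 mulr1.
rewrite (eq_bigr (fun t : 'I_k.*2 => (-1) ^+ t * phi (r * b ^+ t) * A ^+ (k.*2 - t.+1) * (A * A))).
  have s0 : (-1) ^+ k.*2 = 1 :> M by rewrite -signr_odd odd_double.
  rewrite -mulr_suml IH [(-1) ^+ k.*2.+1]exprS s0 mul1r mulr1 mulN1r; have [-> ->] := U k.
  rewrite mulNr /=; have := PA k.
  case: (jm_pair _ _ k) => p t /= pA; rewrite !opprD mulNr expr1.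
  by rewrite pA -!mulrA addrA.
move=> t _; rewrite -!mulrA; congr (_ * (_ * _)); rewrite -expr2 -exprD; congr (_ ^+ _).
by have := ltn_ord t; lia.
Qed.
End StepAlgebra.

(** * Jucys-Murphy sums and restriction to subgroups fixing the last points *)

Section JucysMurphy.
Variables (C : numClosedFieldType) (n : nat).
Local Notation GA := (grp_alg C (spin_sym n)).
Local Notation dl g := (tw_delta (triv_cocycle C (spin_sym n)) g).
Local Notation z := (spin_z n).
Implicit Types (g h : spin_sym n) (x y : GA).

Definition fixes_from m : pred (spin_sym n) :=
  fun g => [forall i : 'I_n, (m <= i)%N ==> (spin_perm g i == i)].

Lemma fixes_fromP m g :
  reflect (forall i : 'I_n, (m <= i)%N -> spin_perm g i = i) (fixes_from m g).
Proof.
apply: (iffP forallP) => H i; first by move/(implyP (H i))/eqP.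
by apply/implyP => /H->.
Qed.

Lemma fixes_fromM m g h : fixes_from m g -> fixes_from m h -> fixes_from m (g * h)%g.
Proof.
move=> /fixes_fromP Hg /fixes_fromP Hh; apply/fixes_fromP => i mi.
by rewrite spin_permM permM Hg ?Hh.
Qed.

Lemma fixes_fromV m g : fixes_from m g -> fixes_from m g^-1%g.
Proof.
move=> /fixes_fromP Hg; apply/fixes_fromP => i mi.
by rewrite spin_permV -{1}(Hg i mi) permK.
Qed.

Lemma fixes_from1 m : fixes_from m 1%g.
Proof. by apply/fixes_fromP => i _; rewrite spin_perm1 perm1. Qed.

Lemma fixes_from_z m : fixes_from m z.
Proof. by apply/fixes_fromP => i _; rewrite spin_perm_z perm1. Qed.

Lemma fixes_from_tr m (p q : 'I_n) : p != q -> (p < m)%N -> (q < m)%N -> fixes_from m (spin_tr p q).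
Proof.
move=> pq pm qm; apply/fixes_fromP => i mi; rewrite spin_perm_tr // tpermD //.
  by apply: contraTneq mi => <-; rewrite -ltnNge.
by apply: contraTneq mi => <-; rewrite -ltnNge.
Qed.

Lemma fixes_fromMr m g h : fixes_from m h -> fixes_from m (g * h)%g = fixes_from m g.
Proof.
move=> Hh; apply/idP/idP => [Hgh|Hg]; last exact: fixes_fromM.
by rewrite -(mulgK h g); apply/fixes_fromM/fixes_fromV.
Qed.

Lemma fixes_fromMl m g h : fixes_from m h -> fixes_from m (h * g)%g = fixes_from m g.
Proof.
move=> Hh; apply/idP/idP => [Hgh|Hg]; last exact: fixes_fromM.
by rewrite -(mulKg h g); apply/fixes_fromM/Hgh/fixes_fromV.
Qed.

(** Conditional expectation onto the subgroup fixing all points from m on, kept in one group algebra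
    so that different m can be compared. *)
Definition restr m x : GA := tw_make _ (fun g => if fixes_from m g then tw_fun x g else 0).

Lemma restrE m x g : tw_fun (restr m x) g = if fixes_from m g then tw_fun x g else 0.
Proof. exact: tw_makeE. Qed.

Lemma restr_is_linear m : linear (restr m).
Proof.
move=> k x y; apply/twP => g; rewrite tw_funD tw_funZ !restrE tw_funD tw_funZ.
by case: ifP; rewrite ?mulr0 ?addr0.
Qed.
HB.instance Definition _ m := GRing.isLinear.Build C GA GA _ (restr m) (restr_is_linear m).

Lemma restrZ m k x : restr m (k *: x) = k *: restr m x. Proof. exact: linearZ. Qed.
Lemma restr_sum m I (r : seq I) (P : pred I) (F : I -> GA) :
  restr m (\sum_(i <- r | P i) F i) = \sum_(i <- r | P i) restr m (F i).
Proof. exact: linear_sum. Qed.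

Lemma restr_delta m g : restr m (dl g) = if fixes_from m g then dl g else 0.
Proof.
apply/twP => h; rewrite restrE tw_deltaE; have [->|hg] := eqVneq h g.
  by case: ifP; rewrite ?tw_deltaE ?eqxx ?tw_fun0.
by case: ifP; case: ifP; rewrite ?tw_deltaE ?(negPf hg) ?tw_fun0.
Qed.

Lemma restr_mulr m x y : tw_supp (fixes_from m) y -> restr m (x * y) = restr m x * y.
Proof.
move=> ym; rewrite (tw_expand y) !mulr_sumr restr_sum; apply: eq_bigr => g _.
have [->|/ym gm] := eqVneq (tw_fun y g) 0; first by rewrite !scale0r !mulr0 linear0.
rewrite -!scalerAr restrZ; congr (_ *: _); apply/twP => h.
by rewrite ga_mul_delta !restrE ga_mul_delta fixes_fromMr ?fixes_fromV.
Qed.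

Lemma restr_mull m x y : tw_supp (fixes_from m) y -> restr m (y * x) = y * restr m x.
Proof.
move=> ym; rewrite (tw_expand y) !mulr_suml restr_sum; apply: eq_bigr => g _.
have [->|/ym gm] := eqVneq (tw_fun y g) 0; first by rewrite !scale0r !mul0r linear0.
rewrite -!scalerAl restrZ; congr (_ *: _); apply/twP => h.
by rewrite ga_delta_mul !restrE ga_delta_mul fixes_fromMl ?fixes_fromV.
Qed.

Definition jm (p : 'I_n) : GA := jm_on C [set j : 'I_n | (j < p)%N] p.

Let lt_neq (j p : 'I_n) : (j < p)%N -> j != p.
Proof. by move=> jp; apply: contraTneq jp => ->; rewrite ltnn. Qed.

Lemma jm_fixes (p : 'I_n) m : (p < m)%N -> tw_supp (fixes_from m) (jm p).
Proof.
move=> pm; apply: tw_supp_sum => j; rewrite inE => jp; apply: tw_supp_delta.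
by rewrite fixes_from_tr ?lt_neq // (ltn_trans jp).
Qed.

Lemma jm_odd p : tw_supp (fun g => spin_odd g) (jm p).
Proof.
apply: tw_supp_sum => j; rewrite inE => jp; apply: tw_supp_delta.
by rewrite spin_odd_tr ?lt_neq.
Qed.

Lemma jm_delta (p : 'I_n) g : fixes_from p g ->
  jm p * dl g = dl (z ^+ spin_odd g)%g * dl g * jm p.
Proof.
move=> /fixes_fromP gp; rewrite /jm /jm_on mulr_suml mulr_sumr.
have lt_g (j : 'I_n) : (spin_perm g j < p)%N = (j < p)%N.
  case: (ltnP j p) => [jp|pj]; last by rewrite gp // ltnNge pj.
  rewrite ltnNge; apply/negP => pgj.
  by have /perm_inj E := gp _ pgj; move: pgj; rewrite E leqNgt jp.
rewrite [RHS](reindex_inj (perm_inj (s := spin_perm g))) /=.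
apply: eq_big => [j|j]; rewrite !inE ?lt_g // => jp.
rewrite !ga_deltaM; congr tw_delta; have := spin_trJ C g (lt_neq jp).
rewrite (gp p) // conjgE => E; rewrite -[LHS](mulKVg g) E !mulgA.
by rewrite spin_zXC.
Qed.

Lemma tw_delta_zX k : dl (z ^+ k)%g = dl z ^+ k.
Proof. by elim: k => // k IH; rewrite expgS exprS -ga_deltaM IH. Qed.

Lemma tw_delta_zC x : dl z * x = x * dl z.
Proof.
rewrite (tw_expand x) mulr_suml mulr_sumr; apply: eq_bigr => g _.
by rewrite -scalerAl -scalerAr !ga_deltaM spin_zC.
Qed.

Lemma tw_delta_zz : dl z * dl z = 1.
Proof. by rewrite ga_deltaM spin_zz. Qed.

Lemma jm_sqr_delta (p : 'I_n) g : fixes_from p g ->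
  jm p ^+ 2 * dl g = dl g * jm p ^+ 2.
Proof.
move=> gp; have := jm_delta gp; rewrite tw_delta_zX; set J := jm p; set x := dl g.
case: spin_odd => /= Jx; last by rewrite mul1r in Jx; rewrite expr2 -mulrA Jx mulrA Jx mulrA.
rewrite expr1 in Jx; rewrite expr2 -mulrA Jx !mulrA -tw_delta_zC -!mulrA (mulrA J x) Jx.
by rewrite !mulrA tw_delta_zz mul1r.
Qed.

Section Step.
Variables (p q : 'I_n).
Hypothesis qp : q = p.+1 :> nat.
Local Notation a := (jm p).
Local Notation b := (jm q).
Local Notation r := (dl (spin_tr p q)).
Local Notation Z := (dl z).

Let pq : p != q. Proof. by apply: lt_neq; rewrite qp. Qed.

Lemma jm_step_rr : r * r = 1.
Proof. by rewrite ga_deltaM (spin_trK C). Qed.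

(** Conjugation by [p q] turns [j p] into z [j q] for j < p; the summand j = p is r itself. *)
Lemma jm_step_r : b = Z * r * a * r + r.
Proof.
rewrite /jm /jm_on (bigD1 p) /=; last by rewrite inE qp.
rewrite addrC; congr (_ + _); rewrite mulr_sumr mulr_suml.
apply: eq_big => [j|j /andP[]]; rewrite !inE qp ltnS; first by rewrite [RHS]ltn_neqAle andbC.
move=> jp jp'; have lt_jp : (j < p)%N by rewrite ltn_neqAle jp'.
rewrite !ga_deltaM; congr tw_delta.
have := spin_trJ C (spin_tr p q) (lt_neq lt_jp).
rewrite spin_odd_tr // expg1 spin_perm_tr // tpermL tpermD; last 2 first.
- by rewrite eq_sym.
- by rewrite eq_sym; apply: lt_neq; rewrite qp ltnS.
rewrite conjgE (spin_trV C) // -!mulgA => E; rewrite E.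
by rewrite mulgA spin_zz mul1g.
Qed.

Lemma jm_step_ba : b * a = Z * a * b.
Proof.
have -> : a = \sum_(j in [set j : 'I_n | (j < p)%N]) dl (spin_tr j p) by [].
rewrite [in LHS]mulr_sumr [Z * _]mulr_sumr mulr_suml; apply: eq_bigr => j.
rewrite inE => jp.
rewrite jm_delta; last by rewrite fixes_from_tr ?lt_neq // qp ltnS // ltnW.
by rewrite spin_odd_tr ?lt_neq // expg1.
Qed.

(** For an even g fixing all points from q on, the conjugate by [p q] fixes q exactly when g fixes
    p, and then g commutes with [p q]. *)
Lemma restr_conj k : restr q (r * (a ^+ 2) ^+ k * r) = restr p ((a ^+ 2) ^+ k).
Proof.
have H : tw_supp (fun g => fixes_from q g && ~~ spin_odd g) ((a ^+ 2) ^+ k).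
  apply: tw_suppX => [g h /andP[gq ge] /andP[hq he]||].
  - by rewrite fixes_fromM // spin_oddM (negPf ge).
  - by rewrite fixes_from1 spin_odd1.
  have aq : tw_supp (fixes_from q) a by apply: jm_fixes; rewrite qp.
  have a2q : tw_supp (fixes_from q) (a ^+ 2).
    by apply: tw_suppX aq => [g h|]; [apply: fixes_fromM | apply: fixes_from1].
  have a2e : tw_supp (fun g => ~~ spin_odd g) (a ^+ 2).
    by apply: tw_suppM (@jm_odd p) (@jm_odd p) => u v; rewrite spin_oddM => -> ->.
  by move=> g ag; rewrite a2q ?a2e.
rewrite (tw_expand ((a ^+ 2) ^+ k)) mulr_sumr mulr_suml !restr_sum.
apply: eq_bigr => g _; have [->|/H/andP[gq ge]] := eqVneq (tw_fun ((a ^+ 2) ^+ k) g) 0.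
  by rewrite !scale0r mulr0 mul0r !linear0.
rewrite -scalerAr -scalerAl !restrZ !ga_deltaM !restr_delta; congr (_ *: _).
have {2}<- : (spin_tr p q)^-1%g = spin_tr p q by rewrite (spin_trV C).
have E : fixes_from q (spin_tr p q * g * (spin_tr p q)^-1)%g = fixes_from p g.
  have q_g : spin_perm g q = q by apply: (fixes_fromP _ _ gq).
  apply/idP/idP => H1.
    have := fixes_fromP _ _ H1 q (leqnn _).
    rewrite !spin_permM spin_permV !permM spin_perm_tr // tpermR tpermV.
    move/(congr1 (tperm p q)); rewrite tpermK tpermR => gp.
    apply/fixes_fromP => i; rewrite leq_eqVlt => /orP[/eqP/val_inj<- //|].
    by rewrite -qp; apply: (fixes_fromP _ _ gq).
  apply/fixes_fromP => i qi; rewrite !spin_permM spin_permV !permM spin_perm_tr // tpermV.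
  have [->|iq] := eqVneq i q; first by rewrite tpermR (fixes_fromP _ _ H1) // tpermL.
  have pi : p != i by apply: lt_neq; rewrite (leq_trans _ qi) // qp.
  have Ei : tperm p q i = i by rewrite tpermD // eq_sym.
  by rewrite Ei (fixes_fromP _ _ gq) // Ei.
rewrite E; case: ifP => // gp; congr tw_delta; apply: (mulIg (spin_tr p q)).
rewrite -mulgA (spin_trK C) // mulg1; have := spin_trJ C g pq.
rewrite (negPf ge) expg0 mul1g !(fixes_fromP _ _ gp) //; last by rewrite qp.
by rewrite conjgE => E'; rewrite -[LHS](mulKVg g) E'.
Qed.

End Step.

End JucysMurphy.

(* jm_next c s is the solution s' of s' k = s k + (jm_pair c s' k).2, which    *)
(* is a recursion because the last term only involves s' below k.              *)
Fixpoint jm_aux (R : pzRingType) (c : R) (s : nat -> R) k : R * R :=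
  if k is k'.+1 then
    let: (P, T) := jm_aux c s k' in
    (c * P + (s k' + T), T * c + P * c + (c * P + (s k' + T)))
  else (0, 0).

Definition jm_next (R : pzRingType) (c : R) (s : nat -> R) k := s k + (jm_aux c s k).2.

Fixpoint jm_level (R : pzRingType) (c : nat -> R) m : nat -> R :=
  if m is m'.+1 then jm_next (c m') (jm_level c m') else fun k => (k == 0)%:R.

Lemma jm_pair_next (R : pzRingType) (c : R) (s : nat -> R) k :
  jm_pair c (jm_next c s) k = jm_aux c s k.
Proof. by elim: k => //= k ->; rewrite /jm_next; case: jm_aux. Qed.

(** B turns A and the y i into scalars, and so the matrix recursion into the scalar one. Only
    indices below k enter, which permits induction on k later. *)
Lemma jm_pair_act (C : fieldType) d (B A : 'M[C]_d) c (y : nat -> 'M_d) (s : nat -> C) k :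
  B *m A = c *: B -> (forall i, (i < k)%N -> B *m y i = s i *: B) ->
  B *m (jm_pair A y k).1 = (jm_pair c s k).1 *: B /\
  B *m (jm_pair A y k).2 = (jm_pair c s k).2 *: B.
Proof.
move=> BA; elim: k => [|k IH] By /=; first by rewrite mulmx0 scale0r.
case: IH => [i ik|]; first by apply: By; rewrite ltnW.
have := By k (ltnSn k); case: (jm_pair A y k) => P T; case: (jm_pair c s k) => p t /=.
move=> Byk BP BT; have BAP : B *m (A *m P) = (c * p) *: B.
  by rewrite mulmxA BA -scalemxAl BP scalerA.
have BX X x : B *m X = x *: B -> B *m (X *m A) = (x * c) *: B.
  by move=> BX; rewrite mulmxA BX -scalemxAl BA scalerA.
rewrite !mulmxDr; have -> := BX _ _ BT; have -> := BX _ _ BP.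
by rewrite [B *m (A * P)]BAP Byk !scalerDl.
Qed.

Section SpinRecursion.
Variables (C : numClosedFieldType) (n : nat) (W : spin_irr C n).
Local Notation GA := (grp_alg C (spin_sym n.+1)).
Local Notation dl g := (tw_delta (triv_cocycle C (spin_sym n.+1)) g).
Local Notation z := (spin_z n.+1).
Local Notation wd := (widen_ord (leqnSn n)).
Local Notation ev := (ev W).
Local Notation J := (@jm C n.+1).
Local Notation d := (spin_dim W).

Definition jm_moment (p : 'I_n.+1) k : 'M[C]_d := ev (restr p (J p ^+ k)).

Lemma fixes_from_max (q : 'I_n.+1) g : fixes_from q g -> @fixes_max n g.
Proof. by move=> /fixes_fromP; apply; rewrite -ltnS. Qed.

Lemma supp_max (q : 'I_n.+1) (x : GA) : tw_supp (fixes_from q) x -> tw_supp (@fixes_max n) x.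
Proof. by move=> xq g /xq; apply: fixes_from_max. Qed.

(** An odd power has no coefficient at even g. For odd g in the subgroup it satisfies b^m g = z g
    b^m, which makes the coefficients at g and z g equal, while z acts as -1. *)
Lemma jm_moment_odd q k : jm_moment q k.*2.+1 = 0.
Proof.
pose m := k.*2.+1; have bo0 := @jm_odd C _ q; rewrite /jm_moment.
have J_delta := @jm_delta C n.+1; move: (J q) bo0 (J_delta q) => b bo bd.
have b_odd : tw_supp (fun g => spin_odd g) (b ^+ m).
  have b2 : tw_supp (fun g => ~~ spin_odd g) (b * b).
    by apply: (tw_suppM _ bo bo) => u v; rewrite spin_oddM => -> ->.
  have b2k : tw_supp (fun g => ~~ spin_odd g) ((b * b) ^+ k).
    apply: (tw_suppX _ _ b2) => [g h|]; last by rewrite spin_odd1.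
    by rewrite spin_oddM => /negPf-> /negPf->.
  rewrite /m exprS -mul2n exprM; apply: (tw_suppM _ bo b2k) => u v.
  by rewrite spin_oddM => -> /negPf->.
have b_delta g : fixes_from q g -> spin_odd g -> b ^+ m * dl g = dl z * dl g * b ^+ m.
  move=> gq go; have bg : b * dl g = dl z * dl g * b by rewrite bd // go expg1.
  have b2g : b * b * dl g = dl g * (b * b).
    rewrite -mulrA bg !mulrA -tw_delta_zC -!mulrA (mulrA b (dl g)) bg !mulrA.
    by rewrite tw_delta_zz mul1r.
  have b2X : (b * b) ^+ k * dl g = dl g * (b * b) ^+ k by exact: (commr_sym (commrX k (esym b2g : GRing.comm _ _))).
  rewrite /m exprS -mul2n exprM -[b ^+ 2]/(b * b).
  by rewrite -mulrA b2X mulrA bg -!mulrA.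
have Ez : dl z * restr q (b ^+ m) = restr q (b ^+ m).
  apply/twP => g; rewrite ga_delta_mul !restrE fixes_fromMl; last first.
    exact/fixes_fromV/fixes_from_z.
  case: ifP => // gq; have [go|/negP ge] := boolP (spin_odd g); last first.
    have v0 h : ~ spin_odd h -> tw_fun (b ^+ m) h = 0.
      by move=> ho; apply/eqP/negPn/negP => /b_odd.
    by rewrite !v0 // spin_oddM spin_oddV spin_odd_z.
  (* At g g the two sides of b^m g = z g b^m read off the coefficients at g and at z^-1 g. *)
  have := congr1 (fun x : GA => tw_fun x (g * g)%g) (b_delta g gq go).
  rewrite /= ga_mul_delta mulgK ga_deltaM ga_delta_mul => ->; congr tw_fun.
  by rewrite -spin_zC invMg -!mulgA mulKg.
have /eqP := ev_z W (restr q (b ^+ m)); rewrite Ez -addr_eq0.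
move=> e0; apply/eqP; move: e0; set x := ev _ => e0.
have : (2 : C) *: x == 0 by rewrite scaler_nat mulr2n.
by rewrite scaler_eq0 pnatr_eq0.
Qed.

Lemma jm_moment_step (p q : 'I_n.+1) k : q = p.+1 :> nat ->
  jm_moment q k.*2 = jm_moment p k.*2 +
  (jm_pair (ev (J p) *m ev (J p)) (fun k => jm_moment q k.*2) k).2.
Proof.
move=> qp; pose phi : {additive GA -> 'M[C]_d} := (ev \o restr q)%FUN.
have pq : p != q by rewrite -val_eqE /= qp neq_ltn ltnSn.
have ap : tw_supp (fixes_from q) (J p) by apply: jm_fixes; rewrite qp.
have zq : tw_supp (fixes_from q) (dl z) by apply: tw_supp_delta; apply: fixes_from_z.
have phiZ x : phi (dl z * x) = - phi x by rewrite /phi /= restr_mull // ev_z.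
have phir : phi (dl (spin_tr p q)) = 0.
  rewrite /phi /= restr_delta ifN ?ev0 //; apply/negP => /fixes_fromP/(_ q (leqnn _)).
  by rewrite spin_perm_tr // tpermR; apply/eqP.
have phia x : phi (x * J p) = phi x * ev (J p).
  by rewrite /phi /= restr_mulr // evMr //; apply: supp_max ap.
have phial x : phi (J p * x) = ev (J p) * phi x.
  by rewrite /phi /= restr_mull // evMl //; apply: supp_max ap.
have phio i : phi (J q ^+ i.*2.+1) = 0 by apply: jm_moment_odd.
have := jm_step (@tw_delta_zC C n.+1) (@tw_delta_zz C n.+1) (jm_step_rr C qp) (jm_step_r C qp)
  (jm_step_ba C qp) phiZ phir phia phial phio k.
rewrite {1}/phi /= (restr_conj C qp) -exprM mul2n => E.
by rewrite [jm_moment p _]E subrK.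
Qed.

Lemma jm_moment0 (p : 'I_n.+1) k : p = 0%N :> nat -> jm_moment p k = (k == 0)%:R%:M.
Proof.
move=> p0; have J0 : J p = 0 by rewrite /jm /jm_on big1 // => j; rewrite inE p0.
rewrite /jm_moment J0 expr0n; case: eqP => _; last by rewrite linear0 ev0 raddf0.
by rewrite mulr1n restr_delta fixes_from1 ev1.
Qed.

Section Eigenvector.
Variables (B : 'M[C]_d) (c : nat -> C).
Hypothesis BJ : forall p : 'I_n.+1, (p < n)%N -> B *m (ev (J p) *m ev (J p)) = c p *: B.

(** Induction on p, and for fixed p on k, since the k-th moment at p is expressed through the
    moments at p - 1 and the earlier ones at p. *)
Lemma jm_moment_level (p : 'I_n.+1) k :
  B *m jm_moment p k.*2 = jm_level c p k *: B.
Proof.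
have [m] := ubnP p; elim: m p k => // m IH p k pm.
have [p0|p_gt0] := posnP p.
  rewrite jm_moment0 // p0 /= mul_mx_scalar; congr (_%:R *: _); case: k => //.
have lt_p : (p.-1 < n.+1)%N by apply: leq_ltn_trans (leq_pred p) (ltn_ord p).
pose p' := Ordinal lt_p; have pp' : p = p'.+1 :> nat by rewrite /= prednK.
have lt_p'n : (p' < n)%N by rewrite -ltnS -pp'.
have By i : B *m jm_moment p' i.*2 = jm_level c p' i *: B by apply: IH; rewrite -ltnS -pp'.
have E : jm_level c p = jm_next (c p') (jm_level c p') by rewrite pp'.
rewrite E; move: (jm_level _ _) By => s By {E}.
have [j] := ubnP k; elim: j k => // j IHj k kj.
have := jm_pair_act (k := k) (BJ lt_p'n) (y := fun i => jm_moment p i.*2) (s := jm_next (c p') s).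
case=> [i ik|_]; first by apply: IHj; apply: leq_trans ik _.
rewrite (jm_moment_step _ pp') mulmxDr By => ->.
by rewrite jm_pair_next -scalerDl.
Qed.
End Eigenvector.

Lemma ev_jm (k : 'I_n) : ev (J (wd k)) = ga_repr W (jm_on C [set j : 'I_n | (j < k)%N] k).
Proof.
rewrite /jm /jm_on ev_sum (linear_sum (ga_repr W)) /=.
rewrite (eq_bigl (fun j : 'I_n.+1 => (j < k)%N)) => [|j]; last by rewrite inE.
rewrite [RHS](eq_bigl (fun j : 'I_n => (j < k)%N)) => [|j]; last by rewrite inE.
rewrite [LHS]big_mkcond big_ord_recr /= ltnNge ltnW //= addr0 -big_mkcond.
apply: eq_bigr => j jk.
have nejk : j != k by apply: contraTneq jk => ->; rewrite ltnn.
by rewrite -spin_embed_tr // ev_delta ga_repr_delta.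
Qed.

(** Even powers of the last Jucys-Murphy sum commute with the smaller group, so Schur's lemma
    applies. *)
Lemma jm_moment_scalar k : exists c, jm_moment ord_max k.*2 = c%:M.
Proof.
have irrW := group_closure_closed_field (spin_repr_irr W).
apply/is_scalar_mxP/(mx_abs_irr_cent_scalar irrW)/centgmxP => g _.
pose h := spin_embed g; have hmax : fixes_from (@ord_max n) h.
  apply/fixes_fromP => i; rewrite /= => ni.
  have -> : i = ord_max by apply/val_inj/eqP; rewrite eqn_leq /= ni -ltnS ltn_ord.
  exact: (spin_perm_embed _).2.
have bh : GRing.comm (J ord_max ^+ k.*2) (dl h).
  by rewrite -mul2n exprM; apply/commr_sym/commrX/esym/jm_sqr_delta.
rewrite -(ev_delta W g) -evMr; last first.
  by apply: tw_supp_delta; apply: fixes_from_max hmax.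
rewrite -evMl; last by apply: tw_supp_delta; apply: fixes_from_max hmax.
have hs : tw_supp (fixes_from (@ord_max n)) (dl h) by apply: tw_supp_delta.
by rewrite -restr_mulr // -restr_mull // bh.
Qed.

Lemma jm_moment_max k : jm_moment ord_max k = ev (J ord_max ^+ k).
Proof.
apply: eq_bigr => g _; rewrite restrE ifT //; apply/fixes_fromP => i /= ni.
have -> : i = ord_max by apply/val_inj/eqP; rewrite eqn_leq /= ni -ltnS ltn_ord.
exact: (spin_perm_embed _).2.
Qed.

Lemma galg_exp_jm k g : galg_exp (jucys_murphy C n.+1) k g = tw_fun (J ord_max ^+ k) g.
Proof.
elim: k g => [|k IH] g; first by rewrite ffunE tw_deltaE.
rewrite exprS ga_mulE /= ffunE; apply: eq_bigr => h _; rewrite IH; congr (_ * _).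
rewrite /jucys_murphy sum_ffunE /jm /jm_on tw_fun_sum big_add1 /= big_mkord.
rewrite (eq_bigl (fun j : 'I_n.+1 => (j < n)%N)) => [|j]; last by rewrite inE.
rewrite [RHS]big_mkcond big_ord_recr /= ltnn addr0 -big_mkcond /=.
rewrite [RHS](eq_bigl xpredT) => [|j]; last by rewrite /= ltn_ord.
by apply: eq_bigr => j _; rewrite ffunE tw_deltaE.
Qed.

Theorem jm_character (B : 'M[C]_d) (c : nat -> C) k : B != 0 ->
  (forall p : 'I_n, B *m ga_repr W (jm_on C [set j : 'I_n | (j < p)%N] p ^+ 2) = c p *: B) ->
  galg_char W (cond_exp (galg_exp (jucys_murphy C n.+1) (2 * k)%N)) / d%:R = jm_level c n k.
Proof.
move=> B0 BJ; have [e Ee] := jm_moment_scalar k.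
have d0 : d%:R != 0 :> C.
  by rewrite pnatr_eq0 -lt0n; case/mx_irrP: (spin_repr_irr W).
have El : e = jm_level c n k.
  have := @jm_moment_level B c _ ord_max k; rewrite Ee mul_mx_scalar => H.
  apply/eqP; rewrite -subr_eq0; have : (e - jm_level c n k) *: B == 0.
    rewrite scalerBl H ?subrr // => p pn.
    have -> : p = wd (Ordinal pn) by apply: val_inj.
    by rewrite ev_jm /= -ga_reprM -expr2 (BJ (Ordinal pn)).
  by rewrite scaler_eq0 (negPf B0) orbF.
rewrite -El; apply: (canLR (mulfK d0)).
rewrite mulr_natr -mxtrace_scalar -Ee jm_moment_max /ev -mul2n linear_sum /=.
apply: eq_bigr => g _; rewrite linearZ /= ffunE galg_exp_jm.
by [].
Qed.

End SpinRecursion.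

(** * Generating series *)

Section TruncatedSeries.
Variables (C : fieldType) (K : nat).
Implicit Types p q r : {poly C}.

(** Equality modulo X^K: truncated polynomials stand for power series. *)
Definition eqser p q := forall i, (i < K)%N -> p`_i = q`_i.

Lemma eqser_sym p q : eqser p q -> eqser q p. Proof. by move=> pq i iK; rewrite pq. Qed.
Lemma eqser_trans q p r : eqser p q -> eqser q r -> eqser p r.
Proof. by move=> pq qr i iK; rewrite pq ?qr. Qed.

Lemma eqserM r p q : eqser p q -> eqser (r * p) (r * q).
Proof.
move=> pq i iK; rewrite !coefM; apply: eq_bigr => j _; rewrite pq //.
exact: leq_ltn_trans (leq_subr _ _) iK.
Qed.

Lemma eqser_cancel r p q : r`_0 = 1 -> eqser (r * p) (r * q) -> eqser p q.
Proof.
move=> r0 pq i; have [m] := ubnP i; elim: m i => // m IH i im iK.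
have := pq i iK; rewrite !coefM !big_ord_recl /= r0 !mul1r subn0.
rewrite (eq_bigr (fun j : 'I_i => r`_(lift ord0 j) * q`_(i - lift ord0 j))).
  by move/addIr.
move=> j _; rewrite IH // /bump /=; have := ltn_ord j; lia.
Qed.
End TruncatedSeries.

Section LevelSeries.
Variables (C : numClosedFieldType) (K : nat).
Local Notation "p =~ q" := (eqser K p q) (at level 70).
Definition series (s : nat -> C) : {poly C} := \poly_(k < K) s k.

Definition lin (a : C) : {poly C} := 1 - a *: 'X.

Lemma lin0 a : (lin a)`_0 = 1.
Proof. by rewrite coefB coef1 coefZ coefX mulr0 subr0. Qed.

Lemma coef_lin a (p : {poly C}) i : (lin a * p)`_i = p`_i - (if i is j.+1 then a * p`_j else 0).
Proof.
rewrite mulrBl mul1r coefB -scalerAl coefZ coefXM.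
by case: i => [|i] /=; rewrite ?mulr0.
Qed.

(** In generating series [jm_pair] says (1 - A t) P = t S' and (1 - A t) T = (1 + A t) P; substitute
    into S = S' - T. *)
Lemma series_next A (s s' : nat -> C) :
  (forall k, s' k = s k + (jm_pair A s' k).2) ->
  lin A ^+ 2 * series s =~ (lin A ^+ 2 - 'X * (1 + A *: 'X)) * series s'.
Proof.
move=> Es; pose P := series (fun k => (jm_pair A s' k).1).
pose T := series (fun k => (jm_pair A s' k).2).
have EP : lin A * P =~ 'X * series s'.
  move=> [|i] iK; rewrite coef_lin coefXM /= !coef_poly iK ?subr0 //.
  rewrite (ltnW iK) /=; case: (jm_pair A s' i) => p t /=; ring.
have ET : lin A * T =~ (1 + A *: 'X) * P.
  move=> [|i] iK; rewrite coef_lin mulrDl mul1r coefD -scalerAl coefZ coefXM /= !coef_poly iK.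
    by rewrite mulr0 subr0 addr0.
  rewrite (ltnW iK) /=; case: (jm_pair A s' i) => p t /=; ring.
have ES : series s = series s' - T.
  apply/polyP => i; rewrite coefB !coef_poly; case: ifP => _; last by rewrite subr0.
  by rewrite [in RHS]Es addrK.
rewrite ES mulrBr mulrBl => i iK; rewrite 2!coefB; congr (_ - _).
rewrite expr2 -mulrA (eqserM (lin A) ET) // mulrCA (eqserM (1 + A *: 'X) EP) //.
by apply: (congr1 (fun p : {poly C} => p`_i)); ring.
Qed.

Definition qlin (m : nat) := lin (qfun C m).

(** q_(c-1) + q_(c+1) = 2 q_c + 1 and q_(c-1) q_(c+1) = q_c^2 - q_c. Truncated predecessor at c = 0
    is harmless, as q_(-1) = q_0 = 0. *)
Lemma qlin_factor c :
  lin (qfun C c) ^+ 2 - 'X * (1 + qfun C c *: 'X) = qlin c.-1 * qlin c.+1.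
Proof.
rewrite /qlin /lin; have [E1 E2] : qfun C c.-1 + qfun C c.+1 = 2 * qfun C c + 1 /\
    qfun C c.-1 * qfun C c.+1 = qfun C c ^+ 2 - qfun C c.
  have two : 2 != 0 :> C by rewrite pnatr_eq0.
  rewrite /qfun; case: c => [|c] /=; first by split; field.
  by rewrite !natrM -!natr1; split; field.
move: (qfun C c.-1) (qfun C c.+1) (qfun C c) E1 E2 => u0 v0 w0 E1 E2.
have {}E1 := congr1 polyC E1; have {}E2 := congr1 polyC E2.
rewrite -!mul_polyC; rewrite !(polyCD, polyCM, polyC1) in E1; rewrite expr2 !(polyCD, polyCM, polyCN) in E2.
move: (u0%:P) (v0%:P) E1 E2 => u v; move: (w0%:P) => w E1 E2.
transitivity (1 - (u + v) * 'X + u * v * 'X^2); last by ring.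
by rewrite E1 E2; ring.
Qed.

End LevelSeries.

Section ColourSeries.
Variables (C : numClosedFieldType) (K n l : nat) (phi : 'I_n -> 'I_l).
Local Notation "p =~ q" := (eqser K p q) (at level 70).
Local Notation series := (@series C K).
Local Notation Q := (qlin C).

Definition colour_count (m : nat) (i : 'I_l) := #|[set j : 'I_n | (j < m)%N && (phi j == i)]|.

(** The m-th point is the next box of its row, and the number of earlier points of its colour is the
    content of that box. *)
Definition colour_content (m : nat) : C :=
  if insub m is Some k then qfun C (colour_count m (phi k)) else 0.

Lemma colour_count0 i : colour_count 0 i = 0%N.
Proof. by apply: eq_card0 => j; rewrite inE. Qed.

Lemma colour_countS (k : 'I_n) i : colour_count k.+1 i = (colour_count k i + (phi k == i))%N.
Proof.
rewrite /colour_count (cardsD1 k) inE ltnSn addnC /=; congr (_ + _)%N.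
apply: eq_card => j; rewrite !inE ltnS -val_eqE /=.
by case: (ltngtP j k) => //= ->; rewrite ?andbF.
Qed.

(** A box of content c multiplies the series by Q(c)^2/(Q(c-1) Q(c+1)), which replaces Q(c-1)/Q(c)
    by Q(c)/Q(c+1) in the factor of its row. *)
Lemma level_series m : (m <= n)%N ->
  (\prod_i Q (colour_count m i)) * series (jm_level colour_content m) =~
  \prod_i Q (colour_count m i).-1.
Proof.
elim: m => [_|m IH mn].
  rewrite !big1 => [|i _|i _]; rewrite ?colour_count0 /qlin /lin ?/qfun ?mul0r ?scale0r ?subr0 //.
  by move=> i iK; rewrite mul1r coef_poly iK coef1.
pose k := Ordinal mn; pose c := colour_count m (phi k).
have Ec : colour_content m = qfun C c.
  by rewrite /colour_content insubT.
have next j : jm_level colour_content m.+1 j = jm_level colour_content m j +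
    (jm_pair (qfun C c) (jm_level colour_content m.+1) j).2.
  by rewrite /= Ec jm_pair_next.
have := series_next (K := K) next; rewrite qlin_factor -/(Q c).
move: {next} (IH (ltnW mn)) => {}IH. move: (series _) (series _) IH => S' S IH step.
have P1 : \prod_i Q (colour_count m.+1 i) = Q c.+1 * \prod_(i | i != phi k) Q (colour_count m i).
  rewrite (bigD1 (phi k)) //= (colour_countS k) eqxx addn1; congr (_ * _).
  by apply: eq_bigr => i /negPf ik; rewrite (colour_countS k) eq_sym ik addn0.
have P2 : \prod_i Q (colour_count m.+1 i).-1 = Q c * \prod_(i | i != phi k) Q (colour_count m i).-1.
  rewrite (bigD1 (phi k)) //= (colour_countS k) eqxx addn1; congr (_ * _).
  by apply: eq_bigr => i /negPf ik; rewrite (colour_countS k) eq_sym ik addn0.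
rewrite P1 P2; rewrite (bigD1 (phi k)) //= [X in _ =~ X](bigD1 (phi k)) //= -/c in IH.
move: (\prod_(_ | _) _) (\prod_(_ | _) _) IH => R2 R1 IH.
apply: (@eqser_cancel _ _ (Q c.-1)); first exact: lin0.
apply: (@eqser_trans _ _ (R1 * (Q c ^+ 2 * S))).
  have -> : Q c.-1 * (Q c.+1 * R1 * S') = R1 * (Q c.-1 * Q c.+1 * S') by ring.
  exact/eqserM/eqser_sym.
have -> : R1 * (Q c ^+ 2 * S) = Q c * (Q c * R1 * S) by ring.
have -> : Q c.-1 * (Q c * R2) = Q c * (Q c.-1 * R2) by ring.
exact: eqserM.
Qed.

End ColourSeries.

(** * Moments of x(x+1)/2 under the transition measure *)

Section KerovSeries.
Variables (C : numClosedFieldType) (K : nat).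
Local Notation "p =~ q" := (eqser K p q) (at level 70).
Local Notation series := (@series C K).

Lemma poly_seq_eq (f : nat -> C) (p q : {poly C}) : injective f ->
  (forall i, p.[f i] = q.[f i]) -> p = q.
Proof.
move=> f_inj pq; apply/eqP; rewrite -subr_eq0; apply/eqP.
apply: (@roots_geq_poly_eq0 _ _ (mkseq f (size (p - q)))); last by rewrite size_mkseq.
  by apply/allP => x /mapP[i _ ->]; rewrite /root hornerD hornerN pq subrr.
exact: mkseq_uniq.
Qed.

Definition qint (x : int) : C := x%:~R * (x%:~R + 1) / 2.

Lemma horner_lin (a t : C) : (lin a).[t] = 1 - a * t.
Proof. by rewrite hornerD hornerN hornerZ hornerX hornerC. Qed.

Lemma lin_geometric (a : C) : lin a * series (fun k => a ^+ k) =~ 1.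
Proof.
move=> [|i] iK; rewrite coef_lin coef1 !coef_poly iK ?subr0 //.
by rewrite (ltnW iK) exprS subrr.
Qed.

Variables (lam : seq nat) (X Y Z : seq int) (m : int -> C).
(** X0 and Y0 are the contents before cancellation, for which the Cauchy transform is a product over
    the parts; Z collects what cancels. *)
Let X0 : seq int := 0 :: [seq c%:Z | c <- lam] ++ [seq - c.+1%:Z | c <- lam].
Let Y0 : seq int := [seq c%:Z - 1 | c <- lam] ++ [seq - c%:Z | c <- lam].
Hypotheses (permX : perm_eq (X ++ Z) X0) (permY : perm_eq (Y ++ Z) Y0).
Hypothesis trans : forall zeta : C, zeta \notin [seq x%:~R | x <- X] ->
  (\prod_(y <- Y) (zeta - y%:~R)) / (\prod_(x <- X) (zeta - x%:~R))
  = \sum_(x <- X) m x / (zeta - x%:~R).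

Let transE (zeta : C) : (forall x, x \in X0 -> zeta - x%:~R != 0) ->
  \sum_(x <- X) m x / (zeta - x%:~R) = zeta^-1 *
    \prod_(c <- lam) ((zeta - c%:R + 1) * (zeta + c%:R) / ((zeta - c%:R) * (zeta + c%:R + 1))).
Proof.
move=> nz; have subX x : (x \in X) || (x \in Z) -> x \in X0.
  by rewrite -mem_cat (perm_mem permX).
rewrite -trans; last first.
  apply/mapP => -[x xX E]; have := nz x; rewrite subX ?xX // => /(_ isT).
  by rewrite E subrr eqxx.
have Z0 : \prod_(x <- Z) (zeta - x%:~R) != 0.
  by rewrite prodf_seq_neq0; apply/allP => x xZ; apply/implyP => _; rewrite nz ?subX ?xZ ?orbT.
set a := \prod_(y <- Y) _; set b := \prod_(x <- X) _.
have -> : a / b = (a * \prod_(x <- Z) (zeta - x%:~R)) / (b * \prod_(x <- Z) (zeta - x%:~R)).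
  by rewrite -mulf_div divff ?mulr1.
rewrite /a /b -!big_cat (perm_big _ permX) (perm_big _ permY) /=.
rewrite prodf_div [in RHS]big_split [X in _ = _ * (_ / X)]big_split /=.
rewrite big_cons !big_cat /= !big_map subr0 invfM mulrCA; congr (_ * (_ / _)).
  by congr (_ * _); apply: eq_bigr => c _; rewrite ?rmorphB ?rmorphN /= ?opprD ?opprK ?addrA.
by congr (_ * _); apply: eq_bigr => c _; rewrite rmorphN /= opprK -pmulrn -natr1 addrA.
Qed.

(** Large enough for N and -N-1 to avoid X0 whenever N >= N0. *)
Let N0 := (\max_(c <- lam) c + 2)%N.

Let lam_lt c : c \in lam -> (c.+1 < N0)%N.
Proof.
move=> clam; have : (c <= \max_(c <- lam) c)%N by apply: leq_bigmax_seq.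
by rewrite /N0; lia.
Qed.

Let nzX0 N (e : bool) : (N0 <= N)%N ->
  forall x, x \in X0 -> (if e then N%:R else - N.+1%:R : C) - x%:~R != 0.
Proof.
move=> N0N x; have -> : (if e then N%:R else - N.+1%:R : C) = (if e then N%:Z else - N.+1%:Z)%:~R.
  by case: e; rewrite ?rmorphN.
rewrite -rmorphB intr_eq0 subr_eq0 inE mem_cat.
by case/or3P => [/eqP->|/mapP[c /lam_lt lt ->]|/mapP[c /lam_lt lt ->]]; case: e; lia.
Qed.

Let X_X0 x : x \in X -> x \in X0.
Proof. by move=> xX; rewrite -(perm_mem permX) mem_cat xX. Qed.

Let nz_quad N x : (N0 <= N)%N -> x \in X0 ->
  N%:R * (N%:R + 1) - x%:~R * (x%:~R + 1) != 0 :> C.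
Proof.
move=> N0N xX0; have -> : N%:R * (N%:R + 1) - x%:~R * (x%:~R + 1) =
  - (N%:R - x%:~R) * (- N.+1%:R - x%:~R) :> C by rewrite -natr1; ring.
by rewrite mulf_neq0 ?oppr_eq0 ?(nzX0 true N0N xX0) ?(nzX0 false N0N xX0).
Qed.

Let qfun_neq0 N : (N0 <= N)%N -> qfun C N != 0.
Proof.
move=> N0N; rewrite /qfun mulf_neq0 ?invr_eq0 ?pnatr_eq0 // -lt0n muln_gt0 andbT.
by apply: leq_trans N0N; rewrite /N0; lia.
Qed.

Let nz_lin N x : (N0 <= N)%N -> x \in X0 -> 1 - qint x / qfun C N != 0.
Proof.
move=> N0N xX0; have qN0 := qfun_neq0 N0N; have := nz_quad N0N xX0.
apply: contraNneq => E; have {}E : qint x = qfun C N.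
  by apply/(mulIf (invr_neq0 qN0))/esym/eqP; rewrite mulfV // -subr_eq0 E.
have two : 2 != 0 :> C by rewrite pnatr_eq0.
move: E; rewrite /qint /qfun => /(mulIf (invr_neq0 two))->.
by rewrite natrM natr1 subrr.
Qed.

(** Subtract the Cauchy transform at -N-1 from that at N. On the left 1/(N - x) + 1/(N + 1 + x) =
    (2N + 1)/(N(N + 1) - x(x + 1)). On the right the product over [lam] depends only on zeta(zeta +
    1), so 1/N + 1/(N + 1) factors out. *)
Let sum_qint N : (N0 <= N)%N -> \sum_(x <- X) m x / (1 - qint x / qfun C N) =
  \prod_(c <- lam) ((1 - qfun C c.-1 / qfun C N) / (1 - qfun C c / qfun C N)).
Proof.
move=> N0N; have F1 := transE (nzX0 true N0N); have F2 := transE (nzX0 false N0N).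
rewrite /= in F1 F2.
have N_gt0 : (0 < N)%N by apply: leq_trans N0N; rewrite /N0; lia.
have two : 2 != 0 :> C by rewrite pnatr_eq0.
have nN : N%:R != 0 :> C by rewrite pnatr_eq0 -lt0n.
have nN1 : N%:R + 1 != 0 :> C by rewrite natr1 pnatr_eq0.
have n2N1 : 2 * N%:R + 1 != 0 :> C by rewrite -natrM natr1 pnatr_eq0.
have qN : qfun C N = N%:R * (N%:R + 1) / 2 by rewrite /qfun natrM natr1.
have E : \sum_(x <- X) m x / (N%:R - x%:~R) - \sum_(x <- X) m x / (- N.+1%:R - x%:~R) =
  (2 * N%:R + 1) / (N%:R * (N%:R + 1)) * \sum_(x <- X) m x / (1 - qint x / qfun C N).
  rewrite -sumrB mulr_sumr; apply: eq_big_seq => x /X_X0 xX0.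
  have n1 := nzX0 true N0N xX0; have n2 := nzX0 false N0N xX0.
  have n3 := nz_quad N0N xX0; rewrite /= in n1 n2; rewrite qN /qint -natr1 in n2 *.
  by field; rewrite nN1 nN n3 n2 n1.
have PE zeta : qfun C N = zeta * (zeta + 1) / 2 -> (forall x, x \in X0 -> zeta - x%:~R != 0) ->
  \prod_(c <- lam) ((zeta - c%:R + 1) * (zeta + c%:R) / ((zeta - c%:R) * (zeta + c%:R + 1))) =
  \prod_(c <- lam) ((1 - qfun C c.-1 / qfun C N) / (1 - qfun C c / qfun C N)).
  move=> qz nz; apply: eq_big_seq => c clam.
  have m1 : c%:Z \in X0 by rewrite inE mem_cat map_f ?orbT.
  have m2 : - c.+1%:Z \in X0 by rewrite inE mem_cat (map_f (fun c => - c.+1%:Z)) ?orbT.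
  have -> : qfun C c.-1 = (c%:R - 1) * c%:R / 2.
    rewrite /qfun natrM; case: c clam {m1 m2} => [|c] _; first by rewrite !(mulr0, mul0r).
    by rewrite /= -[X in X - 1]natr1 addrK.
  have := nz _ m1; have := nz _ m2.
  rewrite rmorphN /= opprK -!pmulrn -[c.+1%:R]natr1 => k2 k1.
  have k3 : zeta * (zeta + 1) - c%:R * (c%:R + 1) != 0.
    have -> : zeta * (zeta + 1) - c%:R * (c%:R + 1) = (zeta - c%:R) * (zeta + (c%:R + 1)) by ring.
    by rewrite mulf_neq0.
  have : zeta * (zeta + 1) != 0.
    apply: contraNneq (mulf_neq0 nN nN1) => z0.
    by apply/eqP/(mulIf (invr_neq0 two)); rewrite mul0r -qN qz z0 mul0r.
  rewrite mulf_eq0 negb_or => /andP[z0 z1]; rewrite qz {1}/qfun natrM -[c.+1%:R]natr1.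
  by field; rewrite k3 z1 z0 -addrA k2 k1.
rewrite (PE N%:R qN (nzX0 true N0N)) in F1.
have qN' : qfun C N = - N.+1%:R * (- N.+1%:R + 1) / 2 by rewrite qN -natr1; field.
rewrite (PE _ qN' (nzX0 false N0N)) in F2; rewrite F1 F2 in E.
apply: (mulfI (_ : (2 * N%:R + 1) / (N%:R * (N%:R + 1)) != 0)).
  by rewrite mulf_neq0 ?invr_neq0 // mulf_neq0.
rewrite -E -natr1 -mulrBl; congr (_ * _); field.
by rewrite nN nN1.
Qed.

Let A : {poly C} := \sum_(x <- X) m x *: \prod_(y <- rem x X) lin (qint y).

(** A is the numerator of the sum of m x/(1 - qint x t) over the common denominator; [sum_qint]
    gives the identity at the infinitely many points t = 1/q_N. *)
Let A_eq : A * \prod_(c <- lam) qlin C c =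
  (\prod_(c <- lam) qlin C c.-1) * \prod_(x <- X) lin (qint x).
Proof.
have two : 2 != 0 :> C by rewrite pnatr_eq0.
apply: (@poly_seq_eq (fun i => (qfun C (N0 + i))^-1)) => [i j|i].
  move/invr_inj; rewrite /qfun => /(mulIf (invr_neq0 two))/eqP.
  rewrite eqr_nat => /eqP E; case: (ltngtP i j) => // ij; nia.
have N0i : (N0 <= N0 + i)%N by apply: leq_addr.
move: (N0 + i)%N N0i => N N0N; set t := _^-1.
have qint_nat c : c \in lam -> qfun C c = qint c%:Z.
  by move=> _; rewrite /qint /qfun natrM -natr1.
have AE : A.[t] = (\sum_(x <- X) m x / (1 - qint x / qfun C N)) *
    (\prod_(x <- X) lin (qint x)).[t].
  rewrite /A horner_sum mulr_suml; apply: eq_big_seq => x xX.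
  rewrite hornerZ [in RHS](big_rem x) //= hornerM horner_lin.
  by rewrite mulrA -(mulrA (m x)) mulVf ?nz_lin ?X_X0 // mulr1.
rewrite hornerM AE sum_qint // [RHS]hornerM !horner_prod.
rewrite mulrAC; congr (_ * _); rewrite -big_split; apply: eq_big_seq => c clam /=.
rewrite /qlin !horner_lin mulfVK // qint_nat // nz_lin //.
by rewrite inE mem_cat map_f ?orbT.
Qed.

Theorem kerov_series : (\prod_(c <- lam) qlin C c) *
    series (fun k => \sum_(x <- X) qint x ^+ k * m x) =~ \prod_(c <- lam) qlin C c.-1.
Proof.
set Den := \prod_(c <- lam) _; set Num := \prod_(c <- lam) _.
set QX := \prod_(x <- X) lin (qint x).
have QX0 : QX`_0 = 1.
  rewrite /QX; elim: (X) => [|x r IH]; first by rewrite big_nil coef1.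
  by rewrite big_cons coef_lin IH subr0.
have E1 : QX * series (fun k => \sum_(x <- X) qint x ^+ k * m x) =~ A.
  have -> : series (fun k => \sum_(x <- X) qint x ^+ k * m x) =
      \sum_(x <- X) m x *: series (fun k => qint x ^+ k).
    apply/polyP => i; rewrite coef_sum coef_poly; case: ifP => iK.
      by apply: eq_bigr => x _; rewrite coefZ coef_poly iK mulrC.
    by rewrite big1 // => x _; rewrite coefZ coef_poly iK mulr0.
  rewrite mulr_sumr /A big_seq [X in _ =~ X]big_seq => k kK; rewrite !coef_sum.
  apply: eq_bigr => x xX; rewrite /QX (big_rem x) //= -scalerAr !coefZ; congr (_ * _).
  rewrite mulrAC -[in RHS](mulr1 (\prod_(_ <- _) _)) mulrC.
  exact: (eqserM _ (@lin_geometric (qint x))).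
apply: (eqser_cancel QX0); rewrite [QX * (_ * _)]mulrCA => k kK.
by rewrite (eqserM Den E1) // mulrC A_eq -/Num mulrC.
Qed.
End KerovSeries.

(** * The double diagram and the covers of a strict partition *)

Lemma uniq_flatten_key (I T : eqType) (F : I -> seq T) (key : T -> I) (s : seq I) :
  (forall i, uniq (F i)) -> (forall i b, b \in F i -> key b = i) ->
  uniq s -> uniq (flatten [seq F i | i <- s]).
Proof.
move=> uF kF; elim: s => //= i s IH /andP[is_ us]; rewrite cat_uniq uF IH // andbT.
apply/hasPn => b /flatten_mapP[j js /kF kb]; apply: contra is_ => /kF.
by rewrite kb => <-.
Qed.

Section StrictSequence.
Variable lam : seq nat.
Hypotheses (lam_sorted : sorted gtn lam) (lam0 : 0%N \notin lam).
Local Notation l := (size lam).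
Local Notation L i := (nth 0%N lam i).
Local Notation D := (double_diagram lam).

Lemma part_gt0 i : (0 < L i)%N = (i < l)%N.
Proof.
case: (ltnP i l) => il; last by rewrite nth_default.
by rewrite lt0n; apply: contraNneq lam0 => <-; apply: mem_nth.
Qed.

Lemma part_decr i j : (i < j)%N -> (0 < L i)%N -> (L j < L i)%N.
Proof.
move=> ij Li; case: (ltnP j l) => jl; last by rewrite nth_default.
apply: (sorted_ltn_nth _ 0%N lam_sorted) => //; last by rewrite inE (ltn_trans ij).
by move=> x y w xy yw; apply: ltn_trans yw xy.
Qed.

Lemma part_gap s r : (s <= r)%N -> (0 < L r)%N -> (L r + (r - s) <= L s)%N.
Proof.
elim: r => [|r IH] sr Lr; first by move: sr; rewrite leqn0 => /eqP->; rewrite addn0.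
move: sr; rewrite leq_eqVlt => /orP[/eqP->|sr]; first by rewrite subnn addn0.
have Lr' : (0 < L r)%N by rewrite part_gt0 (leq_trans _ (_ : r.+1 < l)%N) -?part_gt0.
have := IH sr Lr'; have := part_decr (ltnSn r) Lr'; lia.
Qed.

(** The i-th diagonal hook has arm L i - 1 and leg L i. *)
Definition in_double i j := if (i <= j)%N then (j - i < L i)%N else (i - j <= L j)%N.

Lemma mem_double b : (b \in D) = in_double b.1 b.2.
Proof.
case: b => i j /=; rewrite /in_double; apply/flatten_mapP/idP => [[r]|].
  rewrite mem_iota size_map => /= rl; rewrite inE mem_cat.
  rewrite (nth_map 0%N) //; have := rl; rewrite -part_gt0 => Lr.
  case/or3P => [/eqP[-> ->]|/mapP[t]|/mapP[t]]; first by rewrite leqnn subnn.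
    rewrite mem_iota => tr [-> ->]; rewrite leq_addr; lia.
  rewrite mem_iota => tr [-> ->]; rewrite ifF; lia.
have mem_row r : (0 < L r)%N -> r \in iota 0 (size (map predn lam)).
  by rewrite mem_iota size_map part_gt0.
case: (leqP i j) => [ij Lij|ji Lij].
  have Li : (0 < L i)%N by lia.
  exists i; first exact: mem_row.
  have := Li; rewrite part_gt0 => il; rewrite inE mem_cat (nth_map 0%N) //.
  case: (ltngtP i j) ij => // [ij _|-> _]; last by rewrite eqxx.
  apply/orP; right; apply/orP; left; apply/mapP; exists (j - i)%N; last by rewrite subnKC // ltnW.
  by rewrite mem_iota; lia.
have Lj : (0 < L j)%N by lia.
exists j; first exact: mem_row.
rewrite inE mem_cat; apply/orP; right; apply/orP; right.
apply/mapP; exists (i - j)%N; last by rewrite subnKC // ltnW.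
by rewrite mem_iota; lia.
Qed.

Lemma double_uniq : uniq D.
Proof.
apply: (uniq_flatten_key (key := fun b => minn b.1 b.2)); last exact: iota_uniq.
  move=> r; rewrite /= cat_uniq mem_cat negb_or -!andbA; apply/and5P; split.
  - by apply/mapP => -[t]; rewrite mem_iota => /andP[t1 _] []; lia.
  - by apply/mapP => -[t]; rewrite mem_iota => /andP[t1 _] []; lia.
  - by rewrite map_inj_uniq ?iota_uniq // => x y [] /addnI.
  - apply/hasPn => b /mapP[t]; rewrite mem_iota => /andP[t1 _] ->.
    by apply/mapP => -[t' _ []]; lia.
  - by rewrite map_inj_uniq ?iota_uniq // => x y [] /addnI.
move=> r b; rewrite inE mem_cat => /or3P[/eqP->|/mapP[t _ ->]|/mapP[t _ ->]] /=; lia.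
Qed.

Lemma double_up i j : in_double i.+1 j -> in_double i j.
Proof.
rewrite /in_double; case: (leqP i.+1 j) => ij; case: (leqP i j) => ij' H; try lia.
  have Li : (0 < L i.+1)%N by lia.
  have := part_gap (leqnSn i) Li; lia.
have E : j = i by lia.
rewrite E in H *; lia.
Qed.

Lemma double_left i j : in_double i j.+1 -> in_double i j.
Proof.
rewrite /in_double; case: (leqP i j.+1) => ij; case: (leqP i j) => ij' H; try lia.
  have E : i = j.+1 by lia.
  rewrite E in H *; have Lj : (0 < L j.+1)%N by lia.
  have := part_gap (leqnSn j) Lj; lia.
have Lj : (0 < L j.+1)%N by lia.
have := part_gap (leqnSn j) Lj; lia.
Qed.

Lemma double_young_cond i j : in_double i j ->
  ((i == 0%N) || in_double i.-1 j) && ((j == 0%N) || in_double i j.-1).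
Proof.
move=> ij; apply/andP; split.
  by case: i ij => //= i; apply: double_up.
by case: j ij => //= j; apply: double_left.
Qed.

Lemma addable_double i j : addable D (i, j) = ~~ in_double i j &&
  (((i == 0%N) || in_double i.-1 j) && ((j == 0%N) || in_double i j.-1)).
Proof.
rewrite /addable mem_double /=; case: (boolP (in_double i j)) => //= ij.
rewrite /is_young /= mem_double ij double_uniq /= !inE !mem_double /=.
have -> : all (fun b : box => ((b.1 == 0%N) || ((b.1.-1, b.2) \in (i, j) :: D)) &&
    ((b.2 == 0%N) || ((b.1, b.2.-1) \in (i, j) :: D))) D.
  apply/allP => -[a b]; rewrite mem_double => /= /double_young_cond.
  rewrite !inE !mem_double /= => /andP[/orP[->|->] /orP[->|->]]; by rewrite ?orbT.
rewrite andbT !xpair_eqE !eqxx andbT /=; congr (_ && _).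
  by case: i {ij} => //= i; rewrite (ltn_eqF (ltnSn i)).
by case: j {ij} => //= j; rewrite (ltn_eqF (ltnSn j)).
Qed.

Lemma removable_double i j : removable D (i, j) =
  [&& in_double i j, ~~ in_double i.+1 j & ~~ in_double i j.+1].
Proof.
rewrite /removable mem_double /=; case: (boolP (in_double i j)) => //= ij.
rewrite /is_young rem_uniq ?double_uniq //=.
have memr x : (x \in rem (i, j) D) = (x != (i, j)) && in_double x.1 x.2.
  by rewrite mem_rem_uniq ?double_uniq // !inE mem_double.
apply/allP/andP => [H|[H1 H2] [a b]].
  split; apply/negP => Hij.
    have := H (i.+1, j); rewrite !memr !xpair_eqE !eqxx /= (gtn_eqF (ltnSn i)) => /(_ Hij).
    by [].
  have := H (i, j.+1); rewrite !memr !xpair_eqE !eqxx /= (gtn_eqF (ltnSn j)) => /(_ Hij).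
  by rewrite andbF.
rewrite !memr /= => /andP[ne Hab]; have := double_young_cond Hab.
case/andP=> c1 c2; apply/andP; split.
  case: a ne Hab c1 {c2} => //= a _ Hab ->; rewrite andbT; apply/eqP => -[ai bj].
  by case/negP: H1; rewrite -ai -bj.
case: b ne Hab c2 {c1} => //= b _ Hab ->; rewrite andbT; apply/eqP => -[ai bj].
by case/negP: H2; rewrite -ai -bj.
Qed.

Lemma double_size i j : in_double i j -> (i < size D)%N && (j < size D)%N.
Proof.
move=> ij; apply/andP; split.
  have sub : {subset [seq (t, j) | t <- iota 0 i.+1] <= D}.
    move=> b /mapP[t]; rewrite mem_iota => /andP[_ ti] ->; rewrite mem_double /=.
    have {ti} ti : (t <= i)%N by lia.
    elim: i ij ti => [|i IH] ij; first by rewrite leqn0 => /eqP->.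
    by rewrite leq_eqVlt => /orP[/eqP->//|]; apply/IH/double_up.
  have := uniq_leq_size _ sub; rewrite size_map size_iota => -> //.
  by rewrite map_inj_uniq ?iota_uniq // => x y [].
have sub : {subset [seq (i, t) | t <- iota 0 j.+1] <= D}.
  move=> b /mapP[t]; rewrite mem_iota => /andP[_ tj] ->; rewrite mem_double /=.
  have {tj} tj : (t <= j)%N by lia.
  elim: j ij tj => [|j IH] ij; first by rewrite leqn0 => /eqP->.
  by rewrite leq_eqVlt => /orP[/eqP->//|]; apply/IH/double_left.
have := uniq_leq_size _ sub; rewrite size_map size_iota => -> //.
by rewrite map_inj_uniq ?iota_uniq // => x y [].
Qed.

Lemma mem_box_range b : (b \in box_range D) = (b.1 <= size D)%N && (b.2 <= size D)%N.
Proof.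
rewrite -!(ltnS _ (size D)); apply/allpairsP/andP => [[p [Ha Hb ->]]|[iD jD]].
  by move: Ha Hb; rewrite !mem_iota !add0n.
exists b; rewrite !mem_iota !add0n; split=> //; exact: surjective_pairing.
Qed.

Lemma box_range_uniq : uniq (box_range D).
Proof. by apply: allpairs_uniq; rewrite ?iota_uniq // => -[a b] [a' b'] _ _ /= [-> ->]. Qed.

(* A new box in row r has content L r; the two corresponding corners of the   *)
(* double diagram have contents L r and - L r - 1.                            *)
Definition growable r := (r == 0%N) || ((L r).+1 < L r.-1)%N.

Definition add_list : seq box :=
  [seq (r, (r + L r)%N) | r <- iota 0 l.+1 & growable r] ++
  [seq ((r + L r).+1, r) | r <- iota 0 l & growable r].

(** The arm end and the leg end of a hook are removable together, except when the last part is 1: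
    its arm end is the diagonal box, which lies above the leg box, so only the latter can go. *)
Definition rem_list : seq box :=
  [seq (r, (r + L r).-1) | r <- iota 0 l & growable r.+1] ++
  [seq ((r + L r)%N, r) | r <- iota 0 l & growable r.+1 || (L r == 1%N)].

Lemma addable_bound i j : addable D (i, j) -> (i <= size D)%N && (j <= size D)%N.
Proof.
rewrite addable_double => /and3P[_ H1 H2]; apply/andP; split.
  by case: i H1 {H2} => //= i /double_size/andP[].
by case: j H2 {H1} => //= j /double_size/andP[].
Qed.

Let Lpos := part_gt0.

Lemma mem_add_listE i j : ((i, j) \in add_list) =
  [&& (i <= l)%N, growable i & j == (i + L i)%N] || [&& (j < l)%N, growable j & i == (j + L j).+1].
Proof.
rewrite mem_cat; congr (_ || _); apply/mapP/and3P => [[r]|[H1 H2 /eqP->]].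
- by rewrite mem_filter mem_iota add0n ltnS => /and3P[gr _ rl] [-> ->].
- by exists i; rewrite ?mem_filter ?H2 ?mem_iota.
- by rewrite mem_filter mem_iota add0n => /and3P[gr _ rl] [-> ->].
by exists j; rewrite ?mem_filter ?H2 ?mem_iota.
Qed.

Lemma mem_rem_listE i j : ((i, j) \in rem_list) =
  [&& (i < l)%N, growable i.+1 & j == (i + L i).-1] ||
  [&& (j < l)%N, growable j.+1 || (L j == 1%N) & i == (j + L j)%N].
Proof.
rewrite mem_cat; congr (_ || _); apply/mapP/and3P => [[r]|[H1 H2 /eqP->]].
- by rewrite mem_filter mem_iota add0n => /and3P[gr _ rl] [-> ->].
- by exists i; rewrite ?mem_filter ?H2 ?mem_iota.
- by rewrite mem_filter mem_iota add0n => /and3P[gr _ rl] [-> ->].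
by exists j; rewrite ?mem_filter ?H2 ?mem_iota.
Qed.

Lemma mem_add_list i j : ((i, j) \in add_list) = addable D (i, j).
Proof.
rewrite addable_double mem_add_listE /growable /in_double.
case: i j => [|i] [|j] /=; rewrite ?subn0 ?add0n ?ltn0 ?leq0n.
- have := Lpos 0; lia.
- have := Lpos 0; have := Lpos j.+1; have := Lpos j; have := @part_decr j j.+1 (ltnSn j).
  lia.
- have := Lpos 0; have := Lpos i; have := Lpos i.+1; have := @part_decr i i.+1 (ltnSn i).
  by case: i => [|i] /=; lia.
have := Lpos i; have := Lpos i.+1; have := @part_decr i i.+1 (ltnSn i).
have := Lpos j; have := Lpos j.+1; have := @part_decr j j.+1 (ltnSn j).
rewrite ltnS; case: (ltngtP i j) => [ij|ij|<-].
- by rewrite leqW ?(ltnW ij) //; lia.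
- by case: (ltngtP i j.+1) ij => [|ij' _|-> _]; lia.
by rewrite leqnSn; lia.
Qed.

Lemma mem_rem_list i j : ((i, j) \in rem_list) = removable D (i, j).
Proof.
rewrite removable_double mem_rem_listE /growable /in_double /=.
have := Lpos i; have := Lpos i.+1; have := @part_decr i i.+1 (ltnSn i).
have := Lpos j; have := Lpos j.+1; have := @part_decr j j.+1 (ltnSn j).
case: (ltngtP i j) => [ij|ij|<-].
- by rewrite leqW ?(ltnW ij) //; lia.
- by case: (ltngtP i j.+1) ij => [|ij' _|-> _]; lia.
by rewrite leqnSn; lia.
Qed.

End StrictSequence.

Section KerovCoordinates.
Variable lam : seq nat.
Hypotheses (lam_sorted : sorted gtn lam) (lam0 : 0%N \notin lam).
Local Notation l := (size lam).
Local Notation L i := (nth 0%N lam i).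
Local Notation D := (double_diagram lam).
Local Notation G := (growable lam).

Lemma perm_refl_of (T : eqType) (s t : seq T) : s = t -> perm_eq s t.
Proof. by move=> ->. Qed.

Lemma kerov_filter (P : pred box) (s : seq box) : uniq s ->
  (forall i j, ((i, j) \in s) = P (i, j)) ->
  (forall i j, P (i, j) -> (i <= size D)%N && (j <= size D)%N) ->
  perm_eq [seq content b | b <- box_range D & P b] [seq content b | b <- s].
Proof.
move=> us sP PD; apply/perm_map/uniq_perm => // [|[i j]].
  exact/filter_uniq/box_range_uniq.
rewrite mem_filter mem_box_range sP andb_idr //; exact: PD.
Qed.

Lemma kerov_xE : perm_eq (kerov_x D)
  ([seq (L r)%:Z | r <- iota 0 l.+1 & G r] ++ [seq - (L r).+1%:Z | r <- iota 0 l & G r]).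
Proof.
apply: (perm_trans (kerov_filter (s := add_list lam) _ _ _)).
- rewrite cat_uniq !map_inj_uniq ?filter_uniq ?iota_uniq // => [|x y []|x y []] //.
  rewrite andbT; apply/hasPn => b /mapP[r _ ->]; apply/mapP => -[r' _ []]; lia.
- exact: mem_add_list.
- exact: addable_bound.
rewrite map_cat -!map_comp; apply: perm_refl_of; congr (_ ++ _); apply: eq_map => r /=.
  by rewrite /content /=; lia.
by rewrite /content /=; lia.
Qed.

Lemma kerov_yE : perm_eq (kerov_y D)
  ([seq (L r)%:Z - 1 | r <- iota 0 l & G r.+1] ++
   [seq - (L r)%:Z | r <- iota 0 l & G r.+1 || (L r == 1%N)]).
Proof.
have Lpos r : r \in iota 0 l -> (0 < L r)%N by rewrite mem_iota (part_gt0 lam0).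
apply: (perm_trans (kerov_filter (s := rem_list lam) _ _ _)).
- rewrite cat_uniq !map_inj_uniq ?filter_uniq ?iota_uniq // => [|x y []|x y []] //.
  rewrite andbT; apply/hasPn => b /mapP[r]; rewrite mem_filter => /andP[_ /Lpos Lr] ->.
  by apply/mapP => -[r']; rewrite mem_filter => /andP[_ /Lpos Lr'] []; lia.
- exact: mem_rem_list.
- move=> i j; rewrite (removable_double lam_sorted lam0) => /andP[/(double_size lam_sorted lam0)].
  by case/andP => /ltnW-> /ltnW->.
rewrite map_cat -!map_comp; apply: perm_refl_of; congr (_ ++ _); apply/eq_in_map => r /=;
  rewrite mem_filter => /andP[_ /Lpos Lr]; rewrite /content /=; lia.
Qed.

(* The contents at which a corner of one row cancels against a corner of the  *)
(* next row.                                                                  *)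
Definition kerov_common : seq int :=
  [seq (L r)%:Z | r <- iota 0 l.+1 & ~~ G r] ++ [seq - (L r).+1%:Z | r <- iota 0 l & ~~ G r].

Let map_filterC (T : eqType) (f : nat -> T) (a : pred nat) s :
  perm_eq ([seq f r | r <- s & a r] ++ [seq f r | r <- s & ~~ a r]) (map f s).
Proof. by rewrite -map_cat; apply/perm_map; rewrite perm_filterC. Qed.

Let map_lam (T : Type) (f : nat -> T) : map f lam = [seq f (L r) | r <- iota 0 l].
Proof. by rewrite -[in LHS](mkseq_nth 0%N lam) -map_comp. Qed.

Lemma kerov_x_common : perm_eq (kerov_x D ++ kerov_common)
  (0 :: [seq c%:Z | c <- lam] ++ [seq - c.+1%:Z | c <- lam]).
Proof.
apply: perm_trans (perm_cat kerov_xE (perm_refl _)) _.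
rewrite perm_catACA -cat_cons; apply: perm_cat.
  apply: (perm_trans (map_filterC _ _ _)); rewrite -addn1 iotaD map_cat /= add0n nth_default //.
  by rewrite map_lam cats1 perm_rcons.
by rewrite map_lam; apply: map_filterC.
Qed.

(** If row r + 1 cannot grow then L r = L (r + 1) + 1, so the missing removable contents of row r
    equal the missing addable ones of row r + 1. *)
Lemma kerov_y_common : perm_eq (kerov_y D ++ kerov_common)
  ([seq c%:Z - 1 | c <- lam] ++ [seq - c%:Z | c <- lam]).
Proof.
apply: perm_trans (perm_cat kerov_yE (perm_refl _)) _.
have Lpos := part_gt0 lam0; have dec := part_decr lam_sorted.
have gap r : (r < l)%N -> ~~ G r.+1 -> L r = (L r.+1).+1.
  move=> rl; rewrite /growable /= => gr; have := Lpos r; have := dec r r.+1 (ltnSn r); lia.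
rewrite perm_catACA !map_lam; apply: perm_cat.
  rewrite [iota 0 l.+1]/= -[1%N]addn0 iotaDl /= filter_map -map_comp.
  rewrite [X in _ ++ X](_ : _ = [seq (L r)%:Z - 1 | r <- iota 0 l & ~~ G r.+1]); first exact: map_filterC.
  apply/eq_in_map => r; rewrite mem_filter mem_iota => /andP[gr /andP[_ rl]] /=.
  have E := gap r rl gr; rewrite E -?[(1 + r)%N]/r.+1; lia.
rewrite [X in _ ++ X](_ : _ = [seq - (L r)%:Z | r <- iota 0 l & ~~ (G r.+1 || (L r == 1%N))]).
  exact: map_filterC.
(* The two index ranges differ by a shift of one row: row 0 can always grow, and the leg end of the
   last row is always removable. *)
case El: l => [//|l'].
have E1 : iota 0 l'.+1 = 0%N :: [seq r.+1 | r <- iota 0 l'] by rewrite /= (iotaDl 1 0).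
have E2 : iota 0 l'.+1 = iota 0 l' ++ [:: l'] by rewrite -addn1 iotaD.
rewrite [in LHS]E1 [in RHS]E2 filter_cat map_cat /= filter_map -map_comp.
have Ll := Lpos l'; have Ll1 : L l'.+1 = 0%N by rewrite nth_default ?El.
rewrite /growable /= Ll1 ifF ?cats0; last by move: Ll; rewrite El ltnSn; lia.
have E : {in iota 0 l', forall r, ~~ (growable lam r.+1 || (L r == 1%N)) = ~~ growable lam r.+1}.
  move=> r; rewrite mem_iota /growable /= => rl; have := dec r r.+1 (ltnSn r).
  by have := Lpos r; have := Lpos r.+1; rewrite El; lia.
rewrite -/(growable lam _) (eq_in_filter E).
apply/eq_in_map => r; rewrite mem_filter mem_iota => /andP[gr rl] /=.
by rewrite (gap r) // El; lia.
Qed.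

End KerovCoordinates.

(** * Covers as rows that can grow *)

Lemma mem_shifted (s : seq nat) i j :
  ((i, j) \in shifted_diagram s) = (i <= j)%N && (j - i < nth 0%N s i)%N.
Proof.
apply/allpairsPdep/andP => [[a [t [_]]]|[ij lt_ij]].
  by rewrite mem_iota => lt_t [-> ->]; rewrite leq_addr addKn.
have is_ : (i < size s)%N by rewrite ltnNge; apply: contraL lt_ij => /(nth_default 0%N)->.
by exists i, (j - i)%N; rewrite !mem_iota /= subnKC.
Qed.

Lemma shifted_uniq (s : seq nat) : uniq (shifted_diagram s).
Proof.
apply: allpairs_uniq_dep => [|i _|[i t] [i' t'] _ _ /= [-> /addnI->]] //; exact: iota_uniq.
Qed.

Lemma mem_added lam mu i j : ((i, j) \in added_boxes lam mu) =
  (i <= j)%N && (nth 0%N lam i <= j - i < nth 0%N mu i)%N.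
Proof.
by rewrite mem_filter !mem_shifted; case: (i <= j)%N => //=; rewrite -leqNgt.
Qed.

Lemma added_uniq lam mu : uniq (added_boxes lam mu).
Proof. exact/filter_uniq/shifted_uniq. Qed.

Section Covers.
Variables (n : nat) (lam : strict_part n).
Local Notation l := (size lam).
Local Notation L i := (nth 0%N lam i).
Local Notation inc r := (set_nth 0%N lam r (L r).+1).

Lemma strict_sorted m (mu : strict_part m) : sorted gtn mu /\ 0%N \notin strict_seq mu.
Proof.
have [/and3P[sl l0 _] ul] := strict_seqP mu.
by rewrite gtn_sorted_uniq_geq ul.
Qed.

Lemma nth_inc r i : nth 0%N (inc r) i = (L i + (i == r))%N.
Proof. by rewrite nth_set_nth /=; case: eqP => [->|_]; rewrite ?addn1 ?addn0. Qed.

Lemma inc_added r (mu : strict_part n.+1) : mu = inc r :> seq nat ->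
  added_boxes lam mu = [:: (r, (r + L r)%N)].
Proof.
move=> Emu; apply/perm_small_eq => //; apply: uniq_perm; rewrite ?added_uniq // => -[i j].
rewrite mem_added Emu nth_inc inE xpair_eqE; case: (eqVneq i r) => [->|_] /=; last by lia.
lia.
Qed.

Lemma inc_covers r (mu : strict_part n.+1) : mu = inc r :> seq nat ->
  covers lam mu /\ skew_content lam mu = (L r)%:Z.
Proof.
move=> Emu; have Ea := inc_added Emu; split.
  rewrite /covers Ea eqxx andbT; apply/allP => -[i j]; rewrite mem_shifted.
  rewrite -[_ \in _]/((i, j) \in shifted_diagram mu) mem_shifted Emu nth_inc; lia.
by rewrite /skew_content Ea /content /=; lia.
Qed.

(** The single added box forces all rows but one to agree; strictness of mu against the row above
    says that this row could grow. *)
Lemma covers_inc (mu : strict_part n.+1) : covers lam mu ->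
  exists r : 'I_l.+1, growable lam r && (strict_seq mu == inc r).
Proof.
case/andP => /allP sub /eqP size1.
have [slam lam0] := strict_sorted lam; have [smu mu0] := strict_sorted mu.
have subL i : (L i <= nth 0%N mu i)%N.
  case: (posnP (L i)) => [->//|Li].
  have : (i, (i + (L i).-1)%N) \in shifted_diagram lam by rewrite mem_shifted; lia.
  by move/sub; rewrite -[_ \in _]/((i, (i + (L i).-1)%N) \in shifted_diagram mu) mem_shifted; lia.
have [b Eb] : exists b, added_boxes lam mu = [:: b].
  by case: (added_boxes _ _) size1 => [|b [|]] // _; exists b.
case: b Eb => r j Eb; have memb i k : (i <= k)%N && (L i <= k - i < nth 0%N mu i)%N -> i = r /\ k = j.
  by rewrite -mem_added Eb inE => /eqP[-> ->].
have : (r, j) \in added_boxes lam mu by rewrite Eb mem_head.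
rewrite mem_added => /andP[rj /andP[Lrj jM]].
have M i : nth 0%N mu i = (L i + (i == r))%N.
  have := subL i; rewrite leq_eqVlt => /orP[/eqP E|lt_i].
    by case: eqP => [Ei|_]; [rewrite -Ei -E in Lrj jM *; lia | rewrite addn0].
  have [Ei Ej] := memb i (i + L i)%N ltac:(lia); rewrite Ei eqxx.
  rewrite Ei in lt_i Ej; case: (ltnP (L r).+1 (nth 0%N mu r)) => lt2; last by lia.
  by have [_] := memb r (r + (L r).+1)%N ltac:(lia); lia.
have size_mu i : (i < size mu)%N = (i == r) || (i < l)%N.
  by rewrite -(part_gt0 mu0) -(part_gt0 lam0) M; case: eqP; lia.
have rl : (r <= l)%N.
  by have := size_mu l; have := size_mu r; rewrite eqxx ltnn orbF; case: eqP; lia.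
exists (Ordinal (rl : (r < l.+1)%N)); apply/andP; split.
  rewrite /growable /=; case: r rl M {Eb memb rj Lrj jM size_mu} => //= r rl M.
  have := part_decr smu (ltnSn r); rewrite !M eqxx (ltn_eqF (ltnSn r)) /= addn0 addn1.
  by apply; rewrite (part_gt0 lam0).
apply/eqP/(@eq_from_nth _ 0%N) => [|i _]; last by rewrite nth_inc M.
rewrite size_set_nth /=; have := size_mu (maxn r.+1 l); have := size_mu (maxn r.+1 l).-1; lia.
Qed.

Lemma inc_ex (r : 'I_l.+1) : growable lam r -> exists mu : strict_part n.+1, strict_seq mu = inc r.
Proof.
move=> gr; have [slam lam0] := strict_sorted lam; have [/and3P[_ _ /eqP ln] _] := strict_seqP lam.
have rl : (r <= l)%N by rewrite -ltnS.
have size_inc : size (inc r) = maxn r.+1 l by rewrite size_set_nth.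
have sinc : sorted gtn (inc r).
  apply/(sortedP 0%N) => i; rewrite size_inc !nth_inc => lt_i /=.
  have Li := part_gt0 lam0 i; have := part_decr slam (ltnSn i).
  have Li1 := part_gt0 lam0 i.+1; have [Er|_] := eqVneq i r; first by rewrite -Er; lia.
  have [Er|_] := eqVneq i.+1 r; last by lia.
  by move: gr; rewrite /growable -Er /=; lia.
have inc0 : 0%N \notin inc r.
  apply/(nthP 0%N) => -[i]; rewrite size_inc nth_inc => lt_i.
  by have Li := part_gt0 lam0 i; case: eqP; lia.
have pinc : is_partition n.+1 (inc r) && uniq (inc r).
  move: sinc; rewrite gtn_sorted_uniq_geq /is_partition => /andP[-> ->]; rewrite inc0 andbT /=.
  by rewrite sumn_set_nth0 ln; lia.
have [pinc' _] := andP pinc; have [p Ep] := part_ex pinc'.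
have Hp : is_partition n.+1 (parts p) && uniq (parts p) by rewrite Ep.
by exists (exist _ p Hp).
Qed.

Lemma covers_sum (R : nmodType) (F : int -> R) :
  \sum_(mu : strict_part n.+1 | covers lam mu) F (skew_content lam mu) =
  \sum_(r <- iota 0 l.+1 | growable lam r) F (L r)%:Z.
Proof.
rewrite -[iota 0 l.+1]/(index_iota 0 l.+1) big_mkord.
pose rel (mu : strict_part n.+1) (r : 'I_l.+1) := growable lam r && (strict_seq mu == inc r).
transitivity (\sum_(mu : strict_part n.+1 | covers lam mu) \sum_(r | rel mu r) F (L r)%:Z).
  apply: eq_bigr => mu /covers_inc[r rmu]; rewrite (bigD1 r) //= big1 => [|s /andP[smu sr]].
    by case/andP: rmu => _ /eqP/inc_covers[_ ->]; rewrite addr0.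
  case/andP: rmu => _ /eqP Er; case/andP: smu => _ /eqP Es; case/eqP: sr; apply: val_inj.
  have := nth_inc r s; rewrite -Er Es nth_inc eqxx => /addnI; by case: eqP.
rewrite (exchange_big_dep (fun r : 'I_l.+1 => growable lam r)) /= => [|mu r _ /andP[]]; last by [].

apply: eq_bigr => r gr; have [mu Emu] := inc_ex gr; have [cmu _] := inc_covers Emu.
rewrite (bigD1 mu) /= ?cmu ?/rel ?gr ?Emu ?eqxx // big1 ?addr0 // => nu.
case/andP=> /andP[_ /andP[_ /eqP Enu]] /eqP[]; apply/val_inj/parts_inj.
by rewrite -[LHS]/(strict_seq nu) Enu -Emu.
Qed.

End Covers.

(** * Comparison of the two series *)

Lemma qint_opp (C : numClosedFieldType) (c : nat) :
  qint C (- c.+1%:Z) = qint C c.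
Proof. by rewrite /qint rmorphN /= -!pmulrn -natr1; congr (_ / _); ring. Qed.

Lemma kerov_x_sum (C : numClosedFieldType) (lam : seq nat) (m : int -> C) k :
  sorted gtn lam -> 0%N \notin lam -> (0 < k)%N ->
  \sum_(x <- kerov_x (double_diagram lam)) qint C x ^+ k * m x =
  \sum_(r <- iota 0 (size lam).+1 | growable lam r)
    qint C (nth 0%N lam r) ^+ k * (m (nth 0%N lam r) + m (- (nth 0%N lam r)%:Z - 1)).
Proof.
move=> slam lam0 k0; rewrite (perm_big _ (kerov_xE slam lam0)) big_cat !big_map !big_filter.
under [RHS]eq_bigr do rewrite mulrDr; rewrite big_split; congr (_ + _).
(* Row l(lambda) has the corner of content 0 but no partner of content -1; the extra term on the
   right carries the factor 0^k, which is 0 because k > 0. *)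
rewrite -[(size lam).+1]addn1 iotaD big_cat /= [X in _ + X]big_mkcond big_seq1 add0n.
rewrite nth_default // /qint mul0r mul0r expr0n gtn_eqF // mul0r if_same addr0.
apply: eq_bigr => r _; rewrite -!/(qint C _) qint_opp.
by congr (_ * m _); lia.
Qed.

Lemma part_prod (R : pzRingType) (f : nat -> R) (lam : seq nat) :
  \prod_(i < size lam) f (nth 0%N lam i) = \prod_(c <- lam) f c.
Proof. by rewrite (big_nth 0%N) big_mkord. Qed.

Theorem theorem1p1 (C : numClosedFieldType) (n : nat) (hn : (1 <= n)%N)
    (V : strict_part n -> bool -> spin_irr C n) (hV : spin_labelling V)
    (lam : strict_part n) (gamma : bool) (k : nat) (hk : (1 <= k)%N)
    (m : int -> C) (hm : transition_measure (double_diagram lam) m) :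
  galg_char (V lam gamma) (cond_exp (galg_exp (jucys_murphy C n.+1) (2 * k)%N))
    / (spin_dim (V lam gamma))%:R
  = \sum_(mu : strict_part n.+1 | covers lam mu)
      let c := skew_content lam mu in
      (c%:~R * (c%:~R + 1) / 2) ^+ k * (m c + m (- c - 1)).
Proof.
have [slam lam0] := strict_sorted lam.
have [phi [phi0 phiL phiJ]] := highest_colouring hn (spin_label_schur hV lam gamma).
have EJ (p : 'I_n) : ga_repr (V lam gamma) (young_elt C phi) *m
    ga_repr (V lam gamma) (jm_on C [set j : 'I_n | (j < p)%N] p ^+ 2) =
    colour_content C phi p *: ga_repr (V lam gamma) (young_elt C phi).
  by rewrite phiJ /colour_content valK.
rewrite (jm_character k phi0 EJ).
rewrite (covers_sum lam (fun c => (c%:~R * (c%:~R + 1) / 2) ^+ k * (m c + m (- c - 1)))).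
rewrite -(kerov_x_sum m slam lam0 hk).
have [_ _ _ trans] := hm.
have Hkerov := kerov_series (K := k.+1) (kerov_x_common slam lam0) (kerov_y_common slam lam0) trans.
have Hlevel := @level_series C k.+1 _ _ phi _ (leqnn n).
have Ecount i : colour_count phi n i = nth 0%N lam i.
  by rewrite -phiL; apply: eq_card => j; rewrite !inE ltn_ord.
move: Hlevel; under eq_bigr do rewrite Ecount; under [X in eqser _ _ X]eq_bigr do rewrite Ecount.
rewrite (part_prod (qlin C)) (part_prod (fun c => qlin C c.-1)) => Hlevel.
have D0 : (\prod_(c <- lam) qlin C c)`_0 = 1.
  elim: (strict_seq lam) => [|c s IH]; first by rewrite big_nil coef1.
  by rewrite big_cons coef_lin IH subr0.
(* Truncation at k + 1 keeps the coefficient of X^k, which is the identity sought. *)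
have := eqser_cancel D0 (eqser_trans Hlevel (eqser_sym Hkerov)) (ltnSn k).
by rewrite !coef_poly ltnSn.
Qed.
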